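(* Let $\nu$ be a finite positive Borel measure on $[0,1]$ such that $$\int_0^1 \frac{1}{1-r}\, d\nu(r) = \infty .$$ Let $$S_\nu(z,\lambda)=\frac{1}{1-z\bar\lambda}\int_0^1\frac{1}{1-rz\bar\lambda}\,d\nu(r),\qquad z,\lambda\in\mathbb{D}.$$ Then $S_\nu$ is the kernel of a radial logarithmically subharmonic weighted Bergman space (that is, there exists a radial logarithmically subharmonic weight $\omega$ on $\mathbb{D}$ with $\int_0^1 r\,\omega(r)\,dr<\infty$ such that $L_a^2(\omega)$ is a reproducing kernel Hilbert space whose reproducing kernel $K_\omega$ satisfies $K_\omega(z,\lambda)=S_\nu(z,\lambda)$ for all $z,\lambda\in\mathbb{D}$) if and only if there exists a logarithmically convex function $h:(0,\infty)\to(0,\infty)$ such that $$\left(\int_0^1 \frac{1-r^{n+1}}{1-r}\,d\nu(r)\right)\left(\int_0^\infty e^{-nt}h(t)\,dt\right)=1\qquad\text{for all } n\in\mathbb{N},$$ and $$\sup_{t\ge T} e^{t}h(t)<\infty\quad\text{for some constant } T>0.$$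
   Context: $\mathbb{D}$ is the open unit disk in $\mathbb{C}$, and $dA(z)=\frac{dx\,dy}{\pi}$ is the normalized area measure. $\mathbb{N}=\{0,1,2,\dots\}$ includes $0$. A weight on $\mathbb{D}$ is a nonnegative measurable function $\omega$ on $\mathbb{D}$. It is radial if $\omega(z)=\omega(|z|)$ for all $z\in\mathbb{D}$. It is logarithmically subharmonic if $\log\omega$ (with $\log 0=-\infty$) is subharmonic on $\mathbb{D}$; subharmonic functions are upper semicontinuous with values in $[-\infty,\infty)$ and satisfy the local submean inequality. The weighted Bergman space is $$L_a^2(\omega)=\Big\{f \text{ holomorphic on } \mathbb{D}:\ \|f\|^2=\int_{\mathbb{D}}|f(z)|^2\omega(z)\,dA(z)<\infty\Big\}.$$ It is a reproducing kernel Hilbert space if it is a Hilbert space for this norm and point evaluation at every point of $\mathbb{D}$ is bounded. In that case its reproducing kernel is the function $K_\omega$ with $K_\omega(\cdot,z)\in L_a^2(\omega)$ and $$f(z)=\int_{\mathbb{D}}f(\lambda)\overline{K_\omega(\lambda,z)}\,\omega(\lambda)\,dA(\lambda)$$ for all $f\in L_a^2(\omega)$ and $z\in\mathbb{D}$. A function $h:(0,\infty)\to(0,\infty)$ is logarithmically convex if $\log h$ is convex on $(0,\infty)$. At $r=1$ (relevant if $\nu(\{1\})>0$) the integrand $\frac{1}{1-r}$ is interpreted as $+\infty$ and $\frac{1-r^{n+1}}{1-r}=\sum_{k=0}^n r^k$ as $n+1$. *)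

(* Defs.v *)
From HB Require Import structures.
From mathcomp Require Import all_boot all_order all_algebra.
From mathcomp Require Import all_classical all_reals all_analysis.
From mathcomp Require Import complex.

Set Implicit Arguments.
Unset Strict Implicit.
Unset Printing Implicit Defensive.

Import Order.TTheory GRing.Theory Num.Theory.
Import numFieldNormedType.Exports.

Local Open Scope classical_set_scope.
Local Open Scope complex_scope.
Local Open Scope ring_scope.

(* Functions on the disk are represented by total functions on R[i]; every
   definition below only looks at their values on [disk R]. *)

Definition disk (R : realType) : set R[i] := [set z | `|z| < 1].

Definition cmod (R : realType) (z : R[i]) : R := ComplexField.Normc.normc z.

(* Measures live on R * R, which is identified with R[i] by [cplx]. *)
Definition cplx (R : realType) (p : R * R) : R[i] := p.1 +i* p.2.

Definition plane (R : realType) := (measurableTypeR R * measurableTypeR R)%type.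

Definition disk_xy (R : realType) : set (plane R) :=
  [set p | disk (cplx p)].

(* dA = dx dy / pi, so that the disk has area 1 *)
Definition disk_int (R : realType) (g : R[i] -> \bar R) : \bar R :=
  ((pi^-1)%:E *
   \int[(@lebesgue_measure R \x @lebesgue_measure R)%E]_(p in @disk_xy R)
      g (cplx p))%E.

Definition disk_cint (R : realType) (f : R[i] -> R[i]) : R[i] :=
  fine (disk_int (fun z => (complex.Re (f z))%:E))
  +i* fine (disk_int (fun z => (complex.Im (f z))%:E)).

Definition cint (R : realType) (mu : {measure set (measurableTypeR R) -> \bar R})
    (A : set R) (f : R -> R[i]) : R[i] :=
  (\int[mu]_(r in A) complex.Re (f r)) +i* (\int[mu]_(r in A) complex.Im (f r)).

(* [R[i]^o] is R[i] as a normed space over the field R[i], so [derivable] in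
   the direction 1 is existence of the complex derivative. *)
Definition holomorphic (R : realType) (f : R[i] -> R[i]) : Prop :=
  forall z, disk z -> derivable (f : R[i]^o -> R[i]^o) (z : R[i]^o) 1.

Definition weight (R : realType) (w : R[i] -> R) : Prop :=
  (forall z, disk z -> 0 <= w z) /\
  measurable_fun (@disk_xy R) (fun p : plane R => w (cplx p)).

(* the norm `|z| of R[i] is itself (real and) of type R[i] *)
Definition radial (R : realType) (w : R[i] -> R) : Prop :=
  forall z, disk z -> w z = w `|z|.

Definition upper_semicontinuous_disk (R : realType) (u : R[i] -> \bar R) :
    Prop :=
  forall z, disk z -> forall a : R, (u z < a%:E)%E ->
    \forall y \near (z : R[i]^o), (u y < a%:E)%E.

(* The integral of an extended real-valued function is the integral of its
   positive part, which is finite here by semicontinuity, minus that of its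
   negative part, so that it may be -oo. *)
Definition circle_mean (R : realType) (u : R[i] -> \bar R) (z : R[i]) (rho : R)
    : \bar R :=
  (((2 * pi)^-1)%:E *
   \int[@lebesgue_measure R]_(t in `[0%R, (2 * pi)%R])
      u (z + rho%:C * (cos t +i* sin t))%R)%E.

Definition subharmonic (R : realType) (u : R[i] -> \bar R) : Prop :=
  [/\ forall z, disk z -> (u z < +oo)%E,
      upper_semicontinuous_disk u &
      forall z, disk z -> exists2 rho0 : R, 0 < rho0 &
        forall rho : R, 0 < rho < rho0 -> (u z <= circle_mean u z rho)%E].

Definition log_subharmonic (R : realType) (w : R[i] -> R) : Prop :=
  subharmonic (fun z => lne (w z)%:E).

Definition bergman_sqnorm (R : realType) (w : R[i] -> R) (f : R[i] -> R[i]) :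
    \bar R :=
  disk_int (fun z => (cmod (f z) ^+ 2 * w z)%:E).

Definition bergman (R : realType) (w : R[i] -> R) : set (R[i] -> R[i]) :=
  [set f | holomorphic f /\ (bergman_sqnorm w f < +oo)%E].

Definition bergman_norm (R : realType) (w : R[i] -> R) (f : R[i] -> R[i]) : R :=
  Num.sqrt (fine (bergman_sqnorm w f)).

(* For any weight, [bergman w] is a complex vector space and [bergman_norm w]
   is the seminorm of a positive semidefinite Hermitian form on it, so it is a
   Hilbert space as soon as the seminorm is definite and complete. *)
Definition bergman_hilbert (R : realType) (w : R[i] -> R) : Prop :=
  (forall f, bergman w f -> bergman_norm w f = 0 ->
     forall z, disk z -> f z = 0) /\
  (forall u : nat -> (R[i] -> R[i]),
     (forall n, bergman w (u n)) ->
     (forall e : R, 0 < e -> exists N : nat, forall m n : nat,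
        (N <= m)%N -> (N <= n)%N ->
        bergman_norm w (fun z => u m z - u n z) < e) ->
     exists2 f, bergman w f &
       bergman_norm w (fun z => u n z - f z) @[n --> \oo] --> (0 : R)).

Definition bergman_rkhs (R : realType) (w : R[i] -> R) : Prop :=
  bergman_hilbert w /\
  (forall z, disk z -> exists M : R, forall f, bergman w f ->
     cmod (f z) <= M * bergman_norm w f).

Definition reproducing_kernel (R : realType) (w : R[i] -> R)
    (K : R[i] -> R[i] -> R[i]) : Prop :=
  (forall z, disk z -> bergman w (fun l => K l z)) /\
  (forall f z, bergman w f -> disk z ->
     f z = disk_cint (fun l => f l * conjc (K l z) * (w l)%:C)).

Definition radial_log_subharmonic_bergman_kernel (R : realType)
    (S : R[i] -> R[i] -> R[i]) : Prop :=
  exists w : R[i] -> R,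
    [/\ weight w, radial w, log_subharmonic w &
        (\int[@lebesgue_measure R]_(r in `]0%R, 1%R[)
           (r * w r%:C)%:E < +oo)%E] /\
    bergman_rkhs w /\
    exists2 K, reproducing_kernel w K &
      forall z l, disk z -> disk l -> K z l = S z l.

Definition S_nu (R : realType) (nu : {measure set (measurableTypeR R) -> \bar R})
    (z l : R[i]) : R[i] :=
  (1 - z * conjc l)^-1 *
  cint nu `[0, 1] (fun r => (1 - r%:C * z * conjc l)^-1).

Definition inv_one_minus (R : realType) (r : R) : \bar R :=
  if r == 1 then +oo%E else ((1 - r)^-1)%:E.

Definition geom_quot (R : realType) (n : nat) (r : R) : R :=
  if r == 1 then n.+1%:R else (1 - r ^+ n.+1) / (1 - r).

Definition log_convex (R : realType) (h : R -> R) : Prop :=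
  convex_function (E := R^o) `]0, +oo[ (fun t : R => ln (h t)).

(* Main.v *)
(* The substitution r = e^(-t/2) turns a radial weight w into
   h t = e^(-t) w (e^(-t/2)), and the moments 2 int r^(2n+1) w(r) dr into the
   Laplace transform of h at n.  The weight w is logarithmically subharmonic
   exactly when log h is convex and e^t h is bounded near infinity (or w = 0 on
   the punctured disk): Jensen's formula for the circle mean of log |z| gives
   both directions, through a maximum principle for the necessity and through
   supporting lines of log h for the sufficiency.  By Parseval's identity a
   holomorphic function sum a_k z^k has squared norm sum |a_k|^2 m_k, m_k being
   the k-th moment; hence the reproducing kernel is sum (z conj(l))^k / m_k,
   whereas S_nu is sum c_k (z conj(l))^k with
   c_k = int (1 - r^(k+1)) / (1 - r) dnu(r).  The theorem is therefore the
   identity c_k m_k = 1 for all k.  Holomorphic functions are expanded in power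
   series by Goursat's subdivision argument in polar-like coordinates, and the
   boundedness of c_k r^k for r < 1 makes L^2_a(w) a Hilbert space. *)

Require Import Defs.
From HB Require Import structures.
From mathcomp Require Import all_boot all_order all_algebra.
From mathcomp Require Import all_classical all_reals all_analysis.
From mathcomp Require Import complex.
From mathcomp Require Import measurable_realfun ring lra.

Set Implicit Arguments.
Unset Strict Implicit.
Unset Printing Implicit Defensive.

Import Order.TTheory GRing.Theory Num.Theory.
Import numFieldNormedType.Exports.

Local Open Scope classical_set_scope.
Local Open Scope ring_scope.

Arguments cmod : simpl never.

(** Cauchy's formula concerns [f w dw / (w - z)], which is singular at [z]. Pulled back along the
    contraction of a circle to [z], the form is regular for [s >= eps]; Goursat's argument applies
    on that rectangle, and continuity of [f] at [z] handles [eps -> 0].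

    Limits are taken through explicit errors [C * q ^+ n] with [q < 1], so that series and integrals
    are exchanged only for finite sums or nonnegative terms.

    The bound on [e^t h] governs the origin. Since [e^t h(t) = w(e^(-t/2))], convexity of [log h]
    alone would admit [w = |z|^(-a)] with [a > 0], whose logarithm is superharmonic at 0. A convex
    function bounded above near infinity is nonincreasing, so the bound makes [w] nondecreasing in
    [|z|], and its infimum is then the right value at 0.

    As [w] may vanish, [log w] takes the value [-oo]. Upper bounds are therefore handled
    multiplicatively, on [w] times the exponential of a comparison function, and circle means are
    compared by a monotonicity lemma for arbitrary functions. *)

(** * Modulus, real and imaginary parts *)

Lemma cmodE (R : realType) (z : R[i]) :
  cmod z = Num.sqrt (complex.Re z ^+ 2 + complex.Im z ^+ 2).
Proof. by case: z. Qed.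

Lemma normc_cmod (R : realType) (z : R[i]) : `|z| = ((cmod z)%:C)%C.
Proof. by rewrite normc_def cmodE. Qed.

Lemma cmod_ge0 (R : realType) (z : R[i]) : 0 <= cmod z.
Proof. by rewrite cmodE sqrtr_ge0. Qed.
#[export] Hint Resolve cmod_ge0 : core.

Lemma cmod0 (R : realType) : cmod (0 : R[i]) = 0.
Proof. exact: ComplexField.Normc.normc0. Qed.

Lemma cmod1 (R : realType) : cmod (1 : R[i]) = 1.
Proof. exact: ComplexField.Normc.normc1. Qed.

Lemma cmod_eq0 (R : realType) (z : R[i]) : (cmod z == 0) = (z == 0).
Proof.
apply/eqP/eqP => [|->]; last exact: cmod0.
exact: ComplexField.Normc.eq0_normc.
Qed.

Lemma cmod_gt0 (R : realType) (z : R[i]) : (0 < cmod z) = (z != 0).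
Proof. by rewrite lt_def cmod_ge0 andbT cmod_eq0. Qed.

Lemma cmodM (R : realType) (x y : R[i]) : cmod (x * y) = cmod x * cmod y.
Proof. exact: ComplexField.Normc.normcM. Qed.

Lemma cmodV (R : realType) (x : R[i]) : cmod x^-1 = (cmod x)^-1.
Proof. exact: ComplexField.Normc.normcV. Qed.

Lemma cmodN (R : realType) (x : R[i]) : cmod (- x) = cmod x.
Proof. exact: complex.normcN. Qed.

Lemma cmodX (R : realType) (x : R[i]) n : cmod (x ^+ n) = cmod x ^+ n.
Proof. by elim: n => [|n IH]; rewrite ?expr0 ?cmod1// !exprS cmodM IH. Qed.

Lemma cmodD (R : realType) (x y : R[i]) : cmod (x + y) <= cmod x + cmod y.
Proof. exact: complex.le_normcD. Qed.

Lemma cmodB (R : realType) (x y : R[i]) : cmod (x - y) <= cmod x + cmod y.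
Proof. by rewrite -(cmodN y) cmodD. Qed.

Lemma cmodBC (R : realType) (x y : R[i]) : cmod (x - y) = cmod (y - x).
Proof. by rewrite -cmodN opprB. Qed.

Lemma cmod_sum (R : realType) (I : Type) (s : seq I) (P : pred I) (F : I -> R[i]) :
  cmod (\sum_(i <- s | P i) F i) <= \sum_(i <- s | P i) cmod (F i).
Proof.
elim/big_ind2 : _ => [|x1 x2 y1 y2 h1 h2|//]; first by rewrite cmod0.
by rewrite (le_trans (cmodD _ _))// lerD.
Qed.

Lemma cmod_sub_ge (R : realType) (x y : R[i]) : cmod x - cmod y <= cmod (x - y).
Proof. by rewrite lerBlDr (le_trans _ (cmodD _ _))// subrK. Qed.

Lemma cmodr (R : realType) (x : R) : cmod (x%:C)%C = `|x|.
Proof. by rewrite cmodE/= expr0n addr0 sqrtr_sqr. Qed.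

Lemma cmod_conj (R : realType) (z : R[i]) : cmod (conjc z) = cmod z.
Proof. by case: z => a b; rewrite !cmodE/= sqrrN. Qed.

Lemma cmod_sq (R : realType) (z : R[i]) :
  cmod z ^+ 2 = complex.Re z ^+ 2 + complex.Im z ^+ 2.
Proof. by rewrite cmodE sqr_sqrtr// addr_ge0// sqr_ge0. Qed.

Lemma Re_le_cmod (R : realType) (z : R[i]) : `|complex.Re z| <= cmod z.
Proof. by rewrite cmodE -sqrtr_sqr ler_wsqrtr// lerDl sqr_ge0. Qed.

Lemma Im_le_cmod (R : realType) (z : R[i]) : `|complex.Im z| <= cmod z.
Proof. by rewrite cmodE -sqrtr_sqr ler_wsqrtr// lerDr sqr_ge0. Qed.

Lemma cmod_le_ReIm (R : realType) (z : R[i]) :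
  cmod z <= `|complex.Re z| + `|complex.Im z|.
Proof.
have [a0 b0] := (normr_ge0 (complex.Re z), normr_ge0 (complex.Im z)).
rewrite -[leRHS]ger0_norm ?addr_ge0// -sqrtr_sqr cmodE ler_wsqrtr//.
rewrite sqrrD !real_normK ?num_real//.
by have := mulr_ge0 a0 b0; lra.
Qed.

Lemma ReD (R : realType) (x y : R[i]) :
  complex.Re (x + y) = complex.Re x + complex.Re y.
Proof. by case: x y => [a b] []. Qed.
Lemma ImD (R : realType) (x y : R[i]) :
  complex.Im (x + y) = complex.Im x + complex.Im y.
Proof. by case: x y => [a b] []. Qed.
Lemma ReN (R : realType) (x : R[i]) : complex.Re (- x) = - complex.Re x.
Proof. by case: x. Qed.
Lemma ImN (R : realType) (x : R[i]) : complex.Im (- x) = - complex.Im x.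
Proof. by case: x. Qed.
Lemma ReB (R : realType) (x y : R[i]) :
  complex.Re (x - y) = complex.Re x - complex.Re y.
Proof. by rewrite ReD ReN. Qed.
Lemma ImB (R : realType) (x y : R[i]) :
  complex.Im (x - y) = complex.Im x - complex.Im y.
Proof. by rewrite ImD ImN. Qed.
Lemma ReM (R : realType) (x y : R[i]) : complex.Re (x * y) =
  complex.Re x * complex.Re y - complex.Im x * complex.Im y.
Proof. by case: x y => [a b] []. Qed.
Lemma ImM (R : realType) (x y : R[i]) : complex.Im (x * y) =
  complex.Re x * complex.Im y + complex.Im x * complex.Re y.
Proof. by case: x y => [a b] []. Qed.

Lemma complexP (R : realType) (x y : R[i]) : complex.Re x = complex.Re y ->
  complex.Im x = complex.Im y -> x = y.
Proof. by case: x y => [a b] [c d]/= -> ->. Qed.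

Lemma disk_cmod (R : realType) (z : R[i]) : disk z <-> cmod z < 1.
Proof. by rewrite /disk/= normc_cmod (_ : 1 = (1%:C)%C)// ltcR. Qed.

(** * The unit circle *)

Definition expi (R : realType) (t : R) : R[i] := (cos t +i* sin t)%C.

Lemma expiD (R : realType) (s t : R) : expi (s + t) = expi s * expi t.
Proof. by apply: complexP; rewrite ?ReM ?ImM/= ?cosD ?sinD//; ring. Qed.

Lemma expi0 (R : realType) : expi (0 : R) = 1.
Proof. by rewrite /expi cos0 sin0. Qed.

Lemma cmod_expi (R : realType) (t : R) : cmod (expi t) = 1.
Proof. by rewrite cmodE/= cos2Dsin2 sqrtr1. Qed.

Lemma expiN (R : realType) (t : R) : expi (- t) = conjc (expi t).
Proof. by rewrite /expi cosN sinN. Qed.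

Lemma expiX (R : realType) (t : R) n : expi t ^+ n = expi (n%:R * t).
Proof.
elim: n => [|n IH]; first by rewrite mul0r expi0 expr0.
by rewrite exprS IH -expiD -natr1 mulrDl mul1r addrC.
Qed.

Lemma expi_neq0 (R : realType) (t : R) : expi t != 0.
Proof. by rewrite -cmod_gt0 cmod_expi. Qed.

Lemma expi_conj (R : realType) (t : R) : expi t * conjc (expi t) = 1.
Proof. by rewrite -expiN -expiD subrr expi0. Qed.

Lemma expiDpi (R : realType) (t : R) : expi (t + pi) = - expi t.
Proof. by apply: complexP; rewrite /= ?cosDpi ?sinDpi. Qed.

Lemma expiD2pi (R : realType) (t : R) : expi (t + 2 * pi) = expi t.
Proof. by rewrite mulr_natl mulr2n addrA !expiDpi opprK. Qed.

(** * Continuity of complex functions of a real variable *)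

(** Stated with real radii, because the norm of [R[i]] takes its values in [R[i]] while the variable
    and all estimates are real. *)
Definition rcont (R : realType) (g : R -> R[i]) (t : R) :=
  forall e : R, 0 < e ->
    exists2 d : R, 0 < d & forall u, `|u - t| < d -> cmod (g u - g t) < e.

Lemma continuous_epsP (R : realType) (f : R -> R) (t : R) :
  {for t, continuous f} <-> forall e : R, 0 < e ->
    exists2 d : R, 0 < d & forall u, `|u - t| < d -> `|f u - f t| < e.
Proof.
split=> [/cvgrPdist_lt h e e0|h].
  have /nbhs_ballP[d/= d0 hd] := h e e0.
  exists d => // u ut; rewrite distrC; apply: hd.
  by rewrite /ball/= distrC.
apply/cvgrPdist_lt => e e0; have [d d0 hd] := h e e0.
apply/nbhs_ballP; exists d => //= u; rewrite /ball/= => ut.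
by rewrite distrC hd// distrC.
Qed.

Lemma eq_for_continuous (R : realType) (f g : R -> R) (t : R) :
  f =1 g -> {for t, continuous f} -> {for t, continuous g}.
Proof. by move=> /funext ->. Qed.

Lemma eq_rcont (R : realType) (f g : R -> R[i]) (t : R) :
  f =1 g -> rcont f t -> rcont g t.
Proof. by move=> /funext ->. Qed.

Lemma rcontP (R : realType) (g : R -> R[i]) (t : R) :
  rcont g t <-> {for t, continuous (fun u => complex.Re (g u))} /\
                {for t, continuous (fun u => complex.Im (g u))}.
Proof.
split=> [h|[/continuous_epsP h1 /continuous_epsP h2]].
  split; apply/continuous_epsP => e e0; have [d d0 hd] := h e e0; exists d => // u ut.
    by rewrite -ReB (le_lt_trans (Re_le_cmod _))// hd.
  by rewrite -ImB (le_lt_trans (Im_le_cmod _))// hd.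
move=> e e0; have e2 : 0 < e / 2 by rewrite divr_gt0.
have [d1 d10 hd1] := h1 _ e2; have [d2 d20 hd2] := h2 _ e2.
exists (Num.min d1 d2); first by rewrite lt_min d10.
move=> u; rewrite lt_min => /andP[u1 u2].
rewrite (le_lt_trans (cmod_le_ReIm _))// [ltRHS]splitr ltrD// ?ReB ?ImB.
  exact: hd1.
exact: hd2.
Qed.

Lemma rcont_cst (R : realType) (c : R[i]) (t : R) : rcont (fun _ => c) t.
Proof. by move=> e e0; exists 1 => // u _; rewrite subrr cmod0. Qed.

Lemma rcontD (R : realType) (f g : R -> R[i]) (t : R) :
  rcont f t -> rcont g t -> rcont (fun u => f u + g u) t.
Proof.
move=> /rcontP[f1 f2] /rcontP[g1 g2]; apply/rcontP; split.
  apply: eq_for_continuous (fun u => esym (ReD _ _)) _; exact: (@cvgD _ R^o).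
apply: eq_for_continuous (fun u => esym (ImD _ _)) _; exact: (@cvgD _ R^o).
Qed.

Lemma rcontN (R : realType) (f : R -> R[i]) (t : R) :
  rcont f t -> rcont (fun u => - f u) t.
Proof.
move=> /rcontP[f1 f2]; apply/rcontP; split.
  apply: eq_for_continuous (fun u => esym (ReN _)) _; exact: (@cvgN _ R^o).
apply: eq_for_continuous (fun u => esym (ImN _)) _; exact: (@cvgN _ R^o).
Qed.

Lemma rcontB (R : realType) (f g : R -> R[i]) (t : R) :
  rcont f t -> rcont g t -> rcont (fun u => f u - g u) t.
Proof. by move=> cf cg; apply: rcontD => //; exact: rcontN. Qed.

Lemma rcontM (R : realType) (f g : R -> R[i]) (t : R) :
  rcont f t -> rcont g t -> rcont (fun u => f u * g u) t.
Proof.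
move=> /rcontP[f1 f2] /rcontP[g1 g2]; apply/rcontP; split.
  apply: eq_for_continuous (fun u => esym (ReM _ _)) _; apply: (@cvgB _ R^o); exact: cvgM.
apply: eq_for_continuous (fun u => esym (ImM _ _)) _; apply: (@cvgD _ R^o); exact: cvgM.
Qed.

Lemma rcont_real (R : realType) (f : R -> R) (t : R) :
  {for t, continuous f} -> rcont (fun u => (f u)%:C%C) t.
Proof. by move=> h; apply/rcontP; split => //=; exact: cvg_cst. Qed.

Lemma rcont_conj (R : realType) (f : R -> R[i]) (t : R) :
  rcont f t -> rcont (fun u => conjc (f u)) t.
Proof.
move=> h e e0; have [d d0 hd] := h e e0; exists d => // u /hd.
by rewrite -raddfB cmod_conj.
Qed.

Lemma rcontX (R : realType) (f : R -> R[i]) (t : R) n :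
  rcont f t -> rcont (fun u => f u ^+ n) t.
Proof.
move=> cf; elim: n => [|n IH]; first exact: rcont_cst.
by under eq_fun do rewrite exprS; exact: rcontM.
Qed.

Lemma rcont_expi (R : realType) (t : R) : rcont (@expi R) t.
Proof. by apply/rcontP; split; [exact: continuous_cos|exact: continuous_sin]. Qed.

Lemma rcont_sum (R : realType) (I : Type) (s : seq I) (P : pred I)
    (F : I -> R -> R[i]) (t : R) :
  (forall i, rcont (F i) t) -> rcont (fun u => \sum_(i <- s | P i) F i u) t.
Proof.
move=> cF; elim: s => [|i s IH].
  by under eq_fun do rewrite big_nil; exact: rcont_cst.
under eq_fun do rewrite big_cons.
by case: (P i) => //; exact: rcontD.
Qed.

(** * Complex continuity and differentiability *)

Definition ccont (R : realType) (f : R[i] -> R[i]) (z : R[i]) :=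
  forall e : R, 0 < e ->
    exists2 d : R, 0 < d & forall w, cmod (w - z) < d -> cmod (f w - f z) < e.

Lemma rcont_comp (R : realType) (f : R[i] -> R[i]) (g : R -> R[i]) (t : R) :
  ccont f (g t) -> rcont g t -> rcont (fun u => f (g u)) t.
Proof.
move=> cf cg e e0; have [d d0 hd] := cf e e0; have [d' d'0 hd'] := cg d d0.
by exists d' => // u /hd'; exact: hd.
Qed.

Lemma cont_cmod (R : realType) (g : R -> R[i]) (t : R) :
  rcont g t -> {for t, continuous (fun u => cmod (g u))}.
Proof.
move=> cg; apply/continuous_epsP => e e0; have [d d0 hd] := cg e e0.
exists d => // u ut; rewrite (le_lt_trans _ (hd u ut))//.
rewrite ler_norml cmod_sub_ge andbT lerNl opprB cmodBC; exact: cmod_sub_ge.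
Qed.

Lemma ccontV (R : realType) (z : R[i]) : z != 0 -> ccont (fun w => w^-1) z.
Proof.
move=> z0 e e0; have m0 : 0 < cmod z by rewrite cmod_gt0.
(* The first radius keeps [cmod w] above [cmod z / 2], so that [|z - w| / |w z|] is at most
   [2 |z - w| / |z|^2]; the second makes this less than [e]. *)
exists (Num.min (cmod z / 2) (e * cmod z ^+ 2 / 2)).
  by rewrite lt_min !divr_gt0// mulr_gt0// exprn_gt0.
move=> w; rewrite lt_min => /andP[w1 w2].
have wz : cmod z / 2 < cmod w.
  have := cmod_sub_ge z (z - w); rewrite subKr cmodBC => /(lt_le_trans _); apply.
  by rewrite [in ltRHS](splitr (cmod z)) -addrA ltrDl subr_gt0.
have w0 : w != 0 by rewrite -cmod_gt0 (lt_trans _ wz)// divr_gt0.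
have -> : w^-1 - z^-1 = (z - w) / (w * z) by field; rewrite ?w0 ?z0.
rewrite cmodM cmodV cmodM cmodBC ltr_pdivrMr ?mulr_gt0 ?cmod_gt0//.
rewrite (lt_le_trans w2)// -mulrA ler_pM2l// expr2 mulrAC -mulrA mulrC.
by rewrite ler_pM2r// ltW// mulrC.
Qed.

Lemma rcontV (R : realType) (f : R -> R[i]) (t : R) :
  f t != 0 -> rcont f t -> rcont (fun u => (f u)^-1) t.
Proof. by move=> f0; apply: rcont_comp; exact: ccontV. Qed.

(** The difference quotient with its denominator cleared: no case distinction at [w = z], and the
    first-order remainder is directly what Goursat's argument estimates. *)
Definition cdiff (R : realType) (f : R[i] -> R[i]) (z d : R[i]) :=
  forall e : R, 0 < e -> exists2 r : R, 0 < r & forall w, cmod (w - z) < r ->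
    cmod (f w - f z - d * (w - z)) <= e * cmod (w - z).

Lemma cdiff_ccont (R : realType) (f : R[i] -> R[i]) (z d : R[i]) :
  cdiff f z d -> ccont f z.
Proof.
move=> h e e0; have [r r0 hr] := h 1 ltr01.
have c0 : 0 < 1 + cmod d by have := cmod_ge0 d; lra.
exists (Num.min r (e / (1 + cmod d))); first by rewrite lt_min r0 divr_gt0.
move=> w; rewrite lt_min => /andP[w1 w2].
rewrite -(subrK (d * (w - z)) (f w - f z)) (le_lt_trans (cmodD _ _))//.
have := hr _ w1; rewrite mul1r => /(fun x => lerD x (lexx (cmod (d * (w - z))))).
move=> /le_lt_trans; apply; rewrite cmodM -[X in X + _]mul1r -mulrDl mulrC.
by rewrite -ltr_pdivlMr.
Qed.

(** In the partial order of [R[i]] a positive element is real, so balls with radius in [R[i]] are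
    the balls with real radius. *)
Lemma nbhsC_ball (R : realType) (z : R[i]) (P : set R[i]) :
  nbhs (z : R[i]^o) P <->
  exists2 d : R, 0 < d & forall w, cmod (w - z) < d -> P w.
Proof.
split.
  move/nbhs_ballP => [d/= d0 hd]; exists (complex.Re d).
    by move: d0; rewrite ltcE/= => /andP[].
  move=> w wz; apply: hd; rewrite /ball/= distrC normc_cmod.
  case: d d0 wz => [a b]; rewrite ltcE/= => /andP[/eqP -> _] wz.
  by rewrite (_ : (a +i* 0)%C = (a%:C)%C)// ltcR.
move=> [d d0 hd]; apply/nbhs_ballP; exists (d%:C)%C; first by rewrite /= ltcR.
by move=> w; rewrite /ball/= distrC normc_cmod ltcR => /hd.
Qed.

Lemma derivable_cdiffP (R : realType) (f : R[i] -> R[i]) (z : R[i]) :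
  derivable (f : R[i]^o -> R[i]^o) (z : R[i]^o) 1 <-> exists d, cdiff f z d.
Proof.
split.
  move=> /cvg_ex[/= d hd]; exists d => e e0.
  move: hd => /cvgrPdist_le/(_ (e%:C)%C).
  have e0' : 0 < (e%:C)%C by rewrite ltcR.
  move=> /(_ e0')/nbhs_ballP[r/= r0 hr].
  have := (nbhsC_ball (0 : R[i]) (ball (0 : R[i]^o) r)).1.
  case; first by apply/nbhs_ballP; exists r.
  move=> d' d'0 hd'; exists d' => // w wz.
  have [->|wnz] := eqVneq w z; first by rewrite !subrr mulr0 subr0 cmod0 mulr0.
  have wz0 : w - z != 0 by rewrite subr_eq0.
  have bz : ball (0 : R[i]^o) r (w - z) by apply: hd'; rewrite subr0.
  have := hr (w - z) bz wz0.
  rewrite /GRing.scale/= mulr1 subrK normc_cmod lecR.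
  have -> : d - (w - z)^-1 * (f w - f z) = - (w - z)^-1 * (f w - f z - d * (w - z)).
    by field.
  by rewrite cmodM cmodN cmodV mulrC ler_pdivrMr// cmod_gt0.
move=> [d hd]; apply/cvg_ex; exists d; apply/cvgrPdist_le => e e0.
have eE : e = ((complex.Re e)%:C)%C.
  by case: e e0 => a b; rewrite ltcE/= => /andP[/eqP -> _].
have e0' : 0 < complex.Re e by rewrite -ltcR -eE.
have [r r0 hr] := hd _ e0'.
apply/(nbhsC_ball (0 : R[i])); exists r => // h; rewrite subr0 => hr0 h0.
have := hr (h + z); rewrite addrK => /(_ hr0).
rewrite /GRing.scale/= mulr1 normc_cmod {2}eE lecR.
have -> : d - h^-1 * (f (h + z) - f z) = - h^-1 * (f (h + z) - f z - d * h).
  by field.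
by move=> hh; rewrite cmodM cmodN cmodV mulrC ler_pdivrMr// cmod_gt0.
Qed.

Lemma holomorphicP (R : realType) (f : R[i] -> R[i]) :
  holomorphic f <-> forall z, cmod z < 1 -> exists d, cdiff f z d.
Proof.
split=> [h z /disk_cmod/h/derivable_cdiffP//|h z /disk_cmod/h].
by move/derivable_cdiffP.
Qed.

(** * Integrals of continuous functions over compact intervals *)

Definition ri (R : realType) (a b : R) (f : R -> R) : R :=
  \int[@lebesgue_measure R]_(x in `[a, b]) f x.

Lemma within_cont (R : realType) (a b : R) (f : R -> R) :
  (forall t, a <= t <= b -> {for t, continuous f}) ->
  {within `[a, b], continuous f}.
Proof.
move=> cf; apply: continuous_in_subspaceT => t /set_mem/=.
by rewrite in_itv/= => /cf.
Qed.

Lemma cont_integrable (R : realType) (a b : R) (f : R -> R) :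
  (forall t, a <= t <= b -> {for t, continuous f}) ->
  (@lebesgue_measure R).-integrable `[a, b] (EFin \o f).
Proof.
move=> cf; apply: continuous_compact_integrable; first exact: segment_compact.
exact: within_cont.
Qed.

Lemma ri_EFin (R : realType) (a b : R) (f : R -> R) :
  (forall t, a <= t <= b -> {for t, continuous f}) ->
  (\int[@lebesgue_measure R]_(x in `[a, b]) (f x)%:E = (ri a b f)%:E)%E.
Proof.
move=> cf; rewrite /ri /Rintegral fineK//.
by apply: integrable_fin_num => //; exact: cont_integrable.
Qed.

Lemma riD (R : realType) (a b : R) (f g : R -> R) :
  (forall t, a <= t <= b -> {for t, continuous f}) ->
  (forall t, a <= t <= b -> {for t, continuous g}) ->
  ri a b (fun x => f x + g x) = ri a b f + ri a b g.
Proof. by move=> cf cg; rewrite /ri RintegralD//; exact: cont_integrable. Qed.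

Lemma riZ (R : realType) (a b k : R) (f : R -> R) :
  (forall t, a <= t <= b -> {for t, continuous f}) ->
  ri a b (fun x => k * f x) = k * ri a b f.
Proof. by move=> cf; rewrite /ri RintegralZl//; exact: cont_integrable. Qed.

Lemma ri_cst (R : realType) (a b c : R) : a <= b ->
  ri a b (fun _ => c) = c * (b - a).
Proof.
move=> ab; rewrite /ri Rintegral_cst//= lebesgue_measure_itv/= lte_fin.
have [//|ba|->] := ltgtP a b; first by rewrite leNgt ba in ab.
by rewrite /= subrr mulr0.
Qed.

Lemma ri_le (R : realType) (a b : R) (f g : R -> R) :
  (forall t, a <= t <= b -> {for t, continuous f}) ->
  (forall t, a <= t <= b -> {for t, continuous g}) ->
  (forall t, a <= t <= b -> f t <= g t) -> ri a b f <= ri a b g.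
Proof.
move=> cf cg fg; apply: le_Rintegral => //; exact: cont_integrable.
Qed.

Lemma ri_bound (R : realType) (a b M : R) (f : R -> R) : a <= b ->
  (forall t, a <= t <= b -> {for t, continuous f}) ->
  (forall t, a <= t <= b -> `|f t| <= M) -> `|ri a b f| <= M * (b - a).
Proof.
move=> ab cf fM; rewrite ler_norml -mulNr -!ri_cst//; apply/andP; split.
  apply: ri_le => // [t _|t /fM]; first exact: cvg_cst.
  by rewrite ler_norml => /andP[].
apply: ri_le => // [t _|t /fM]; first exact: cvg_cst.
by rewrite ler_norml => /andP[].
Qed.

Lemma ri_split (R : realType) (a b c : R) (f : R -> R) : a <= b -> b <= c ->
  (forall t, a <= t <= c -> {for t, continuous f}) ->
  ri a c f = ri a b f + ri b c f.
Proof.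
move=> ab bc cf; rewrite /ri.
have := @Rintegral_itvB R f (BLeft a) (BRight c) b (cont_integrable cf).
rewrite !bnd_simp ab bc => /(_ isT isT); rewrite Rintegral_itv_obnd_cbnd.
  by move=> <-; rewrite addrC subrK.
apply: (integrableS _ _ _ (cont_integrable cf)) => //.
by apply: subset_itvr; rewrite bnd_simp.
Qed.

Lemma eq_ri (R : realType) (a b : R) (f g : R -> R) :
  (forall t, a <= t <= b -> f t = g t) -> ri a b f = ri a b g.
Proof.
move=> fg; apply: eq_Rintegral => x /set_mem/=.
by rewrite in_itv/=; exact: fg.
Qed.

Lemma ri_FTC (R : realType) (a b : R) (f F : R -> R) : a <= b ->
  (forall t, {for t, continuous f}) -> (forall t : R, is_derive t (1 : R) F (f t)) ->
  ri a b f = F b - F a.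
Proof.
move=> ab cf dF; have [ab'|ba|<-] := ltgtP a b; last 2 first.
- by rewrite leNgt ba in ab.
- by rewrite subrr /ri set_itv1 Rintegral_set1.
have cF t : {for t, continuous F}.
  by apply: differentiable_continuous; apply/derivable1_diffP; case: (dF t).
rewrite /ri /Rintegral (@continuous_FTC2 _ f F)//.
- exact: within_cont.
- split; first by move=> x _; case: (dF x).
  + by apply: cvg_at_right_filter; exact: cF.
  + by apply: cvg_at_left_filter; exact: cF.
- by move=> x _; rewrite derive1E; case: (dF x).
Qed.

(** * Integrals of complex-valued functions *)

Definition ci (R : realType) (a b : R) (g : R -> R[i]) : R[i] :=
  (ri a b (fun t => complex.Re (g t)) +i* ri a b (fun t => complex.Im (g t)))%C.

Lemma rcontRe (R : realType) (g : R -> R[i]) t :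
  rcont g t -> {for t, continuous (fun u => complex.Re (g u))}.
Proof. by case/rcontP. Qed.

Lemma rcontIm (R : realType) (g : R -> R[i]) t :
  rcont g t -> {for t, continuous (fun u => complex.Im (g u))}.
Proof. by case/rcontP. Qed.

Lemma eq_ci (R : realType) (a b : R) (f g : R -> R[i]) :
  (forall t, a <= t <= b -> f t = g t) -> ci a b f = ci a b g.
Proof. by move=> fg; apply: complexP; apply: eq_ri => t /fg ->. Qed.

Lemma ciD (R : realType) (a b : R) (f g : R -> R[i]) :
  (forall t, a <= t <= b -> rcont f t) -> (forall t, a <= t <= b -> rcont g t) ->
  ci a b (fun t => f t + g t) = ci a b f + ci a b g.
Proof.
move=> cf cg; apply: complexP; rewrite ?ReD ?ImD/= -riD.
- by apply: eq_ri => t _; rewrite ReD.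
- by move=> t /cf/rcontRe.
- by move=> t /cg/rcontRe.
- by apply: eq_ri => t _; rewrite ImD.
- by move=> t /cf/rcontIm.
- by move=> t /cg/rcontIm.
Qed.

Lemma cont_scale (R : realType) (k : R) (f : R -> R) t :
  {for t, continuous f} -> {for t, continuous (fun u => k * f u)}.
Proof. by move=> cf; apply: cvgM => //; exact: cvg_cst. Qed.

Lemma ciZ (R : realType) (a b : R) (k : R[i]) (f : R -> R[i]) :
  (forall t, a <= t <= b -> rcont f t) ->
  ci a b (fun t => k * f t) = k * ci a b f.
Proof.
move=> cf.
have c1 t : a <= t <= b -> {for t, continuous (fun u => complex.Re (f u))}.
  by move=> /cf/rcontRe.
have c2 t : a <= t <= b -> {for t, continuous (fun u => complex.Im (f u))}.
  by move=> /cf/rcontIm.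
have c1' x t : a <= t <= b -> {for t, continuous (fun u => x * complex.Re (f u))}.
  by move=> /c1/cont_scale; exact.
have c2' x t : a <= t <= b -> {for t, continuous (fun u => x * complex.Im (f u))}.
  by move=> /c2/cont_scale; exact.
apply: complexP; rewrite ?ReM ?ImM/=.
  rewrite -mulNr -(riZ _ c1) -(riZ _ c2) -(riD (c1' _) (c2' _)).
  by apply: eq_ri => t _; rewrite ReM mulNr.
rewrite -(riZ _ c1) -(riZ _ c2) -(riD (c2' _) (c1' _)).
by apply: eq_ri => t _; rewrite ImM.
Qed.

Lemma ciN (R : realType) (a b : R) (f : R -> R[i]) :
  (forall t, a <= t <= b -> rcont f t) ->
  ci a b (fun t => - f t) = - ci a b f.
Proof.
move=> cf; rewrite -mulN1r -ciZ//.
by apply: eq_ci => t _; rewrite mulN1r.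
Qed.

Lemma ciB (R : realType) (a b : R) (f g : R -> R[i]) :
  (forall t, a <= t <= b -> rcont f t) -> (forall t, a <= t <= b -> rcont g t) ->
  ci a b (fun t => f t - g t) = ci a b f - ci a b g.
Proof. by move=> cf cg; rewrite ciD ?ciN// => t /cg/rcontN. Qed.

Lemma ci_cst (R : realType) (a b : R) (c : R[i]) : a <= b ->
  ci a b (fun _ => c) = c * ((b - a)%:C)%C.
Proof.
by move=> ab; apply: complexP; rewrite ?ReM ?ImM/= ri_cst// mulr0 ?subr0 ?add0r.
Qed.

Lemma ci_split (R : realType) (a b c : R) (f : R -> R[i]) : a <= b -> b <= c ->
  (forall t, a <= t <= c -> rcont f t) -> ci a c f = ci a b f + ci b c f.
Proof.
move=> ab bc cf; apply: complexP; rewrite ?ReD ?ImD/= -ri_split//.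
  by move=> t /cf/rcontRe.
by move=> t /cf/rcontIm.
Qed.

(** The factor 2 comes from bounding real and imaginary parts separately; every use tolerates a
    constant factor. *)
Lemma ci_bound (R : realType) (a b M : R) (f : R -> R[i]) : a <= b ->
  (forall t, a <= t <= b -> rcont f t) ->
  (forall t, a <= t <= b -> cmod (f t) <= M) ->
  cmod (ci a b f) <= 2 * M * (b - a).
Proof.
move=> ab cf fM; rewrite (le_trans (cmod_le_ReIm _))//= -mulrA mulr_natl mulr2n.
rewrite lerD// ri_bound//.
- by move=> t /cf/rcontRe.
- by move=> t /fM; apply: le_trans; exact: Re_le_cmod.
- by move=> t /cf/rcontIm.
- by move=> t /fM; apply: le_trans; exact: Im_le_cmod.
Qed.

Lemma ci_sum (R : realType) (a b : R) (I : Type) (s : seq I) (P : pred I)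
    (F : I -> R -> R[i]) : a <= b ->
  (forall i t, rcont (F i) t) ->
  ci a b (fun t => \sum_(i <- s | P i) F i t) = \sum_(i <- s | P i) ci a b (F i).
Proof.
move=> ab cF; elim: s => [|i s IH].
  rewrite big_nil -[RHS](mul0r ((b - a)%:C)%C) -ci_cst//.
  by apply: eq_ci => t _; rewrite big_nil.
rewrite big_cons -IH; case: ifPn => Pi.
  rewrite -ciD; [|by move=> t _; exact: cF|by move=> t _; exact: rcont_sum].
  by apply: eq_ci => t _; rewrite big_cons Pi.
by apply: eq_ci => t _; rewrite big_cons (negbTE Pi).
Qed.

Lemma rcont_lin (R : realType) (g : R -> R[i]) (k : R) t :
  rcont g (k * t) -> rcont (fun u => g (k * u)) t.
Proof.
move=> cg e /cg[d d0 hd].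
have /continuous_epsP/(_ d d0)[d' d'0 hd'] : {for t, continuous (fun u : R => k * u)}.
  by apply: (@cont_scale _ k id); exact: cvg_id.
by exists d' => // u /hd'; exact: hd.
Qed.

Lemma rcont_expik (R : realType) (k : R) t : rcont (fun u => expi (k * u)) t.
Proof. by apply: rcont_lin; exact: rcont_expi. Qed.

Lemma ci_dexpi (R : realType) (a b k : R) : a <= b ->
  ci a b (fun t => (k%:C * 'i)%C * expi (k * t)) = expi (k * b) - expi (k * a).
Proof.
move=> ab; set g := (fun t => _); have ck t : rcont g t.
  by apply: rcontM; [exact: rcont_cst|exact: rcont_expik].
apply: complexP; rewrite ?ReB ?ImB/=.
  apply: (@ri_FTC _ a b _ (fun t => cos (k * t)) ab) => t; first exact: (rcontRe (ck t)).
  apply: is_derive_eq.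
  rewrite /g /GRing.scale/=; ring.
apply: (@ri_FTC _ a b _ (fun t => sin (k * t)) ab) => t; first exact: (rcontIm (ck t)).
apply: is_derive_eq.
rewrite /g /GRing.scale/=; ring.
Qed.

Lemma expi_2pi (R : realType) (t : R) n : expi (t + n%:R * (2 * pi)) = expi t.
Proof.
elim: n => [|n IH]; first by rewrite mul0r addr0.
by rewrite -natr1 mulrDl mul1r addrA expiD2pi.
Qed.

Lemma two_pi_ge0 (R : realType) : 0 <= 2 * pi :> R.
Proof. by rewrite mulr_ge0// pi_ge0. Qed.

(** A primitive of [expi (n t)] is [expi (n t) / (n i)], which takes equal values at both ends of a
    period. *)
Lemma ci_expi_period (R : realType) (a : R) (n : nat) : (0 < n)%N ->
  ci a (a + 2 * pi) (fun t => expi (n%:R * t)) = 0.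
Proof.
move=> n0; have an : a <= a + 2 * pi by rewrite lerDl two_pi_ge0.
have k0 : ((n%:R : R)%:C * 'i)%C != 0.
  by rewrite -cmod_gt0 cmodM cmodr mulr_gt0 ?normr_gt0 ?pnatr_eq0 -?lt0n// cmodE/= expr0n expr1n add0r sqrtr1.
apply: (mulfI k0); rewrite mulr0 -ciZ; last by move=> t _; exact: rcont_expik.
by rewrite ci_dexpi// mulrDr expi_2pi subrr.
Qed.

Lemma ci_conj (R : realType) (a b : R) (f : R -> R[i]) :
  (forall t, a <= t <= b -> rcont f t) ->
  ci a b (fun t => conjc (f t)) = conjc (ci a b f).
Proof.
move=> cf; apply: complexP => /=.
  by apply: eq_ri => t _; case: (f t).
rewrite -mulN1r -riZ; last by move=> t /cf/rcontIm.
by apply: eq_ri => t _; rewrite mulN1r; case: (f t).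
Qed.

Lemma expi_lip (R : realType) (a b : R) : a <= b ->
  cmod (expi b - expi a) <= 2 * (b - a).
Proof.
move=> ab; have := @ci_dexpi _ a b 1 ab; rewrite !mul1r => <-.
rewrite -[leRHS]mulrC -(mulr1 2) [leRHS]mulrC; apply: ci_bound => // t _.
  by apply: rcontM; [exact: rcont_cst|exact: rcont_expik].
by rewrite cmodM cmod_expi mulr1 cmodE/= expr0n expr1n add0r sqrtr1.
Qed.

Lemma geo_small (R : realType) (q C e : R) : 0 <= q < 1 -> 0 < e ->
  exists n : nat, forall m, (n <= m)%N -> C * q ^+ m < e.
Proof.
move=> /andP[q0 q1] e0.
have h : C * q ^+ n @[n --> \oo] --> C * 0.
  by apply: cvgMr; apply: cvg_expr; rewrite ger0_norm.
rewrite mulr0 in h.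
have [n _ hn] := (@cvgrPdist_lt _ _ _ _ _ _ _).1 h e e0.
exists n => m /hn; rewrite sub0r normrN; apply: le_lt_trans; exact: ler_norm.
Qed.

(** Turns an estimate with geometrically decaying error into an equality, when [x] is a modulus. *)
Lemma geo_limit_le (R : realType) (x q C : R) : 0 <= q < 1 ->
  (forall n : nat, x <= C * q ^+ n) -> x <= 0.
Proof.
move=> hq h; rewrite leNgt; apply/negP => x0.
have [n /(_ n (leqnn n))] := @geo_small R q C x hq x0.
by rewrite ltNge h.
Qed.

(** * Goursat's subdivision argument *)

(** If [N] were positive on the whole rectangle, repeated quartering would give nested rectangles on
    which [N] loses at most a factor 4 per stage. The squared size loses exactly that factor, so
    smallness [e * size^2] at the common point gives a contradiction. *)
Lemma goursat (R : realType) (N : R -> R -> R -> R -> R) (s1 s2 t1 t2 : R) :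
  s1 <= s2 -> t1 <= t2 ->
  (forall a b c d, s1 <= a -> a <= b -> b <= s2 -> t1 <= c -> c <= d -> d <= t2 ->
     let m := (a + b) / 2 in let n := (c + d) / 2 in
     N a b c d <= N a m c n + N m b c n + N a m n d + N m b n d) ->
  (forall s t, s1 <= s <= s2 -> t1 <= t <= t2 -> forall e : R, 0 < e ->
     exists2 r : R, 0 < r & forall a b c d, s1 <= a -> a <= s -> s <= b -> b <= s2 ->
       t1 <= c -> c <= t -> t <= d -> d <= t2 -> b - a < r -> d - c < r ->
       N a b c d <= e * ((b - a) + (d - c)) ^+ 2) ->
  N s1 s2 t1 t2 <= 0.
Proof.
move=> s12 t12 sub loc; rewrite leNgt; apply/negP => N0.
pose V := (R * R * R * R)%type.
pose NN (q : V) := let: (a, b, c, d) := q in N a b c d.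
(* Takes a quarter carrying at least a fourth of [N]. The last one is the default: if the other
   three fail, subadditivity forces it to qualify. *)
pose step (q : V) : V := let: (a, b, c, d) := q in
  let m := (a + b) / 2 in let n := (c + d) / 2 in
  if N a b c d <= 4 * N a m c n then (a, m, c, n) else
  if N a b c d <= 4 * N m b c n then (m, b, c, n) else
  if N a b c d <= 4 * N a m n d then (a, m, n, d) else (m, b, n, d).
pose qs k := iter k step (s1, s2, t1, t2).
pose A k := (qs k).1.1.1; pose B k := (qs k).1.1.2.
pose C k := (qs k).1.2; pose D k := (qs k).2.
have inv k : [/\ s1 <= A k, A k <= B k, B k <= s2 & t1 <= C k] /\
    [/\ C k <= D k, D k <= t2 & NN (s1, s2, t1, t2) <= 4 ^+ k * NN (qs k)].
  elim: k => [|k]; first by rewrite /A /B /C /D /qs/= expr0 mul1r.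
  rewrite /A /B /C /D /qs iterS -/(qs k).
  case: (qs k) => [[[a b] c] d]/= [[h1 h2 h3 h4] [h5 h6 h7]].
  have := sub a b c d h1 h2 h3 h4 h5 h6; rewrite exprS /=.
  set m := (a + b) / 2; set n := (c + d) / 2 => hs.
  have am : a <= m by rewrite /m; lra.
  have mb : m <= b by rewrite /m; lra.
  have cn : c <= n by rewrite /n; lra.
  have nd : n <= d by rewrite /n; lra.
  have p4 : (0 : R) < 4 ^+ k by rewrite exprn_gt0.
  have key x : N a b c d <= 4 * x -> NN (s1, s2, t1, t2) <= 4 * 4 ^+ k * x.
    by move=> hx; rewrite (le_trans h7)// [4 * _]mulrC -mulrA ler_pM2l.
  case: ifPn => g1; first by split; split => //=; [lra|lra|exact: key].
  case: ifPn => g2; first by split; split => //=; [lra|lra|exact: key].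
  case: ifPn => g3; first by split; split => //=; [lra|lra|exact: key].
  split; split => //=; [lra|lra|].
  by apply: key; move: g1 g2 g3; rewrite -!ltNge; lra.
have mono k : [/\ A k <= A k.+1, B k.+1 <= B k, C k <= C k.+1 & D k.+1 <= D k].
  have [[_ h1 _ _] [h2 _ _]] := inv k; move: h1 h2.
  rewrite /A /B /C /D /qs iterS -/(qs k).
  case: (qs k) => [[[a b] c] d]/= h1 h2.
  by case: ifP => _; [|case: ifP => _; [|case: ifP => _]]; split => //=; lra.
have width k : B k - A k = (s2 - s1) * 2^-1 ^+ k /\ D k - C k = (t2 - t1) * 2^-1 ^+ k.
  elim: k => [|k]; first by rewrite !expr0 !mulr1.
  rewrite exprS [2^-1 * _]mulrC !mulrA => -[<- <-].
  rewrite /A /B /C /D /qs iterS -/(qs k).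
  case: (qs k) => [[[a b] c] d]/=.
  by case: ifP => _; [|case: ifP => _; [|case: ifP => _]]; split => /=; lra.
have nest (X Y : nat -> R) : (forall k, X k <= Y k) ->
    (forall k, X k <= X k.+1) -> (forall k, Y k.+1 <= Y k) ->
    exists l, forall k, X k <= l <= Y k.
  move=> XY Xm Ym.
  have Xn : {homo X : m n / (m <= n)%N >-> m <= n} by apply/nondecreasing_seqP.
  have Yn : {homo Y : m n / (m <= n)%N >-> n <= m} by apply/nonincreasing_seqP.
  have XYmn m n : X m <= Y n.
    rewrite (le_trans (Xn _ _ (leq_maxl m n)))// (le_trans (XY _))//.
    by apply: Yn; exact: leq_maxr.
  exists (sup (range X)) => k; apply/andP; split.
    apply: ub_le_sup; last by exists k.
    by exists (Y 0%N) => _ [m _ <-].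
  by apply: ge_sup; [exists (X 0%N), 0%N|move=> _ [m _ <-]].
have [s hs] : exists l, forall k, A k <= l <= B k.
  by apply: nest => k; [have [[]] := inv k|have [] := mono k|have [] := mono k].
have [t ht] : exists l, forall k, C k <= l <= D k.
  by apply: nest => k; [have [_ []] := inv k|have [] := mono k|have [] := mono k].
pose W := (s2 - s1) + (t2 - t1).
have W0 : 0 <= W by rewrite addr_ge0// subr_ge0.
have W1 : 0 < W ^+ 2 + 1 by rewrite ltr_wpDl// sqr_ge0.
(* This tolerance leads to [N <= N * (W^2 / (W^2 + 1))], absurd for positive [N]; the added 1 also
   covers [W = 0]. *)
have [|r r0 hr] := loc s t (hs 0%N) (ht 0%N) (N s1 s2 t1 t2 / (W ^+ 2 + 1)).
  by rewrite divr_gt0.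
have h01 : 0 <= (2^-1 : R) < 1 by lra.
have [k hk] := @geo_small R 2^-1 W r h01 r0.
have {}hk := hk k (leqnn k).
have [w1 w2] := width k; have [[i1 i2 i3 i4] [i5 i6 i7]] := inv k.
have [hs1 hs2] := andP (hs k); have [ht1 ht2] := andP (ht k).
have e12 : W * 2^-1 ^+ k = (B k - A k) + (D k - C k) by rewrite w1 w2 -mulrDl.
have wB : B k - A k < r by apply: le_lt_trans hk; rewrite e12 lerDl subr_ge0.
have wD : D k - C k < r by apply: le_lt_trans hk; rewrite e12 lerDr subr_ge0.
have := hr (A k) (B k) (C k) (D k) i1 hs1 hs2 i3 i4 ht1 ht2 i6 wB wD.
rewrite -e12.
move: i7; rewrite -[NN (qs k)]/(NN (qs k)).
have -> : NN (qs k) = N (A k) (B k) (C k) (D k).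
  by rewrite /NN /A /B /C /D; case: (qs k) => [[[? ?] ?] ?].
move=> i7 i8.
have p4 : (0 : R) < 4 ^+ k by rewrite exprn_gt0.
have := le_trans i7 (ler_wpM2l (ltW p4) i8).
have -> : (4 : R) ^+ k * (N s1 s2 t1 t2 / (W ^+ 2 + 1) * (W * 2^-1 ^+ k) ^+ 2) =
    N s1 s2 t1 t2 * (W ^+ 2 / (W ^+ 2 + 1)).
  have -> : (W * 2^-1 ^+ k) ^+ 2 = W ^+ 2 / 4 ^+ k.
    rewrite exprMn -exprM mulnC exprM -exprVn; congr (_ * _ ^+ _).
    by rewrite expr2; lra.
  by field; rewrite ?gt_eqF.
rewrite /NN leNgt => /negP; apply.
by rewrite -[ltRHS]mulr1 ltr_pM2l// ltr_pdivrMr// mul1r ltrDl.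
Qed.

(** * Boundary integrals over rectangles *)

Section boundary.
Context (R : realType) (k : R -> R[i]).

(* The integral of [g (k dt + ds / s)] along the boundary of
   [a, b] x [c, d], where [g] is read in the coordinates (s, t). *)
Definition bdry (g : R -> R -> R[i]) (a b c d : R) : R[i] :=
  (ci c d (fun t => g b t * k t) - ci c d (fun t => g a t * k t)) -
  (ci a b (fun s => g s d * (s^-1)%:C%C) - ci a b (fun s => g s c * (s^-1)%:C%C)).

(** Continuity along each coordinate line is what the four side integrals call for; [s] stays above
    [eps] because of the factor [1 / s]. *)
Definition sepcont (eps : R) (g : R -> R -> R[i]) :=
  forall s t, eps <= s -> s <= 1 -> rcont (g s) t /\ rcont (g^~ t) s.

Hypothesis ck : forall t, rcont k t.

Lemma rcont_invr (s : R) : 0 < s -> rcont (fun s : R => (s^-1)%:C%C) s.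
Proof. by move=> s0; apply: rcont_real; apply: (@cvgV _ _ (nbhs s)); rewrite ?gt_eqF//; exact: cvg_id. Qed.

Lemma sepcont_t eps g s c d : sepcont eps g -> eps <= s -> s <= 1 ->
  forall t, c <= t <= d -> rcont (fun t => g s t * k t) t.
Proof. by move=> cg es s1 t _; apply: rcontM => //; have [] := cg s t es s1. Qed.

Lemma sepcont_s eps g t a b : 0 < eps -> sepcont eps g -> eps <= a -> b <= 1 ->
  forall s, a <= s <= b -> rcont (fun s => g s t * (s^-1)%:C%C) s.
Proof.
move=> e0 cg ea b1 s /andP[as_ sb]; apply: rcontM.
  by have [] := cg s t (le_trans ea as_) (le_trans sb b1).
by apply: rcont_invr; rewrite (lt_le_trans e0)// (le_trans ea).
Qed.

Lemma bdryD eps g1 g2 a b c d : 0 < eps -> sepcont eps g1 -> sepcont eps g2 ->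
  eps <= a -> a <= b -> b <= 1 ->
  bdry (fun s t => g1 s t + g2 s t) a b c d = bdry g1 a b c d + bdry g2 a b c d.
Proof.
move=> e0 c1 c2 ea ab b1; rewrite /bdry.
have a1 := le_trans ab b1; have eb := le_trans ea ab.
have E s : eps <= s -> s <= 1 -> ci c d (fun t => (g1 s t + g2 s t) * k t) =
    ci c d (fun t => g1 s t * k t) + ci c d (fun t => g2 s t * k t).
  move=> es s1; rewrite -ciD; [|exact: (sepcont_t c1 es s1)|exact: (sepcont_t c2 es s1)].
  by apply: eq_ci => t _; rewrite mulrDl.
have F t : ci a b (fun s => (g1 s t + g2 s t) * (s^-1)%:C%C) =
    ci a b (fun s => g1 s t * (s^-1)%:C%C) + ci a b (fun s => g2 s t * (s^-1)%:C%C).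
  rewrite -ciD; [|exact: (@sepcont_s _ _ t _ _ e0 c1 ea b1)|exact: (@sepcont_s _ _ t _ _ e0 c2 ea b1)].
  by apply: eq_ci => s _; rewrite mulrDl.
by rewrite !E// !F; ring.
Qed.

(** Each inner edge is traversed twice, in opposite directions, so its two contributions cancel. *)
Lemma bdry_split eps g a m b c n d : 0 < eps -> sepcont eps g ->
  eps <= a -> a <= m -> m <= b -> b <= 1 -> c <= n -> n <= d ->
  bdry g a b c d =
  bdry g a m c n + bdry g m b c n + bdry g a m n d + bdry g m b n d.
Proof.
move=> e0 cg ea am mb b1 cn nd; rewrite /bdry.
have em := le_trans ea am; have m1 := le_trans mb b1.
have eb := le_trans em mb; have a1 := le_trans am m1.
have E s : eps <= s -> s <= 1 -> ci c d (fun t => g s t * k t) =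
    ci c n (fun t => g s t * k t) + ci n d (fun t => g s t * k t).
  by move=> es s1; rewrite (@ci_split _ c n d)//; exact: (sepcont_t cg es s1).
have F t : ci a b (fun s => g s t * (s^-1)%:C%C) =
    ci a m (fun s => g s t * (s^-1)%:C%C) + ci m b (fun s => g s t * (s^-1)%:C%C).
  by rewrite (@ci_split _ a m b)//; exact: (@sepcont_s _ _ t _ _ e0 cg ea b1).
by rewrite !E// !F; ring.
Qed.

Lemma bdry_bound eps g a b c d K M : 0 < eps -> sepcont eps g ->
  eps <= a -> a <= b -> b <= 1 -> c <= d -> 0 <= M ->
  (forall t, cmod (k t) <= K) ->
  (forall s t, a <= s <= b -> c <= t <= d -> cmod (g s t) <= M) ->
  cmod (bdry g a b c d) <= 4 * M * (K + eps^-1) * ((b - a) + (d - c)).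
Proof.
move=> e0 cg ea ab b1 cd M0 kK gM.
have a1 := le_trans ab b1; have eb := le_trans ea ab.
have K0 : 0 <= K by rewrite (le_trans (cmod_ge0 (k 0))).
have E s : a <= s <= b ->
    cmod (ci c d (fun t => g s t * k t)) <= 2 * (M * K) * (d - c).
  move=> /andP[as_ sb]; apply: ci_bound => //.
    exact: (sepcont_t cg (le_trans ea as_) (le_trans sb b1)).
  by move=> t ht; rewrite cmodM ler_pM// ?cmod_ge0// gM// as_.
have F t : c <= t <= d ->
    cmod (ci a b (fun s => g s t * (s^-1)%:C%C)) <= 2 * (M * eps^-1) * (b - a).
  move=> ht; apply: ci_bound => //.
    exact: (@sepcont_s _ _ t _ _ e0 cg ea b1).
  move=> s /andP[as_ sb]; have es := le_trans ea as_.
  rewrite cmodM ler_pM// ?cmod_ge0// ?gM ?as_//.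
  rewrite cmodr ger0_norm ?lef_pV2 ?posrE ?invr_ge0//.
    exact: lt_le_trans es.
  by rewrite (le_trans _ es)// ltW.
have haa : a <= a <= b by rewrite lexx.
have hbb : a <= b <= b by rewrite lexx andbT.
have hcc : c <= c <= d by rewrite lexx.
have hdd : c <= d <= d by rewrite lexx andbT.
have h1 := cmodB (ci c d (fun t => g b t * k t)) (ci c d (fun t => g a t * k t)).
have h2 := cmodB (ci a b (fun s => g s d * (s^-1)%:C%C)) (ci a b (fun s => g s c * (s^-1)%:C%C)).
have e1 := E _ haa; have e2 := E _ hbb; have e3 := F _ hcc; have e4 := F _ hdd.
have x1 : 0 <= M * K * (b - a) by rewrite !mulr_ge0// subr_ge0.
have x2 : 0 <= M * eps^-1 * (d - c) by rewrite !mulr_ge0// ?subr_ge0// invr_ge0 ltW.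
(* The first four terms bound the four sides; the last two are the nonnegative cross terms added to
   reach a form symmetric in the two directions. *)
have -> : 4 * M * (K + eps^-1) * ((b - a) + (d - c)) =
  2 * (M * K) * (d - c) + 2 * (M * K) * (d - c) +
  (2 * (M * eps^-1) * (b - a) + 2 * (M * eps^-1) * (b - a)) +
  4 * (M * K * (b - a)) + 4 * (M * eps^-1 * (d - c)) by ring.
rewrite /bdry; apply: le_trans (cmodB _ _) _.
apply: le_trans (lerD (le_trans h1 (lerD e2 e1)) (le_trans h2 (lerD e4 e3))) _.
by rewrite -[leRHS]addrA lerDl addr_ge0// mulr_ge0.
Qed.

End boundary.

(** * Cauchy's formula and its geometric expansion *)

Section cauchy.
Context (R : realType) (f : R[i] -> R[i]) (z : R[i]) (rho : R).
Hypothesis df : forall w, cmod w < 1 -> exists d, cdiff f w d.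
Hypotheses (rho0 : 0 < rho) (rho1 : rho < 1) (zr : cmod z < rho).

(* [H] contracts the circle of radius [rho] to [z]; in the coordinates (s, t)
   the form [f w dw / (w - z)] becomes [f (H s t) (k t dt + ds / s)]. *)
Let E t := rho%:C%C * expi t - z.
Let H s t := z + s%:C%C * E t.
Let kap t := rho%:C%C * expi t / E t.
Let k t := ('i * kap t)%C.
Let K := rho / (rho - cmod z).
Let T : R := 2 * pi.

Let cf w : cmod w < 1 -> ccont f w.
Proof. by move=> /df[d]; exact: cdiff_ccont. Qed.

Let E_ge t : rho - cmod z <= cmod (E t).
Proof.
apply: le_trans (cmod_sub_ge _ _).
by rewrite cmodM cmod_expi mulr1 cmodr gtr0_norm.
Qed.

Let E_neq0 t : E t != 0.
Proof. by rewrite -cmod_gt0 (lt_le_trans _ (E_ge t))// subr_gt0. Qed.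

Let E_le t : cmod (E t) <= 2.
Proof.
rewrite (le_trans (cmodB _ _))// cmodM cmod_expi mulr1 cmodr gtr0_norm//.
by have := zr; have := rho1; lra.
Qed.

Let K0 : 0 <= K.
Proof. by rewrite divr_ge0// ltW// subr_gt0. Qed.

Let kapK t : cmod (kap t) <= K.
Proof.
rewrite cmodM cmodM cmod_expi mulr1 cmodr gtr0_norm// cmodV ler_pM ?invr_ge0 ?cmod_ge0 ?(ltW rho0)//.
by rewrite lef_pV2 ?posrE ?subr_gt0// cmod_gt0.
Qed.

Lemma cmod_i : cmod ('i : R[i])%C = 1.
Proof. by rewrite cmodE/= expr0n expr1n add0r sqrtr1. Qed.

Let kK t : cmod (k t) <= K.
Proof. by rewrite cmodM cmod_i mul1r. Qed.

Let cE t : rcont E t.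
Proof.
apply: rcontB; last exact: rcont_cst.
by apply: rcontM; [exact: rcont_cst|exact: rcont_expi].
Qed.

Let ckap t : rcont kap t.
Proof.
apply: rcontM; last exact: rcontV.
by apply: rcontM; [exact: rcont_cst|exact: rcont_expi].
Qed.

Let ck t : rcont k t.
Proof. by apply: rcontM => //; exact: rcont_cst. Qed.

Let H_lt1 s t : 0 <= s -> s <= 1 -> cmod (H s t) < 1.
Proof.
move=> s0 s1; apply: le_lt_trans rho1.
have -> : H s t = ((1 - s)%:C * z + (s * rho)%:C * expi t)%C.
  by rewrite /H /E rmorphB rmorphM rmorph1/=; ring.
rewrite (le_trans (cmodD _ _))// !cmodM cmod_expi mulr1 !cmodr.
have -> : `|1 - s| = 1 - s by rewrite ger0_norm// subr_ge0.
have -> : `|s * rho| = s * rho by rewrite ger0_norm// mulr_ge0// ltW.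
have : (1 - s) * cmod z <= (1 - s) * rho.
  by rewrite ler_wpM2l ?subr_ge0// ltW.
lra.
Qed.

Let sepH eps (g : R[i] -> R[i]) : 0 < eps -> (forall w, cmod w < 1 -> ccont g w) ->
  sepcont eps (fun s t => g (H s t)).
Proof.
move=> e0 cg s t es s1; have s0 : 0 <= s by rewrite (le_trans _ es)// ltW.
split; apply: rcont_comp; try by apply: cg; exact: H_lt1.
  apply: rcontD; first exact: rcont_cst.
  by apply: rcontM => //; exact: rcont_cst.
apply: rcontD; first exact: rcont_cst.
apply: rcontM; last exact: rcont_cst.
by apply: rcont_real; exact: cvg_id.
Qed.

(** The constant part cancels between opposite sides. For the linear part, [E t * k t] is the
    derivative of [E], so both differences of sides equal [be * (b - a) * (E d - E c)]. *)
Let bdry_affine (al be : R[i]) eps a b c d : 0 < eps -> eps <= a -> a <= b ->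
  b <= 1 -> c <= d -> bdry k (fun s t => al + be * (s%:C%C * E t)) a b c d = 0.
Proof.
move=> e0 ea ab b1 cd.
have cg s t : rcont (fun t => (al + be * (s%:C%C * E t)) * k t) t.
  apply: rcontM => //; apply: rcontD; first exact: rcont_cst.
  by apply: rcontM; [exact: rcont_cst|apply: rcontM => //; exact: rcont_cst].
have cs t s : 0 < s -> rcont (fun s => (al + be * (s%:C%C * E t)) * (s^-1)%:C%C) s.
  move=> s0; apply: rcontM; last exact: rcont_invr.
  apply: rcontD; first exact: rcont_cst.
  apply: rcontM; first exact: rcont_cst.
  by apply: rcontM; [apply: rcont_real; exact: cvg_id|exact: rcont_cst].
have s0 s : a <= s <= b -> 0 < s.
  by move=> /andP[as_ _]; rewrite (lt_le_trans e0)// (le_trans ea).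
rewrite /bdry -ciB//; [|by move=> s /s0; exact: cs..].
rewrite -[X in _ - X]ciB//; [|by move=> s /s0; exact: cs..].
rewrite (@eq_ci _ c d _ (fun t => (be * (b - a)%:C%C * rho%:C%C) * ((1%:C * 'i)%C * expi (1 * t)))); last first.
  move=> t _; rewrite /k /kap mul1r rmorphB/= rmorph1.
  by field; rewrite E_neq0.
rewrite ciZ; last first.
  by move=> t _; apply: rcontM; [exact: rcont_cst|exact: rcont_expik].
rewrite ci_dexpi// !mul1r.
rewrite (@eq_ci _ a b _ (fun=> be * (E d - E c))); last first.
  move=> s /s0 s0'; rewrite fmorphV/=.
  by field; rewrite (_ : 0 = (0%:C)%C)// (inj_eq (@complexI _)) gt_eqF.
rewrite ci_cst// /E rmorphB/=; ring.
Qed.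

(** Moving [s] costs at most [|E t| <= 2] per unit; moving [t] costs at most the Lipschitz constant
    2 of [expi]. *)
Let Hdist s t s' t' a b c d : 0 <= a -> b <= 1 -> a <= s <= b -> c <= t <= d ->
  a <= s' <= b -> c <= t' <= d ->
  cmod (H s t - H s' t') <= 2 * ((b - a) + (d - c)).
Proof.
move=> a0 b1 /andP[as1 sb] /andP[ct td] /andP[as1' sb'] /andP[ct' td'].
have -> : H s t - H s' t' =
    ((s - s')%:C * E t + (s' * rho)%:C * (expi t - expi t'))%C.
  by rewrite /H /E rmorphB rmorphM/=; ring.
rewrite (le_trans (cmodD _ _))// !cmodM !cmodr mulrDr lerD//.
  rewrite mulrC; apply: ler_pM; [exact: cmod_ge0|exact: normr_ge0|exact: E_le|].
  by rewrite ler_norml; apply/andP; split; lra.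
have -> : `|s' * rho| = s' * rho by rewrite ger0_norm// mulr_ge0 ?(ltW rho0)// (le_trans a0).
have h : cmod (expi t - expi t') <= 2 * (d - c).
  have [tt|tt] := leP t' t.
    by rewrite (le_trans (expi_lip tt))// ler_pM2l//; lra.
  by rewrite cmodBC (le_trans (expi_lip (ltW tt)))// ler_pM2l//; lra.
rewrite -[leRHS]mul1r; apply: ler_pM => //.
- by rewrite mulr_ge0 ?(ltW rho0)// (le_trans a0).
- exact: cmod_ge0.
- by rewrite mulr_ile1// ?(ltW rho0) ?(ltW rho1)// ?(le_trans a0)// (le_trans sb').
Qed.

(** Near a point, [f] is its tangent map plus a remainder small relative to the size of the
    rectangle. The tangent map contributes nothing, and the remainder is integrated over a perimeter
    of that size, which gives the quadratic smallness that [goursat] asks for. *)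
Let bdry0 eps c d : 0 < eps -> eps <= 1 -> c <= d ->
  bdry k (fun s t => f (H s t)) eps 1 c d = 0.
Proof.
move=> e0 e1 cd; apply/eqP; rewrite -cmod_eq0 eq_le cmod_ge0 andbT.
have cfH := sepH e0 cf.
apply: (@goursat _ (fun a b c d => cmod (bdry k (fun s t => f (H s t)) a b c d))) => //.
  move=> a b c' d' ea ab b1 cc' cd' d1 /=; set m := (a + b) / 2; set n := (c' + d') / 2.
  have am : a <= m by rewrite /m; lra.
  have mb : m <= b by rewrite /m; lra.
  have cn : c' <= n by rewrite /n; lra.
  have nd : n <= d' by rewrite /n; lra.
  rewrite (bdry_split ck e0 cfH ea am mb b1 cn nd).
  by rewrite (le_trans (cmodD _ _))// lerD2r (le_trans (cmodD _ _))// lerD2r cmodD.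
move=> s t /andP[es s1] /andP[ct td] e e_gt0.
have s0 := le_trans (ltW e0) es.
have [be hbe] := df (H_lt1 t s0 s1).
(* 8 is the factor 4 of [bdry_bound] times the factor 2 of [Hdist]. *)
have C0 : 0 < 8 * (K + eps^-1) by rewrite mulr_gt0// ltr_wpDl// invr_gt0.
have [r r0 hr] := hbe (e / (8 * (K + eps^-1))) (divr_gt0 e_gt0 C0).
(* Sides shorter than [r / 4] keep the distance of [Hdist] below [2 * (r / 4 + r / 4) = r]. *)
exists (r / 4) => [|a b c' d' ea as1 sb b1 cc' ct' td' d'd ba dc]; first by rewrite divr_gt0.
have ab := le_trans as1 sb; have cd' := le_trans ct' td'.
have a0 := le_trans (ltW e0) ea.
(* With this constant [al + be * (w - z)] is the tangent map of [f] at [H s t], rewritten around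
   [z]. *)
pose al := f (H s t) + be * (z - H s t).
pose g1 s t := al + be * (s%:C%C * E t).
pose rem w := f w - (al + be * (w - z)).
have remE w : rem w = f w - f (H s t) - be * (w - H s t) by rewrite /rem /al; ring.
have cg1 : sepcont eps g1.
  have -> : g1 = (fun s t => (fun w => al + be * (w - z)) (H s t)).
    by apply/funext => u; apply/funext => v; rewrite /g1 /H; congr (_ + _ * _); ring.
  apply: (@sepH eps (fun w => al + be * (w - z)) e0) => w _; apply: (@cdiff_ccont _ _ _ be) => x x0; exists 1 => // w' _.
  rewrite (_ : _ - _ - _ = 0); last by ring.
  by rewrite cmod0; exact: mulr_ge0 (ltW x0) (cmod_ge0 _).
have crem : sepcont eps (fun s t => rem (H s t)).
  move=> u v eu u1; have [x1 x2] := cfH u v eu u1; have [y1 y2] := cg1 u v eu u1.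
  split.
    apply: (@eq_rcont _ (fun t => f (H u t) - g1 u t)); last exact: rcontB.
    by move=> t'; rewrite /rem /g1 /H; congr (_ - (_ + _ * _)); ring.
  apply: (@eq_rcont _ (fun s => f (H s v) - g1 s v)); last exact: rcontB.
  by move=> t'; rewrite /rem /g1 /H; congr (_ - (_ + _ * _)); ring.
have -> : (fun s t => f (H s t)) = (fun s t => g1 s t + rem (H s t)).
  apply/funext => u; apply/funext => v; rewrite /rem /g1 {3}/H.
  by rewrite (_ : z + _ - z = u%:C%C * E v) ?subrKC//; ring.
rewrite (bdryD ck _ _ e0 cg1 crem ea ab b1) (bdry_affine _ _ e0 ea ab b1 cd') add0r.
set L := (b - a) + (d' - c').
have L0 : 0 <= L by rewrite addr_ge0// subr_ge0.
pose M := e / (8 * (K + eps^-1)) * (2 * L).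
have M0 : 0 <= M by rewrite mulr_ge0 ?divr_ge0// ?(ltW C0) ?(ltW e_gt0)// mulr_ge0.
apply: le_trans (bdry_bound ck e0 crem ea ab b1 cd' M0 kK _) _.
  move=> u v hu hv; rewrite remE.
  have hd : cmod (H u v - H s t) <= 2 * L.
    by apply: (Hdist a0 b1 hu hv); [rewrite as1|rewrite ct'].
  apply: le_trans (hr _ _) _; last by rewrite ler_pM2l// divr_gt0.
  by apply: le_lt_trans hd _; rewrite /L; lra.
rewrite -/L le_eqVlt; apply/orP; left; apply/eqP.
have KE0 : K + eps^-1 != 0 by rewrite gt_eqF// ltr_wpDl// invr_gt0.
rewrite /M; move: KE0; set X := K + eps^-1 => KE0; field; exact: KE0.
Qed.

Let T0 : 0 <= T. Proof. exact: two_pi_ge0. Qed.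

Let cfHk s t : 0 < s -> s <= 1 -> rcont (fun t => f (H s t) * kap t) t.
Proof. by move=> s0 s1; apply: rcontM => //; have [] := sepH s0 cf t (lexx s) s1. Qed.

(** The sides [t = 0] and [t = 2 pi] are mapped to the same radial segment and cancel; what remains
    compares the circles [s = 1] and [s = eps]. *)
Let circle_const eps : 0 < eps -> eps <= 1 ->
  ci 0 T (fun t => f (H 1 t) * kap t) = ci 0 T (fun t => f (H eps t) * kap t).
Proof.
move=> e0 e1; have := bdry0 e0 e1 T0; rewrite /bdry.
have HT s : H s T = H s 0 by rewrite /H /E -[T]add0r expiD2pi.
rewrite (@eq_ci _ eps 1 (fun s => f (H s T) * _) (fun s => f (H s 0) * (s^-1)%:C%C)); last first.
  by move=> s _; rewrite HT.
rewrite subrr subr0 => /eqP; rewrite subr_eq0 => /eqP h.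
have i0 : ('i : R[i])%C != 0 by rewrite -cmod_gt0 cmod_i.
apply: (mulfI i0); rewrite -!ciZ; last 2 first.
- by move=> t _; exact: cfHk.
- by move=> t _; exact: cfHk.
rewrite -[LHS](@eq_ci _ _ _ (fun t => f (H 1 t) * k t)); last by move=> t _; rewrite mulrCA.
by rewrite h; apply: eq_ci => t _; rewrite mulrCA.
Qed.

(** The integral does not depend on [eps], and as [eps] tends to 0 the points [H eps t] tend to [z]
    uniformly in [t]. *)
Let cauchy_kernel : ci 0 T (fun t => f (rho%:C%C * expi t) * kap t) = f z * ci 0 T kap.
Proof.
apply/eqP; rewrite -subr_eq0 -cmod_eq0 eq_le cmod_ge0 andbT.
apply/ler_addgt0Pr => e e0; rewrite add0r.
pose C := 2 * K * T + 1.
have C0 : 0 < C by rewrite ltr_wpDl// mulr_ge0// mulr_ge0.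
have [|d d0 hd] := @cf z _ (e / C) (divr_gt0 e0 C0); first exact: lt_trans rho1.
(* As [|E t| <= 2], this keeps [H eps t] within [d / 2] of [z]. *)
pose eps := Num.min 1 (d / 4).
have eps0 : 0 < eps by rewrite lt_min ltr01 divr_gt0.
have eps1 : eps <= 1 by rewrite ge_min lexx.
rewrite (@eq_ci _ _ _ _ (fun t => f (H 1 t) * kap t)); last first.
  by move=> t _; rewrite /H /E mul1r subrKC.
rewrite (circle_const eps0 eps1) -ciZ// -ciB; last 2 first.
- by move=> t _; exact: cfHk.
- by move=> t _; apply: rcontM => //; exact: rcont_cst.
apply: le_trans (@ci_bound _ _ _ (e / C * K) _ T0 _ _) _.
- by move=> t _; apply: rcontB; [exact: cfHk|apply: rcontM => //; exact: rcont_cst].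
- move=> t _; rewrite -mulrBl cmodM.
  apply: ler_pM; rewrite ?cmod_ge0//; apply: ltW; apply: hd.
  rewrite /H addrAC subrr add0r cmodM cmodr gtr0_norm//.
  have : eps * cmod (E t) <= d / 4 * 2.
    apply: ler_pM; [exact: ltW|exact: cmod_ge0| |exact: E_le].
    by rewrite /eps ge_min lexx orbT.
  by move/le_lt_trans; apply; move: d0; lra.
rewrite subr0 (_ : 2 * _ * _ = e * ((2 * K * T) / C)); last by field; rewrite gt_eqF.
by rewrite -[leRHS]mulr1 ler_pM2l// ler_pdivrMr// mul1r lerDl.
Qed.

(** This is [z / (rho * expi t)], conjugation being inversion on the unit circle; hence
    [kap t = 1 / (1 - u t)]. *)
Let u t := z * (rho^-1)%:C%C * conjc (expi t).

Let cmod_u t : cmod (u t) = cmod z / rho.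
Proof. by rewrite !cmodM cmod_conj cmod_expi mulr1 cmodr gtr0_norm ?invr_gt0. Qed.

Let kap_geo t n : kap t = \sum_(j < n) u t ^+ j + u t ^+ n * kap t.
Proof.
have e0 := expi_neq0 t.
have r0 : (rho%:C)%C != 0 by rewrite (_ : 0 = (0%:C)%C)// (inj_eq (@complexI _)) gt_eqF.
have kE : kap t * (1 - u t) = 1.
  have := E_neq0 t; rewrite /kap /u /E fmorphV => E0.
  have -> : conjc (expi t) = (expi t)^-1.
    by apply: (mulfI e0); rewrite expi_conj mulfV.
  by field; rewrite e0 r0 E0.
have u1 : 1 - u t != 0.
  by apply/eqP => h; move: kE; rewrite h mulr0 => /eqP; rewrite eq_sym oner_eq0.
apply: (mulfI u1); rewrite mulrDr.
have -> : (1 - u t) * (\sum_(j < n) u t ^+ j) = 1 - u t ^+ n.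
  by rewrite -[1 - u t]opprB mulNr -subrX1 opprB.
by rewrite mulrC kE mulrCA [_ * kap t]mulrC kE mulr1 subrK.
Qed.

Let cu t : rcont u t.
Proof. by apply: rcontM; [exact: rcont_cst|apply: rcont_conj; exact: rcont_expi]. Qed.

Let q01 : 0 <= cmod z / rho < 1.
Proof.
apply/andP; split; first by rewrite divr_ge0 ?cmod_ge0// ltW.
by rewrite ltr_pdivrMr// mul1r.
Qed.

(** Only a finite geometric sum is integrated; the exact remainder keeps the factor [u t ^+ n], of
    modulus [(cmod z / rho) ^+ n]. *)
Let expansion_kap (F : R -> R[i]) (M : R) : (forall t, rcont F t) ->
  (forall t, 0 <= t <= T -> cmod (F t) <= M) -> forall n : nat,
  cmod (ci 0 T (fun t => F t * kap t) - \sum_(j < n) ci 0 T (fun t => F t * u t ^+ j))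
    <= 2 * (M * K) * T * (cmod z / rho) ^+ n.
Proof.
move=> cF FM n.
have cFu j t : rcont (fun t => F t * u t ^+ j) t by apply: rcontM => //; exact: rcontX.
have cr t : rcont (fun t => F t * (u t ^+ n * kap t)) t.
  by apply: rcontM => //; apply: rcontM => //; exact: rcontX.
rewrite -ci_sum//.
rewrite (@eq_ci _ _ _ _ (fun t => \sum_(j < n) F t * u t ^+ j + F t * (u t ^+ n * kap t))); last first.
  by move=> t _; rewrite {1}(kap_geo t n) mulrDr mulr_sumr.
rewrite ciD//; last by move=> t _; exact: rcont_sum.
rewrite addrAC subrr add0r.
apply: le_trans (@ci_bound _ _ _ (M * K * (cmod z / rho) ^+ n) _ T0 _ _) _ => //.
  move=> t t0T; rewrite (cmodM (F t)) (cmodM (u t ^+ n)) cmodX cmod_u mulrCA [leRHS]mulrC.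
  apply: ler_wpM2l; first by apply: exprn_ge0; case/andP: q01.
  apply: ler_pM; [exact: cmod_ge0|exact: cmod_ge0|exact: FM|exact: kapK].
rewrite subr0 le_eqVlt; apply/orP; left; apply/eqP; ring.
Qed.

(** In the expansion with [F = 1] every term but the constant one integrates to 0 over a period. *)
Let ckap_int : ci 0 T kap = T%:C%C.
Proof.
apply/eqP; rewrite -subr_eq0 -cmod_eq0 eq_le cmod_ge0 andbT.
(* Used at order [n.+1], so that the sum contains its constant term; the extra factor [cmod z / rho]
   goes into the constant. *)
apply: (@geo_limit_le _ _ (cmod z / rho) (2 * (1 * K) * T * (cmod z / rho)) q01) => n.
have := @expansion_kap (fun=> 1) 1 (fun t => rcont_cst 1 t).
have H1 t : 0 <= t <= T -> cmod (1 : R[i]) <= 1 by rewrite cmod1.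
move=> /(_ H1 n.+1).
rewrite exprS !mulrA; apply: le_trans; rewrite le_eqVlt; apply/orP; left; apply/eqP.
congr (cmod (_ - _)); first by apply: eq_ci => t _; rewrite mul1r.
rewrite big_ord_recl big1 => [|i _].
  rewrite addr0 (@eq_ci _ _ _ _ (fun=> 1)); last by move=> t _; rewrite expr0 mulr1.
  by rewrite ci_cst// mul1r subr0.
rewrite (@eq_ci _ _ _ _ (fun t => (z * (rho^-1)%:C%C) ^+ i.+1 * conjc (expi (i.+1%:R * t)))); last first.
  by move=> t _; rewrite mul1r lift0 /u exprMn -expiX rmorphXn.
rewrite ciZ; last by move=> t _; apply: rcont_conj; exact: rcont_expik.
rewrite ci_conj; last by move=> t _; exact: rcont_expik.
by rewrite -[T]add0r ci_expi_period// conjc0 mulr0.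
Qed.

Lemma cauchy_expansion : exists C : R, forall n : nat,
  cmod (f z - \sum_(j < n) (((2 * pi)^-1 * rho^-1 ^+ j)%:C%C *
       ci 0 (2 * pi) (fun t => f (rho%:C%C * expi t) * conjc (expi t) ^+ j)) * z ^+ j)
    <= C * (cmod z / rho) ^+ n.
Proof.
have cF t : rcont (fun t => f (rho%:C%C * expi t)) t.
  apply: (@eq_rcont _ (fun t => f (H 1 t))).
    by move=> t'; rewrite /H /E mul1r subrKC.
  by have [] := sepH ltr01 cf t (lexx 1) (lexx 1).
have [M FM] : exists M, forall t, 0 <= t <= T -> cmod (f (rho%:C%C * expi t)) <= M.
  have [c _ hc] := @EVT_max R (fun t => cmod (f (rho%:C%C * expi t))) 0 T T0
    (within_cont (fun t _ => cont_cmod (cF t))).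
  by exists (cmod (f (rho%:C%C * expi c))) => t ht; apply: hc; rewrite in_itv.
have Tp : 0 < T by rewrite mulr_gt0 ?pi_gt0.
exists (2 * (M * K)) => n.
have := @expansion_kap _ M cF FM n; rewrite cauchy_kernel ckap_int => h.
rewrite -(@ler_pM2l _ T)//.
have {1}-> : T = cmod (T%:C%C) by rewrite cmodr gtr0_norm.
rewrite -cmodM; apply: le_trans (le_trans h _); last first.
  by rewrite le_eqVlt; apply/orP; left; apply/eqP; ring.
rewrite le_eqVlt; apply/orP; left; apply/eqP; congr cmod.
rewrite mulrBr [f z * _]mulrC; congr (_ - _).
rewrite mulr_sumr; apply: eq_bigr => j _.
rewrite -[RHS](@eq_ci _ _ _ (fun t => (z * (rho^-1)%:C%C) ^+ j * (f (rho%:C%C * expi t) * conjc (expi t) ^+ j))); last first.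
  by move=> t _; rewrite /u [in RHS]exprMn [RHS]mulrCA.
rewrite ciZ; last first.
  move=> t _; apply: rcontM => //; apply: rcontX.
  by apply: rcont_conj; exact: rcont_expi.
rewrite !mulrA -rmorphM/= mulrA mulfV ?gt_eqF// mul1r rmorphXn exprMn; ring.
Qed.

End cauchy.

(** * Power series *)

Definition psum (R : realType) (a : nat -> R[i]) (z : R[i]) (n : nat) : R[i] :=
  \sum_(j < n) a j * z ^+ j.

Definition is_ps (R : realType) (rho : R) (a : nat -> R[i]) (f : R[i] -> R[i]) :=
  forall z, cmod z < rho -> forall e : R, 0 < e ->
    exists n, forall m, (n <= m)%N -> cmod (f z - psum a z m) < e.

Lemma psumS (R : realType) (a : nat -> R[i]) z n :
  psum a z n.+1 = psum a z n + a n * z ^+ n.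
Proof. by rewrite /psum big_ord_recr. Qed.

Lemma is_psS (R : realType) (r rho : R) a (f : R[i] -> R[i]) :
  r <= rho -> is_ps rho a f -> is_ps r a f.
Proof. by move=> rr h z zr; apply: h; exact: lt_le_trans rr. Qed.

Lemma is_ps_ext (R : realType) (rho : R) a (f g : R[i] -> R[i]) :
  (forall z, cmod z < rho -> f z = g z) -> is_ps rho a f -> is_ps rho a g.
Proof. by move=> fg h z zr e /(h z zr); rewrite (fg z zr). Qed.

Lemma is_psD (R : realType) (rho : R) a b (f g : R[i] -> R[i]) :
  is_ps rho a f -> is_ps rho b g ->
  is_ps rho (fun k => a k + b k) (fun z => f z + g z).
Proof.
move=> ha hb z zr e e0; have e2 : 0 < e / 2 by rewrite divr_gt0.
have [n hn] := ha z zr _ e2; have [m hm] := hb z zr _ e2.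
exists (maxn n m) => k; rewrite geq_max => /andP[/hn h1 /hm h2].
have -> : psum (fun k => a k + b k) z k = psum a z k + psum b z k.
  by rewrite /psum -big_split/=; apply: eq_bigr => i _; rewrite mulrDl.
rewrite opprD addrACA (le_lt_trans (cmodD _ _))// [ltRHS]splitr.
exact: ltrD.
Qed.

Lemma is_psZ (R : realType) (rho : R) (c : R[i]) a (f : R[i] -> R[i]) :
  is_ps rho a f -> is_ps rho (fun k => c * a k) (fun z => c * f z).
Proof.
move=> ha z zr e e0; have c1 : 0 < cmod c + 1 by rewrite ltr_wpDl ?cmod_ge0.
have [n hn] := ha z zr _ (divr_gt0 e0 c1).
exists n => k /hn h1.
have -> : psum (fun k => c * a k) z k = c * psum a z k.
  by rewrite /psum mulr_sumr; apply: eq_bigr => i _; rewrite mulrA.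
rewrite -mulrBr cmodM; move: h1; rewrite ltr_pdivlMr// mulrC => /(le_lt_trans _); apply.
by rewrite ler_wpM2r ?cmod_ge0// lerDl.
Qed.

Lemma is_psN (R : realType) (rho : R) a (f : R[i] -> R[i]) :
  is_ps rho a f -> is_ps rho (fun k => - a k) (fun z => - f z).
Proof.
move=> /(is_psZ (-1)) h.
have -> : (fun k => - a k) = (fun k => -1 * a k) by apply/funext => k; rewrite mulN1r.
by apply: is_ps_ext h => z _; rewrite mulN1r.
Qed.

Lemma is_psB (R : realType) (rho : R) a b (f g : R[i] -> R[i]) :
  is_ps rho a f -> is_ps rho b g ->
  is_ps rho (fun k => a k - b k) (fun z => f z - g z).
Proof. by move=> ha hb; apply: is_psD => //; exact: is_psN. Qed.

(** At the real point [r] late partial sums are within 1 of the limit, so each late term, a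
    difference of two of them, is at most 2; the finitely many early terms are bounded by their
    sum. *)
Lemma is_ps_bound (R : realType) (rho r : R) a (f : R[i] -> R[i]) :
  is_ps rho a f -> 0 <= r < rho ->
  exists2 C : R, 0 <= C & forall k, cmod (a k) * r ^+ k <= C.
Proof.
move=> h /andP[r0 rr].
have hr : cmod (r%:C)%C < rho by rewrite cmodr ger0_norm.
have [n hn] := h _ hr 1 ltr01.
have S0 : 0 <= \sum_(j < n) cmod (a j) * r ^+ j.
  by apply: sumr_ge0 => j _; rewrite mulr_ge0 ?cmod_ge0// exprn_ge0.
exists (2 + \sum_(j < n) cmod (a j) * r ^+ j) => [|k]; first by rewrite addr_ge0.
have [kn|nk] := ltnP k n.
  rewrite (bigD1 (Ordinal kn))//= addrCA lerDl addr_ge0// sumr_ge0// => j _.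
  by rewrite mulr_ge0 ?cmod_ge0// exprn_ge0.
apply: (@le_trans _ _ 2); last by rewrite lerDl.
have -> : cmod (a k) * r ^+ k = cmod (a k * (r%:C)%C ^+ k).
  by rewrite cmodM cmodX cmodr ger0_norm.
have -> : a k * r%:C%C ^+ k = (f (r%:C)%C - psum a (r%:C)%C k) - (f (r%:C)%C - psum a (r%:C)%C k.+1).
  by rewrite psumS; ring.
rewrite (le_trans (cmodB _ _))//.
by have := hn k nk; have := hn k.+1 (leqW nk); lra.
Qed.

Lemma geo_sum_le (R : realType) (q : R) n m : 0 <= q < 1 -> (n <= m)%N ->
  \sum_(n <= j < m) q ^+ j <= q ^+ n / (1 - q).
Proof.
move=> /andP[q0 q1] nm; have q1' : 0 < 1 - q by rewrite subr_gt0.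
rewrite ler_pdivlMr// -(subnKC nm) mulr_suml.
elim: (m - n)%N => [|k IH]; first by rewrite addn0 big_geq// exprn_ge0.
rewrite addnS big_nat_recr ?leq_addr//=.
have -> : \sum_(n <= i < n + k) q ^+ i * (1 - q) = q ^+ n - q ^+ (n + k).
  rewrite -mulr_suml; elim: k {IH} => [|k IH].
    by rewrite addn0 big_geq// mul0r subrr.
  by rewrite addnS big_nat_recr ?leq_addr//= mulrDl IH exprS; ring.
by rewrite mulrBr mulr1 -exprSr addrA subrK gerBl exprn_ge0.
Qed.

Lemma csum_diff_le (R : realType) (b : nat -> R[i]) (C q : R) n m :
  0 <= C -> 0 <= q < 1 -> (forall k, cmod (b k) <= C * q ^+ k) -> (n <= m)%N ->
  cmod (\sum_(j < m) b j - \sum_(j < n) b j) <= C * q ^+ n / (1 - q).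
Proof.
move=> C0 q01 hb nm.
rewrite -!(big_mkord xpredT b) (big_cat_nat (leq0n n) nm)//= addrAC subrr add0r.
rewrite (le_trans (cmod_sum _ _ _))//.
apply: (@le_trans _ _ (\sum_(n <= i < m) C * q ^+ i)); first exact: ler_sum.
by rewrite -mulr_sumr -mulrA ler_wpM2l// geo_sum_le.
Qed.

(** Coefficients bounded at radius [r] are dominated by a geometric series of ratio [q] where
    [cmod z <= q * r]. The limit is reached through a later partial sum, at the price of an
    arbitrary [e]. *)
Lemma is_ps_tail (R : realType) (rho r q C : R) a (f : R[i] -> R[i]) z n :
  is_ps rho a f -> 0 <= q < 1 -> 0 <= C ->
  (forall k, cmod (a k) * r ^+ k <= C) -> cmod z <= q * r -> cmod z < rho ->
  cmod (f z - psum a z n) <= C * q ^+ n / (1 - q).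
Proof.
move=> h q01 C0 hC zq zr; have [q0 q1] := andP q01.
apply/ler_addgt0Pr => e e0; have [N hN] := h z zr e e0.
have hm := hN (maxn n N) (leq_maxr _ _).
have -> : f z - psum a z n =
  (psum a z (maxn n N) - psum a z n) + (f z - psum a z (maxn n N)) by ring.
apply: le_trans (cmodD _ _) _; apply: lerD; last exact: ltW.
apply: (@csum_diff_le _ (fun j => a j * z ^+ j)) => //; last exact: leq_maxl.
move=> k; rewrite cmodM cmodX.
apply: (@le_trans _ _ (cmod (a k) * (q * r) ^+ k)).
  by rewrite ler_wpM2l ?cmod_ge0// lerXn2r// ?nnegrE ?cmod_ge0// (le_trans _ zq) ?cmod_ge0.
by rewrite exprMn mulrCA mulrC ler_wpM2r// exprn_ge0.
Qed.

(** Let [c k] be the first nonzero coefficient of the difference, a series for 0. At the point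
    [q * (rho / 2)] the tail after [c k] has order [q ^+ k.+1], too small to cancel the term [c k]
    when [q] is small. *)
Lemma is_ps_uniq (R : realType) (rho : R) a b (f : R[i] -> R[i]) :
  0 < rho -> is_ps rho a f -> is_ps rho b f -> a =1 b.
Proof.
move=> rho0 ha hb.
have hc := is_psB ha hb; set c := (fun k => _) in hc.
suff H : forall k, c k = 0 by move=> k; apply/eqP; rewrite -subr_eq0; apply/eqP; exact: H.
move=> k; elim/ltn_ind: k => k IH.
have r01 : 0 <= rho / 2 < rho by lra.
have [C C0 hC] := is_ps_bound hc r01.
have [r0 _] := andP r01.
apply/eqP; rewrite -cmod_eq0 eq_le cmod_ge0 andbT leNgt; apply/negP => ck0.
have r2 : 0 < rho / 2 by rewrite divr_gt0.
(* The second entry makes [C * q / (1 - q)] less than [cmod (c k) * (rho / 2) ^+ k]; the first gives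
   [1 - q >= 1 / 2]. *)
pose q := Num.min (2^-1) (cmod (c k) * (rho / 2) ^+ k / (4 * (C + 1))).
have C1 : 0 < 4 * (C + 1) by rewrite mulr_gt0// ltr_wpDl.
have P0 : 0 < (rho / 2) ^+ k by rewrite exprn_gt0.
have q0 : 0 < q by rewrite lt_min invr_gt0 ltr0n/= divr_gt0// mulr_gt0.
have q12 : q <= 2^-1 by rewrite ge_min lexx.
have q1 : q < 1 by apply: le_lt_trans q12 _; lra.
have q01 : 0 <= q < 1 by rewrite ltW.
have zE : cmod ((q * (rho / 2))%:C)%C = q * (rho / 2).
  by rewrite cmodr ger0_norm// mulr_ge0// ltW.
have zlt : cmod ((q * (rho / 2))%:C)%C < rho.
  rewrite zE; apply: (@lt_le_trans _ _ (1 * rho)); last by rewrite mul1r.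
  by apply: ltr_pM => //; rewrite ?(ltW q0) ?(ltW r2)//; case/andP: r01.
have := is_ps_tail k.+1 hc q01 C0 hC (_ : _ <= q * (rho / 2)) zlt.
rewrite zE lexx => /(_ isT); rewrite subrr psumS {1}/psum big1; last first.
  by move=> j _; rewrite IH ?mul0r.
rewrite !add0r cmodN cmodM cmodX zE exprMn exprS mulrCA => h.
have {h} : cmod (c k) * (rho / 2) ^+ k <= C * q / (1 - q).
  rewrite -(@ler_pM2l _ (q ^+ k)) ?exprn_gt0//.
  by apply: le_trans h _; rewrite le_eqVlt; apply/orP; left; apply/eqP; ring.
apply/negP; rewrite -ltNge.
have X0 : 0 < cmod (c k) * (rho / 2) ^+ k by rewrite mulr_gt0.
have qX : q * (4 * (C + 1)) <= cmod (c k) * (rho / 2) ^+ k.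
  by rewrite -ler_pdivlMr// ge_min lexx orbT.
have h1q : 2^-1 <= 1 - q by lra.
rewrite ltr_pdivrMr ?subr_gt0//.
apply: (@lt_le_trans _ _ (q * (4 * (C + 1)) * 2^-1)).
  have : 0 <= C * q by rewrite mulr_ge0// ltW.
  have -> : q * (4 * (C + 1)) * 2^-1 = 2 * (C * q) + 2 * q by field.
  by move: q0; lra.
by apply: ler_pM => //; rewrite ?invr_ge0// mulr_ge0 ?(ltW q0) ?(ltW C1).
Qed.

Lemma complex_complete (R : realType) (x : nat -> R[i]) :
  (forall e : R, 0 < e -> exists N, forall m n, (N <= m)%N -> (N <= n)%N ->
     cmod (x m - x n) < e) ->
  exists l, forall e : R, 0 < e -> exists N, forall n, (N <= n)%N -> cmod (x n - l) < e.
Proof.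
move=> hx.
have part (u : nat -> R) : (forall e : R, 0 < e -> exists N, forall m n, (N <= m)%N -> (N <= n)%N ->
     `|u m - u n| < e) -> exists l, forall e : R, 0 < e -> exists N, forall n, (N <= n)%N -> `|u n - l| < e.
  move=> hu.
  have cu : cvg (u @ \oo).
    apply: cauchy_cvg; apply: cauchy_exP => e e0; have [N hN] := hu e e0.
    by exists (u N); exists N => // n /= Nn; exact: hN.
  exists (lim (u @ \oo)) => e e0; have [n _ hn] := (@cvgrPdist_lt _ _ _ _ _ _ _).1 cu e e0.
  by exists n => m /hn; rewrite distrC.
have [l1 h1] : exists l, forall e : R, 0 < e -> exists N, forall n, (N <= n)%N -> `|complex.Re (x n) - l| < e.
  apply: part => e e0; have [N hN] := hx e e0; exists N => m n Nm Nn.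
  by rewrite -ReB (le_lt_trans (Re_le_cmod _))// hN.
have [l2 h2] : exists l, forall e : R, 0 < e -> exists N, forall n, (N <= n)%N -> `|complex.Im (x n) - l| < e.
  apply: part => e e0; have [N hN] := hx e e0; exists N => m n Nm Nn.
  by rewrite -ImB (le_lt_trans (Im_le_cmod _))// hN.
exists (l1 +i* l2)%C => e e0; have e2 : 0 < e / 2 by rewrite divr_gt0.
have [n1 hn1] := h1 _ e2; have [n2 hn2] := h2 _ e2.
exists (maxn n1 n2) => m; rewrite geq_max => /andP[/hn1 g1 /hn2 g2].
by rewrite (le_lt_trans (cmod_le_ReIm _))// [ltRHS]splitr ltrD// ?ReB ?ImB.
Qed.

Lemma csum_cvg (R : realType) (b : nat -> R[i]) (C q : R) :
  0 <= C -> 0 <= q < 1 -> (forall k, cmod (b k) <= C * q ^+ k) ->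
  exists s, forall e : R, 0 < e ->
    exists n, forall m, (n <= m)%N -> cmod (s - \sum_(j < m) b j) < e.
Proof.
move=> C0 q01 hb; have [q0 q1] := andP q01.
have hd m n : (m <= n)%N -> cmod (\sum_(j < n) b j - \sum_(j < m) b j) <= C / (1 - q) * q ^+ m.
  move=> mn; rewrite -!(big_mkord xpredT) (big_cat_nat (leq0n m) mn)/= addrAC subrr add0r.
  apply: le_trans (cmod_sum _ _ _) _; apply: le_trans (ler_sum _ (fun k _ => hb k)) _.
  by rewrite -mulr_sumr -mulrA [_^-1 * _]mulrC ler_wpM2l// geo_sum_le.
have [|l hl] := @complex_complete _ (fun n => \sum_(j < n) b j).
  move=> e e0; have [n hn] := @geo_small R q (C / (1 - q)) e q01 e0.
  exists n => m p /hn nm /hn np; have [mp|/ltnW pm] := leqP m p.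
    by rewrite cmodBC (le_lt_trans (hd _ _ mp)).
  exact: le_lt_trans (hd _ _ pm) np.
by exists l => e /hl[n hn]; exists n => m /hn; rewrite cmodBC.
Qed.

Lemma is_ps_exists (R : realType) (rho : R) (a : nat -> R[i]) : 0 < rho ->
  (forall r, 0 <= r < rho -> exists2 C : R, 0 <= C & forall k, cmod (a k) * r ^+ k <= C) ->
  exists f, is_ps rho a f.
Proof.
move=> rho0 h.
suff /choice[f hf] : forall z, exists s, cmod z < rho -> forall e : R, 0 < e ->
    exists n, forall m, (n <= m)%N -> cmod (s - psum a z m) < e.
  by exists f.
move=> z; have [zr|] := ltP (cmod z) rho; last by exists 0.
pose r := (cmod z + rho) / 2.
have r0 : 0 < r by rewrite /r; have := cmod_ge0 z; lra.
have zr' : cmod z < r by rewrite /r; lra.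
have rr : 0 <= r < rho by rewrite ltW// /r; lra.
have [C C0 hC] := h r rr.
have q01 : 0 <= cmod z / r < 1.
  apply/andP; split; first by rewrite divr_ge0 ?cmod_ge0// ltW.
  by rewrite ltr_pdivrMr// mul1r.
have [|s hs] := @csum_cvg _ (fun k => a k * z ^+ k) C (cmod z / r) C0 q01; last by exists s.
move=> k; rewrite cmodM cmodX expr_div_n mulrA ler_pdivlMr ?exprn_gt0//.
by rewrite mulrAC ler_wpM2r// exprn_ge0 ?cmod_ge0.
Qed.

(** For [t = p / q < 1], [k * t ^+ k] is at most [1 + t + ... + t ^+ k.-1], hence at most
    [1 / (1 - t)]. *)
Lemma nat_pow_le (R : realType) (p q : R) : 0 <= p -> p < q ->
  exists2 M : R, 0 <= M & forall k : nat, k%:R * p ^+ k <= M * q ^+ k.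
Proof.
move=> p0 pq; have q0 : 0 < q by exact: le_lt_trans pq.
have t01 : 0 <= p / q < 1.
  apply/andP; split; first by rewrite divr_ge0// ltW.
  by rewrite ltr_pdivrMr// mul1r.
have [t0 t1] := andP t01.
exists (1 - p / q)^-1; first by rewrite invr_ge0 subr_ge0 ltW.
move=> k; rewrite -ler_pdivrMr ?exprn_gt0// -mulrA -expr_div_n.
apply: (@le_trans _ _ (\sum_(0 <= j < k) (p / q) ^+ j)).
  rewrite mulr_natl -[in leLHS](subn0 k) -sumr_const_nat.
  rewrite big_nat_cond [leRHS]big_nat_cond; apply: ler_sum => j.
  rewrite subn0 andbT => /andP[_ jk].
  exact: (@ler_wiXn2l _ _ t0 (ltW t1) k j (ltnW jk)).
by have := @geo_sum_le R (p / q) 0 k t01 (leq0n k); rewrite expr0 mul1r.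
Qed.

Lemma cmod_nat (R : realType) (n : nat) : cmod (n%:R : R[i]) = n%:R.
Proof.
have -> : (n%:R : R[i]) = ((n%:R : R)%:C)%C by rewrite rmorph_nat.
by rewrite cmodr normr_nat.
Qed.

(** Second-order remainder of a power. The factor [s ^+ 2] on the left avoids the exponent [k - 2],
    and the crude [k * k] is preserved by the recurrence from [k] to [k.+1]. *)
Lemma pow_taylor (R : realType) (z w : R[i]) (s : R) : 0 <= s ->
  cmod z <= s -> cmod w <= s -> forall k : nat,
  s ^+ 2 * cmod (w ^+ k - z ^+ k - k%:R * z ^+ k.-1 * (w - z)) <=
  k%:R * (k%:R * s ^+ k) * cmod (w - z) ^+ 2.
Proof.
move=> s0 zs ws; elim=> [|k IH].
  by rewrite !mul0r subr0 subrr cmod0 mulr0.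
have E : w ^+ k.+1 - z ^+ k.+1 - k.+1%:R * z ^+ k * (w - z) =
  w * (w ^+ k - z ^+ k - k%:R * z ^+ k.-1 * (w - z)) + k%:R * z ^+ k.-1 * (w - z) ^+ 2.
  case: k {IH} => [|k]; first by rewrite !expr0; ring.
  by rewrite /= !exprS -[in LHS]natr1; ring.
rewrite /= E.
have h1 : cmod (w * (w ^+ k - z ^+ k - k%:R * z ^+ k.-1 * (w - z))) <=
    s * cmod (w ^+ k - z ^+ k - k%:R * z ^+ k.-1 * (w - z)).
  by rewrite cmodM ler_wpM2r ?cmod_ge0.
have h2 : s ^+ 2 * cmod (k%:R * z ^+ k.-1 * (w - z) ^+ 2) <=
    k%:R * s ^+ k.+1 * cmod (w - z) ^+ 2.
  rewrite (cmodM _ ((w - z) ^+ 2)) (cmodX (w - z)) mulrA ler_wpM2r ?exprn_ge0 ?cmod_ge0//.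
  rewrite cmodM cmodX cmod_nat mulrCA; case: k {IH E h1} => [|k] /=; first by rewrite !mul0r.
  rewrite ler_wpM2l// (_ : s ^+ k.+2 = s ^+ 2 * s ^+ k); last by rewrite -exprD.
  by rewrite ler_wpM2l ?exprn_ge0// lerXn2r ?nnegrE ?cmod_ge0.
have h3 := ler_wpM2l s0 IH.
have h4 : s ^+ 2 * cmod (w * (w ^+ k - z ^+ k - k%:R * z ^+ k.-1 * (w - z))) <=
    k%:R * (k%:R * s ^+ k.+1) * cmod (w - z) ^+ 2.
  apply: le_trans (ler_wpM2l (exprn_ge0 2 s0) h1) _; rewrite mulrCA.
  apply: le_trans h3 _; rewrite (exprS s k) le_eqVlt; apply/orP; left; apply/eqP; ring.
apply: le_trans (ler_wpM2l (exprn_ge0 2 s0) (cmodD _ _)) _.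
rewrite mulrDr; apply: le_trans (lerD h4 h2) _.
have -> : k.+1%:R * (k.+1%:R * s ^+ k.+1) * cmod (w - z) ^+ 2 =
  k%:R * (k%:R * s ^+ k.+1) * cmod (w - z) ^+ 2 + k%:R * s ^+ k.+1 * cmod (w - z) ^+ 2
   + k.+1%:R * s ^+ k.+1 * cmod (w - z) ^+ 2 by rewrite -natr1; ring.
by rewrite lerDl !mulr_ge0 ?exprn_ge0 ?cmod_ge0.
Qed.

Lemma ps_cdiff (R : realType) (rho : R) (a : nat -> R[i]) f z :
  is_ps rho a f -> cmod z < rho -> exists d, cdiff f z d.
Proof.
move=> hf zr.
(* Radii [cmod z < s < u < t < r < rho]: passing from [s] to [u] and from [u] to [t] absorbs one
   factor [k] each, and [t / r] is the ratio of the dominating geometric series. *)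
pose s := (2 * cmod z + rho) / 3.
pose t := (cmod z + rho) / 2.
pose u := (s + t) / 2.
pose r := (t + rho) / 2.
have z0 := cmod_ge0 z.
have s0 : 0 < s by rewrite /s; lra.
have zs : cmod z < s by rewrite /s; lra.
have st : s < t by rewrite /s /t; lra.
have su : s < u by rewrite /u; lra.
have ut : u < t by rewrite /u; lra.
have tr : t < r by rewrite /r /t; lra.
have rr : r < rho by rewrite /r /t; lra.
have r0 : 0 < r by rewrite (lt_trans _ tr)// (lt_trans _ st).
have t0 : 0 < t by rewrite (lt_trans _ st).
have r01 : 0 <= r < rho by rewrite ltW.
clearbody r u t s.
have [C C0 hC] := is_ps_bound hf r01.
have [M1 M10 hM1] := @nat_pow_le R s u (ltW s0) su.
have [M2 M20 hM2] := @nat_pow_le R u t (le_trans (ltW s0) (ltW su)) ut.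
have k2 (k : nat) : k%:R * (k%:R * s ^+ k) <= M1 * M2 * t ^+ k.
  apply: le_trans (ler_wpM2l (ler0n _ _) (hM1 k)) _.
  by rewrite mulrCA -mulrA ler_wpM2l.
have q01 : 0 <= t / r < 1.
  apply/andP; split; first by rewrite divr_ge0// ltW.
  by rewrite ltr_pdivrMr// mul1r.
have [q0 q1] := andP q01.
have ak k : cmod (a k) * t ^+ k <= C * (t / r) ^+ k.
  rewrite expr_div_n mulrA ler_pdivlMr ?exprn_gt0// mulrAC ler_wpM2r//.
  by rewrite exprn_ge0// ltW.
(* Terms of the derived series; at [k = 0] the factor [k] makes the truncated exponent harmless. *)
pose b k := a k * (k%:R * z ^+ k.-1).
have [d hd] : exists d, forall e : R, 0 < e ->
    exists n, forall m, (n <= m)%N -> cmod (d - \sum_(j < m) b j) < e.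
  apply: (@csum_cvg _ _ (s^-1 * (M1 * M2 * C)) (t / r)) => //.
    by rewrite !mulr_ge0// invr_ge0 ltW.
  move=> k; rewrite /b !cmodM cmod_nat cmodX.
  have [->|k0] := posnP k.
    rewrite !mul0r mulr0 expr0 mulr1 !mulr_ge0// invr_ge0; exact: ltW.
  rewrite -(ler_pM2l s0) (_ : s * (s^-1 * _ * _) = M1 * M2 * (C * (t / r) ^+ k)); last first.
    by field; rewrite ?gt_eqF.
  have -> : s * (cmod (a k) * (k%:R * cmod z ^+ k.-1)) =
    cmod (a k) * (k%:R * cmod z ^+ k.-1 * s) by ring.
  have hk : k%:R * cmod z ^+ k.-1 * s <= M1 * M2 * t ^+ k.
    apply: le_trans (k2 k).
    have -> : s ^+ k = s ^+ k.-1 * s by rewrite -exprSr prednK.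
    rewrite -mulrA ler_wpM2l// mulrA ler_wpM2r ?(ltW s0)//.
    apply: (@le_trans _ _ (s ^+ k.-1)).
      by rewrite lerXn2r ?nnegrE ?cmod_ge0// ltW.
    by rewrite ler_peMl ?exprn_ge0 ?(ltW s0)// ler1n.
  apply: le_trans (ler_wpM2l (cmod_ge0 _) hk) _.
  by rewrite mulrCA ler_wpM2l ?mulr_ge0.
exists d => e e0.
pose M := s ^-2 * (M1 * M2 * C / (1 - t / r)).
have M0 : 0 <= M.
  by rewrite mulr_ge0 ?invr_ge0 ?exprn_ge0 ?(ltW s0)// divr_ge0 ?subr_ge0 ?(ltW q1)// !mulr_ge0.
have key w : cmod w <= s -> cmod (f w - f z - d * (w - z)) <= M * cmod (w - z) ^+ 2.
  move=> ws; apply/ler_addgt0Pr => x x0.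
  (* The approximations of [f w], [f z] and [d] enter with weights 1, 1 and [cmod (w - z)], so the
     tolerance [x] is divided by their sum. *)
  have c3 : 0 < 2 + cmod (w - z) by rewrite ltr_wpDr ?cmod_ge0.
  have y0 : 0 < x / (2 + cmod (w - z)) by rewrite divr_gt0.
  have wr : cmod w < rho by rewrite (le_lt_trans ws)// (lt_trans st)// (lt_trans tr).
  have [n1 h1] := hf w wr _ y0; have [n2 h2] := hf z zr _ y0; have [n3 h3] := hd _ y0.
  pose n := maxn n1 (maxn n2 n3).
  have {}h1 := h1 n (leq_maxl _ _).
  have {}h2 := h2 n (leq_trans (leq_maxl _ _) (leq_maxr _ _)).
  have {}h3 := h3 n (leq_trans (leq_maxr _ _) (leq_maxr _ _)).
  pose P := psum a w n - psum a z n - (\sum_(j < n) b j) * (w - z).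
  have hP : cmod P <= M * cmod (w - z) ^+ 2.
    have -> : P = \sum_(j < n) a j * (w ^+ j - z ^+ j - j%:R * z ^+ j.-1 * (w - z)).
      rewrite /P /psum mulr_suml -!sumrB; apply: eq_bigr => j _; rewrite /b; ring.
    apply: le_trans (cmod_sum _ _ _) _.
    apply: (@le_trans _ _ (\sum_(j < n) s ^-2 * (M1 * M2 * C) * (t / r) ^+ j * cmod (w - z) ^+ 2)).
      apply: ler_sum => j _; rewrite cmodM.
      have := pow_taylor (ltW s0) (ltW zs) ws j.
      rewrite mulrC -ler_pdivlMr ?exprn_gt0// => hj.
      apply: le_trans (ler_wpM2l (cmod_ge0 _) hj) _.
      have -> : cmod (a j) * (j%:R * (j%:R * s ^+ j) * cmod (w - z) ^+ 2 / s ^+ 2) =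
        (j%:R * (j%:R * s ^+ j)) * (cmod (a j) * (s ^- 2 * cmod (w - z) ^+ 2)) by ring.
      have cc : 0 <= cmod (a j) * (s ^- 2 * cmod (w - z) ^+ 2).
        by rewrite !mulr_ge0 ?exprn_ge0 ?cmod_ge0// invr_ge0 exprn_ge0// ltW.
      apply: le_trans (ler_wpM2r cc (k2 j)) _.
      have -> : M1 * M2 * t ^+ j * (cmod (a j) * (s ^- 2 * cmod (w - z) ^+ 2)) =
        (M1 * M2 * (s ^- 2 * cmod (w - z) ^+ 2)) * (cmod (a j) * t ^+ j) by ring.
      have -> : s ^- 2 * (M1 * M2 * C) * (t / r) ^+ j * cmod (w - z) ^+ 2 =
        (M1 * M2 * (s ^- 2 * cmod (w - z) ^+ 2)) * (C * (t / r) ^+ j) by ring.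
      rewrite ler_wpM2l ?ak// !mulr_ge0 ?exprn_ge0 ?cmod_ge0// invr_ge0 exprn_ge0//.
      exact: ltW.
    rewrite -mulr_suml ler_wpM2r ?exprn_ge0 ?cmod_ge0// -mulr_sumr /M -mulrA.
    rewrite ler_wpM2l ?invr_ge0 ?exprn_ge0 ?(ltW s0)// ler_wpM2l ?mulr_ge0//.
    have := @geo_sum_le R (t / r) 0 n q01 (leq0n n).
    by rewrite expr0 mul1r big_mkord.
  have -> : f w - f z - d * (w - z) = P + ((f w - psum a w n) - (f z - psum a z n)
     - (d - \sum_(j < n) b j) * (w - z)) by rewrite /P; ring.
  apply: le_trans (cmodD _ _) _; apply: lerD => //.
  apply: le_trans (cmodB _ _) _; rewrite cmodM.
  have hh := cmodB (f w - psum a w n) (f z - psum a z n).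
  have : cmod (d - \sum_(j < n) b j) * cmod (w - z) <= x / (2 + cmod (w - z)) * cmod (w - z).
    by rewrite ler_wpM2r ?cmod_ge0// ltW.
  have : x / (2 + cmod (w - z)) * (2 + cmod (w - z)) = x by rewrite divfK ?gt_eqF.
  move: h1 h2 hh; rewrite mulrDr; lra.
exists (Num.min (s - cmod z) (e / (M + 1))).
  by rewrite lt_min subr_gt0 zs divr_gt0// ltr_wpDl.
move=> w; rewrite lt_min => /andP[w1 w2].
have ws : cmod w <= s.
  by rewrite -(subrK z w) (le_trans (cmodD _ _))// -lerBrDr ltW.
apply: le_trans (key w ws) _; rewrite expr2 mulrA ler_wpM2r ?cmod_ge0//.
move: w2; rewrite ltr_pdivlMr ?ltr_wpDl// => w2.
by apply: ltW; apply: le_lt_trans w2; rewrite mulrC ler_wpM2l ?cmod_ge0// lerDl.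
Qed.

Lemma ps_holomorphic (R : realType) (a : nat -> R[i]) f :
  is_ps 1 a f -> holomorphic f.
Proof. by move=> hf; apply/holomorphicP => z z1; exact: ps_cdiff hf z1. Qed.

(** The coefficients read off a circle might depend on its radius; uniqueness near 0 shows that they
    do not, so those of radius 1/2 serve at every point of the disk. *)
Lemma holomorphic_ps (R : realType) (f : R[i] -> R[i]) :
  holomorphic f -> exists a, is_ps 1 a f.
Proof.
move=> /holomorphicP df.
pose a (rho : R) j := ((2 * pi)^-1 * rho^-1 ^+ j)%:C%C *
       ci 0 (2 * pi) (fun t => f (rho%:C%C * expi t) * conjc (expi t) ^+ j).
have H rho : 0 < rho < 1 -> is_ps rho (a rho) f.
  move=> /andP[r0 r1] z zr e e0.
  have [C hC] := cauchy_expansion df r0 r1 zr.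
  have q01 : 0 <= cmod z / rho < 1.
    apply/andP; split; first by rewrite divr_ge0 ?cmod_ge0// ltW.
    by rewrite ltr_pdivrMr// mul1r.
  have [n hn] := @geo_small R _ C e q01 e0.
  by exists n => m /hn; apply: le_lt_trans; exact: hC.
have h2 : 0 < (2^-1 : R) < 1 by apply/andP; split; lra.
exists (a 2^-1) => z z1.
(* Large enough to enclose [z], and at least 1/2 so that both expansions hold on the disk of radius
   1/2. *)
pose rho := Num.max (2^-1) ((1 + cmod z) / 2).
have rho01 : 0 < rho < 1.
  by rewrite /rho lt_max gt_max invr_gt0 ltr0n/=; apply/andP; split; lra.
have zr : cmod z < rho by rewrite /rho lt_max; apply/orP; right; lra.
have hr := H _ rho01.
have -> : a 2^-1 = a rho; last exact: hr.
apply/funext; apply: (@is_ps_uniq _ 2^-1 _ _ f); first by case/andP: h2.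
  exact: H.
by apply: is_psS hr; rewrite /rho le_max lexx.
Qed.

(** * Polar coordinates *)

Lemma ri_affine (R : realType) (a b c d : R) (phi : R -> R) : a <= b -> 0 < c ->
  (forall t, {for t, continuous phi}) ->
  ri (c * a + d) (c * b + d) phi = c * ri a b (fun x => phi (c * x + d)).
Proof.
move=> ab c0 cphi.
have caff t : {for t, continuous (fun x : R => c * x + d)}.
  by apply: cvgD; [apply: (@cont_scale _ c id); exact: cvg_id|exact: cvg_cst].
have ccomp t : {for t, continuous (fun x => phi (c * x + d))}.
  exact: (@continuous_comp _ _ _ (fun x : R => c * x + d) phi).
have hd (x : R) : is_derive x (1 : R) (fun x : R => c * x + d) c.
  by apply: is_derive_eq; rewrite /GRing.scale/=; ring.
have dF : (fun x : R => c * x + d)^`()%classic = cst c.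
  by apply/funext => x; rewrite derive1E; case: (hd x).
have derF x : derivable (fun x : R => c * x + d) x 1 by case: (hd x).
rewrite -riZ// /ri /Rintegral; congr fine.
rewrite (@integration_by_substitution_increasing _ (fun x : R => c * x + d))//.
- apply: eq_integral => x _; rewrite dF/=.
  by congr EFin; rewrite [RHS]mulrC.
- by move=> x y _ _ xy; rewrite ltrD2r ltr_pM2l.
- by move=> x _; rewrite dF; exact: cvg_cst.
- by rewrite dF; exact: is_cvg_cst.
- by rewrite dF; exact: is_cvg_cst.
- split; first by move=> x _; exact: derF.
  + by apply: cvg_at_right_filter; exact: caff.
  + by apply: cvg_at_left_filter; exact: caff.
- by apply: within_cont => t _.
Qed.

Lemma ri_shift (R : realType) (a b d : R) (phi : R -> R) : a <= b ->
  (forall t, {for t, continuous phi}) ->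
  ri (a + d) (b + d) phi = ri a b (fun x => phi (x + d)).
Proof.
move=> ab cphi; have := ri_affine d ab ltr01 cphi.
by rewrite !mul1r => ->; apply: eq_ri => t _; rewrite mul1r.
Qed.

Lemma ri_period (R : realType) (a b T : R) (phi : R -> R) :
  b <= a -> a <= b + T -> (forall t, {for t, continuous phi}) ->
  (forall t, phi (t + T) = phi t) -> ri a (a + T) phi = ri b (b + T) phi.
Proof.
move=> ba abT cphi per.
rewrite (@ri_split _ b a (b + T))//.
rewrite (@ri_split _ a (b + T) (a + T)) ?lerD2r//.
rewrite ri_shift// [RHS]addrC; congr (_ + _).
by apply: eq_ri => t _; rewrite per.
Qed.

Local Notation mu := lebesgue_measure.

Section scaling.
Local Open Scope ereal_scope.
Context (R : realType) (c : R).
Hypothesis c0 : (c != 0)%R.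

Let phi : measurableTypeR R -> measurableTypeR R := fun x => (c * x)%R.
Let mphi : measurable_fun setT phi.
Proof. exact: mulrl_measurable. Qed.
Let pf : {measure set (measurableTypeR R) -> \bar R} :=
  measure_function_pushforward__canonical__measure_function_Measure (@lebesgue_measure R) mphi.
Let cn : (0 <= `|c|)%R. Proof. exact: normr_ge0. Qed.
Let nu : {measure set (measurableTypeR R) -> \bar R} :=
  mscale (NngNum cn) pf.

(** Both measures agree on half-open intervals, and these determine Lebesgue measure. *)
Lemma lebesgue_scale (A : set (measurableTypeR R)) : measurable A -> mu A = nu A.
Proof.
apply: lebesgue_measure_unique => _ [[a b]] _ <-.
have -> : nu `]a, b]%classic = `|c|%:E * mu (phi @^-1` `]a, b]%classic) by [].
have [cpos|cneg] := ltP 0%R c.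
  have -> : phi @^-1` `]a, b] = `](a / c)%R, (b / c)%R]%classic.
    apply/seteqP; split => x /=; rewrite !in_itv/= /phi.
      by rewrite ltr_pdivrMr// ler_pdivlMr// ![(c * _)%R]mulrC.
    by rewrite ltr_pdivrMr// ler_pdivlMr// ![(c * _)%R]mulrC.
  rewrite !lebesgue_measure_itv/= !lte_fin ltr_pM2r ?invr_gt0//.
  rewrite gtr0_norm//; case: ifPn => _; last by rewrite mule0.
  by rewrite -!EFinD -EFinM; congr EFin; field.
have {}cneg : (c < 0)%R by rewrite lt_neqAle c0.
have -> : phi @^-1` `]a, b] = `[(b / c)%R, (a / c)%R[%classic.
  apply/seteqP; split => x /=; rewrite !in_itv/= /phi.
    by rewrite ler_ndivrMr// ltr_ndivlMr// ![(c * _)%R]mulrC andbC.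
  by rewrite ler_ndivrMr// ltr_ndivlMr// ![(c * _)%R]mulrC andbC.
rewrite !lebesgue_measure_itv/= !lte_fin ltr_nM2r ?invr_lt0//.
rewrite ltr0_norm//; case: ifPn => _; last by rewrite mule0.
by rewrite -!EFinD -EFinM; congr EFin; field.
Qed.

Lemma integral_scale (f : measurableTypeR R -> \bar R) :
  measurable_fun setT f -> (forall x, 0 <= f x) ->
  \int[mu]_x f x = `|c|%:E * \int[mu]_x f (c * x)%R.
Proof.
move=> mf f0.
rewrite (@eq_measure_integral _ _ _ _ nu); last by move=> A mA _; exact: lebesgue_scale.
rewrite ge0_integral_mscale//= ge0_integral_pushforward//.
Qed.

End scaling.

Section polar.
Local Open Scope ereal_scope.
Context (R : realType) (g : plane R -> \bar R).
Hypotheses (mg : measurable_fun setT g) (g0 : forall p, 0 <= g p).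

(** This is [cos (atan s)]: with [x = cosat s * r], the point [(x, x * s)] is
    [r * expi (atan s)]. *)
Definition cosat (s : R) : R := ((Num.sqrt (1 + s ^+ 2))^-1)%R.

Lemma cosat_gt0 s : (0 < cosat s)%R.
Proof. by rewrite invr_gt0 sqrtr_gt0 ltr_wpDr ?sqr_ge0. Qed.

Lemma cosat_sq s : (cosat s ^+ 2 = (1 + s ^+ 2)^-1)%R.
Proof. by rewrite exprVn sqr_sqrtr// addr_ge0 ?sqr_ge0. Qed.

Let mR := measurableTypeR R.

Lemma measurable_cosat : measurable_fun setT (cosat : mR -> mR).
Proof.
apply: continuous_measurable_fun => s.
apply: (@cvgV _ _ (nbhs s)); first by rewrite gt_eqF// sqrtr_gt0 ltr_wpDr ?sqr_ge0.
apply: (@continuous_comp _ _ _ (fun s : R => 1 + s ^+ 2)%R Num.sqrt); last exact: sqrt_continuous.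
by apply: cvgD; [exact: cvg_cst|exact: exprn_continuous].
Qed.

Let mfst : measurable_fun setT (fun p : plane R => (p.1 : mR)).
Proof. exact: measurable_fst. Qed.
Let msnd : measurable_fun setT (fun p : plane R => (p.2 : mR)).
Proof. exact: measurable_snd. Qed.

Let g1 (p : plane R) := `|p.1|%:E * g (p.1, p.1 * p.2)%R.
Let mg1 : measurable_fun setT g1.
Proof.
apply: emeasurable_funM.
  by apply/measurable_EFinP; apply: measurableT_comp.
apply: (measurableT_comp mg); apply/measurable_fun_pairP; split => //=.
exact: measurable_funM.
Qed.

Let g2 (p : plane R) := ((1 + p.2 ^+ 2)^-1 * `|p.1|)%:E *
  g (cosat p.2 * p.1, cosat p.2 * p.1 * p.2)%R.
Let mg2 : measurable_fun setT g2.
Proof.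
have mc : measurable_fun setT (fun p : plane R => (cosat p.2 : mR)).
  exact: (measurableT_comp measurable_cosat).
apply: emeasurable_funM.
  apply/measurable_EFinP; apply: measurable_funM; last exact: measurableT_comp.
  rewrite (_ : (fun _ => _) = (fun p : plane R => cosat p.2 ^+ 2)%R); last first.
    by apply/funext => p; rewrite cosat_sq.
  by apply: measurable_funX.
apply: (measurableT_comp mg); apply/measurable_fun_pairP; split => /=.
  exact: measurable_funM.
by apply: measurable_funM => //; exact: measurable_funM.
Qed.

Let g10 p : 0 <= g1 p. Proof. by rewrite mule_ge0 ?lee_fin. Qed.
Let g20 p : 0 <= g2 p.
Proof. by rewrite mule_ge0 ?lee_fin// mulr_ge0// invr_ge0 addr_ge0// sqr_ge0. Qed.

Let msec x : measurable_fun setT (fun y : mR => g (x, y)).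
Proof. by apply: (measurableT_comp mg); exact: measurable_pair1. Qed.

Let fubini_g2 (r : mR) : fubini_F (@lebesgue_measure R) g2 r = `|r|%:E *
     \int[mu]_s (((1 + s ^+ 2)^-1)%:E * g (cosat s * r, cosat s * r * s)%R).
Proof.
rewrite /fubini_F /g2/= -ge0_integralZl//.
- by apply: eq_integral => s _; rewrite [in LHS]mulrC EFinM muleA.
- apply: emeasurable_funM.
    apply/measurable_EFinP; rewrite (_ : (fun _ => _) = (fun s : mR => cosat s ^+ 2)%R); last first.
      by apply/funext => s; rewrite cosat_sq.
    by apply: measurable_funX; exact: measurable_cosat.
  apply: (measurableT_comp mg); apply/measurable_fun_pairP.
  have mc : measurable_fun setT (fun s : mR => cosat s * r)%R.
    by apply: measurable_funM => //; exact: measurable_cosat.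
  by split => //=; apply: measurable_funM.
- by move=> s _; rewrite mule_ge0// lee_fin invr_ge0 addr_ge0// sqr_ge0.
Qed.

(* Fubini in the slope coordinates [y = x * s], followed by [x = cosat s * r];
   no change of variables in the plane is needed. *)
Lemma polar_slope :
  \int[(@lebesgue_measure R \x @lebesgue_measure R)%E]_p g p =
  \int[mu]_r (`|r|%:E *
     \int[mu]_s (((1 + s ^+ 2)^-1)%:E * g (cosat s * r, cosat s * r * s)%R)).
Proof.
rewrite fubini_tonelli1//.
have mF : measurable_fun setT (fubini_F (@lebesgue_measure R) g).
  exact: measurable_fun_fubini_tonelli_F.
(* The slope is undefined on the line [x = 0], which is removed as a null set and put back after the
   substitution. *)
have mD : measurable ([set: mR] `\ 0%R) by exact: measurableD.
rewrite -(integral_setD1 mD (measurable_funTS mF)).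
transitivity (\int[mu]_(x in [set: mR] `\ 0%R) fubini_F (@lebesgue_measure R) g1 x).
  apply: eq_integral => x; rewrite inE/= => -[_ /eqP x0].
  rewrite /fubini_F (integral_scale x0 (msec x))// -ge0_integralZl//.
  by apply: (measurableT_comp (msec x)); exact: mulrl_measurable.
have mF1 : measurable_fun setT (fubini_F (@lebesgue_measure R) g1).
  exact: measurable_fun_fubini_tonelli_F.
rewrite (integral_setD1 mD (measurable_funTS mF1)).
rewrite (fubini_tonelli g1)//.
(* The Jacobian [cosat s] and the factor [|x| = cosat s * |r|] combine to
   [cosat s ^+ 2 = 1 / (1 + s ^+ 2)], the derivative of [atan]. *)
transitivity (\int[mu]_s fubini_G (@lebesgue_measure R) g2 (s : mR)).
  apply: eq_integral => s _; rewrite /fubini_G.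
  have c0 : cosat s != 0%R by rewrite gt_eqF// cosat_gt0.
  have ms : measurable_fun setT (fun x : mR => g1 (x, s)).
    by apply: (measurableT_comp mg1); exact: measurable_pair2.
  rewrite (integral_scale c0 ms)// -ge0_integralZl//; last first.
    by apply: (measurableT_comp ms); exact: mulrl_measurable.
  apply: eq_integral => x _; rewrite /g1 /g2/= muleA -EFinM; congr (_%:E * _).
  by rewrite normrM gtr0_norm ?cosat_gt0// mulrA -expr2 cosat_sq.
by rewrite -(fubini_tonelli g2)//; apply: eq_integral => r _; exact: fubini_g2.
Qed.

Lemma measurable_polar_slope : measurable_fun setT (fun r : mR => `|r|%:E *
     \int[mu]_s (((1 + s ^+ 2)^-1)%:E * g (cosat s * r, cosat s * r * s)%R)).
Proof.
rewrite (_ : (fun _ => _) = fubini_F (@lebesgue_measure R) g2); last first.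
  by apply/funext => r; rewrite fubini_g2.
exact: measurable_fun_fubini_tonelli_F.
Qed.

End polar.

(** Substitution on the compact intervals [[-n, n]], whose images under [atan] exhaust the open
    interval of length [pi]; monotone convergence on both sides. *)
Lemma integral_atan (R : realType) (phi : R -> R) :
  (forall t, {for t, continuous phi}) -> (forall t, 0 <= phi t) ->
  (\int[mu]_s ((1 + s ^+ 2)^-1 * phi (atan s))%:E =
   (ri (- (pi / 2)) (pi / 2) phi)%:E)%E.
Proof.
move=> cphi phi0.
pose F n : set (measurableTypeR R) := `[- n%:R, n%:R]%classic.
pose H n : set (measurableTypeR R) := `[atan (- n%:R), atan n%:R]%classic.
have cFG : continuous (fun s : R => (1 + s ^+ 2)^-1 * phi (atan s)).
  move=> s; apply: cvgM.
    apply: (@cvgV _ _ (nbhs s)); first by rewrite gt_eqF// ltr_wpDr ?sqr_ge0.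
    by apply: cvgD; [exact: cvg_cst|exact: exprn_continuous].
  by apply: (@continuous_comp _ _ _ (@atan R) phi); [exact: continuous_atan|exact: cphi].
have mphi : measurable_fun setT (EFin \o phi).
  by apply/measurable_EFinP; exact: continuous_measurable_fun.
have mFG : measurable_fun setT (fun s : R => ((1 + s ^+ 2)^-1 * phi (atan s))%:E).
  by apply/measurable_EFinP; exact: continuous_measurable_fun.
have UF : \bigcup_n F n = setT.
  apply/seteqP; split => // x _; exists (Num.truncn `|x|).+1 => //=.
  by rewrite /F/= in_itv/= -ler_norml ltW// truncnS_gt.
have UH : \bigcup_n H n = `](- (pi / 2)), (pi / 2)[%classic.
  apply/seteqP; split => x /=.
    case=> n _; rewrite /H/= !in_itv/= => /andP[h1 h2].
    by rewrite (lt_le_trans (atan_gtNpi2 _) h1) (le_lt_trans h2 (atan_ltpi2 _)).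
  move=> xI; have : setT (tan x) by []; rewrite -UF => -[n _].
  rewrite /F/= in_itv/= => /andP[h1 h2]; exists n => //; rewrite /H/= in_itv/=.
  by rewrite -(tanK xI) !le_atan.
have c1 : (\int[mu]_(x in F n) ((1 + x ^+ 2)^-1 * phi (atan x))%:E)%E @[n --> \oo] -->
    (\int[mu]_s ((1 + s ^+ 2)^-1 * phi (atan s))%:E)%E.
  rewrite -UF; apply: ge0_nondecreasing_set_cvg_integral => //.
  - move=> n m nm; apply/subsetPset => x; rewrite /F/= !in_itv/= => /andP[h1 h2].
    have : (n%:R : R) <= m%:R by rewrite ler_nat.
    by move=> nmR; apply/andP; split; lra.
  - by move=> n; exact: measurable_itv.
  - by move=> n; apply: measurable_funTS; exact: mFG.
  - by move=> n x _; rewrite lee_fin mulr_ge0// invr_ge0 addr_ge0// sqr_ge0.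
have c2 : (\int[mu]_(x in H n) (phi x)%:E)%E @[n --> \oo] -->
    (ri (- (pi / 2)) (pi / 2) phi)%:E.
  rewrite -ri_EFin; last by move=> t _; exact: cphi.
  have -> : (\int[mu]_(x in `[(- (pi / 2))%R, (pi / 2)%R]) (phi x)%:E =
      \int[mu]_(x in `](- (pi / 2))%R, (pi / 2)%R[) (phi x)%:E)%E.
    by rewrite (@integral_itv_bndoo _ _ _ _ true false)//; exact: measurable_funTS.
  rewrite -UH; apply: ge0_nondecreasing_set_cvg_integral => //.
  - move=> n m nm; apply/subsetPset => x; rewrite /H/= !in_itv/= => /andP[h1 h2].
    have nmR : (n%:R : R) <= m%:R by rewrite ler_nat.
    by rewrite (le_trans _ h1) ?(le_trans h2)// le_atan// lerN2.
  - by move=> n; exact: measurable_itv.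
  - by move=> n; apply: measurable_funTS; exact: mphi.
  - by move=> n x _; rewrite lee_fin.
have c12 n : (\int[mu]_(x in H n) (phi x)%:E =
    \int[mu]_(x in F n) ((1 + x ^+ 2)^-1 * phi (atan x))%:E)%E.
  have dA : (@atan R)^`()%classic = (fun x => (1 + x ^+ 2)^-1).
    by apply/funext => x; rewrite derive1_atan.
  have cA : continuous (fun x : R => (1 + x ^+ 2)^-1).
    move=> s; apply: (@cvgV _ _ (nbhs s)); first by rewrite gt_eqF// ltr_wpDr ?sqr_ge0.
    by apply: cvgD; [exact: cvg_cst|exact: exprn_continuous].
  rewrite /H (@integration_by_substitution_increasing _ (@atan R)).
  - by apply: eq_integral => x _; rewrite dA/= mulrC.
  - by rewrite -subr_ge0 opprK addr_ge0.
  - by move=> x y _ _; exact: lt_atan.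
  - by move=> x _; rewrite dA; exact: cA.
  - by rewrite dA; apply/cvg_ex; eexists; apply: cvg_at_right_filter; exact: cA.
  - by rewrite dA; apply/cvg_ex; eexists; apply: cvg_at_left_filter; exact: cA.
  - split; first by move=> x _; exact: derivable_atan.
    + by apply: cvg_at_right_filter; exact: continuous_atan.
    + by apply: cvg_at_left_filter; exact: continuous_atan.
  - by apply: within_cont => t _; exact: cphi.
have E12 : (fun n => \int[mu]_(x in H n) (phi x)%:E)%E =
    (fun n => \int[mu]_(x in F n) ((1 + x ^+ 2)^-1 * phi (atan x))%:E)%E.
  by apply/funext => n; rewrite c12.
rewrite E12 in c2.
exact: (cvg_unique _ c1 c2).
Qed.

Lemma sin_atan (R : realType) (x : R) : sin (atan x) = x * cos (atan x).
Proof.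
have c0 : cos (atan x) != 0.
  by rewrite cos_atan invr_eq0 gt_eqF// sqrtr_gt0 ltr_wpDr ?sqr_ge0.
by rewrite -[X in X * _](atanK x) /tan divfK.
Qed.

Lemma measurable_disk (R : realType) : measurable (@disk_xy R).
Proof.
have m : measurable_fun setT (fun p : plane R => (p.1 ^+ 2 + p.2 ^+ 2 : measurableTypeR R)).
  apply: measurable_funD; apply: measurable_funX.
    exact: measurable_fst.
  exact: measurable_snd.
rewrite (_ : @disk_xy R = (fun p : plane R => (p.1 ^+ 2 + p.2 ^+ 2 : measurableTypeR R)) @^-1` `]-oo, 1[%classic).
  by rewrite -[X in measurable X]setTI; apply: m => //; exact: measurable_itv.
apply/seteqP; split => -[x y]/=; rewrite /disk_xy/= in_itv/=.
  move=> /disk_cmod; rewrite cmodE/= => h.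
  by rewrite -(@sqr_sqrtr _ (x ^+ 2 + y ^+ 2)) ?addr_ge0 ?sqr_ge0// expr_lt1 ?sqrtr_ge0.
move=> h; apply/disk_cmod; rewrite cmodE/=.
by rewrite -(@expr_lt1 _ 2) ?sqrtr_ge0// sqr_sqrtr ?addr_ge0 ?sqr_ge0.
Qed.

(** [polar_slope] has angles in a half-circle and radii of both signs. A negative radius is a
    positive one with its angle shifted by [pi], and the two half-circles make up a period. *)
Lemma disk_polar (R : realType) (G : R[i] -> R) :
  measurable_fun (@disk_xy R) (fun p : plane R => G (cplx p)) ->
  (forall z, cmod z < 1 -> 0 <= G z) ->
  (forall r, 0 < r < 1 -> forall t, {for t, continuous (fun t => G (r%:C%C * expi t))}) ->
  (disk_int (fun z => (G z)%:E) = (pi^-1)%:E *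
    \int[mu]_(r in `]0%R, 1%R[) (r * ri 0 (2 * pi) (fun t => G (r%:C%C * expi t)))%:E)%E.
Proof.
move=> mG G0 cG.
rewrite /disk_int; congr (_ * _)%E.
pose g : plane R -> \bar R := (fun p => (G (cplx p))%:E) \_ (@disk_xy R).
have mg : measurable_fun setT g.
  by apply/(measurable_restrictT _ (@measurable_disk R)); exact/measurable_EFinP.
have g0 p : (0 <= g p)%E.
  rewrite /g patchE; case: ifPn => //; rewrite inE => /disk_cmod h.
  by rewrite lee_fin G0.
rewrite integral_mkcond -/g (polar_slope mg g0).
set F := (fun r => (`|r|%:E * _)%E).
have mF : measurable_fun setT (F : measurableTypeR R -> \bar R) := measurable_polar_slope mg g0.
have F0 r : (0 <= F r)%E.
  rewrite /F mule_ge0 ?lee_fin//; apply: integral_ge0 => s _.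
  by rewrite mule_ge0// lee_fin invr_ge0 addr_ge0// sqr_ge0.
have gE r s : g (cosat s * r, cosat s * r * s) =
    if `|r| < 1 then (G (r%:C%C * expi (atan s)))%:E else 0%E.
  have -> : g (cosat s * r, cosat s * r * s) =
     if cmod (r%:C%C * expi (atan s)) < 1 then (G (r%:C%C * expi (atan s)))%:E else 0%E.
    have cE : cplx (cosat s * r, cosat s * r * s) = r%:C%C * expi (atan s).
      apply: complexP; rewrite ?ReM ?ImM/= sin_atan cos_atan /cosat; ring.
    rewrite /g patchE cE; congr (if _ then _ else _).
    by apply/idP/idP => [|h]; rewrite ?inE /disk_xy/= cE; [move/disk_cmod|apply/disk_cmod].
  by rewrite cmodM cmod_expi mulr1 cmodr.
have cGn r : `|r| < 1 -> r != 0 -> forall t, {for t, continuous (fun t => G (r%:C%C * expi t))}.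
  rewrite ltr_norml => /andP[r1 r2]; rewrite neq_lt => /orP[rn|rp] t; last by apply: cG; rewrite rp.
  have -> : (fun t => G (r%:C%C * expi t)) = (fun t => (fun t => G ((- r)%:C%C * expi t)) (t + pi)).
    by apply/funext => u; rewrite expiDpi rmorphN mulrNN.
  apply: (@continuous_comp _ _ _ (fun t : R => t + pi) (fun t => G ((- r)%:C%C * expi t))).
    by apply: cvgD; [exact: cvg_id|exact: cvg_cst].
  by apply: cG; apply/andP; split; lra.
have Gp r t : `|r| < 1 -> 0 <= G (r%:C%C * expi t).
  by move=> r1; apply: G0; rewrite cmodM cmod_expi mulr1 cmodr.
have FE r : r != 0 -> `|r| < 1 ->
    F r = (`|r| * ri (- (pi / 2)) (pi / 2) (fun t => G (r%:C%C * expi t)))%:E.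
  move=> r0 r1; rewrite /F EFinM; congr (_ * _)%E.
  rewrite -integral_atan; last 2 first.
  - exact: cGn.
  - by move=> t; exact: Gp.
  by apply: eq_integral => s _; rewrite gE r1 EFinM.
have FN r : 1 <= `|r| -> F r = 0%E.
  move=> r1; rewrite /F integral0_eq ?mule0// => s _.
  by rewrite gE ltNge r1/= mule0.
(* Negative radii are split off and folded back by [r] to [- r]. *)
have -> : (\int[mu]_r F r = \int[mu]_(r in `]0%R, +oo[) F r + \int[mu]_(r in `]-oo, 0%R]) F r)%E.
  rewrite -ge0_integral_setU//=.
  - by rewrite setUC -itv_bndbnd_setU// set_itvNyy.
  - by rewrite setUC -itv_bndbnd_setU// set_itvNyy.
  - apply/disj_setPS => x []/=; rewrite !in_itv/= andbT => x0.
    by rewrite leNgt x0.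
have -> : (\int[mu]_(r in `]-oo, 0%R]) F r = \int[mu]_(r in `]0%R, +oo[) F (- r)%R)%E.
  rewrite integral_itv_obnd_cbnd; last first.
    apply: measurable_funTS; apply: (measurableT_comp mF).
    exact: measurable_funN.
  rewrite (@ge0_integration_by_substitution0 _ (fun r => F (- r))).
  - by apply: eq_integral => r _; rewrite opprK.
  - by apply: (measurableT_comp mF); exact: measurable_funN.
  - by move=> r; exact: F0.
rewrite -ge0_integralD//; last 2 first.
- exact: measurable_funTS.
- by apply: measurable_funTS; apply: (measurableT_comp mF); exact: measurable_funN.
rewrite integral_mkcond [RHS]integral_mkcond; apply: eq_integral => r _.
rewrite !patchE !mem_setE !in_itv/= andbT.
case: ltP => //= r0; case: ltP => [r1|r1]; last by rewrite !FN ?normrN ?adde0// ger0_norm// ltW.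
have rn : `|r| < 1 by rewrite gtr0_norm.
have cr := cG r; rewrite r0 r1 in cr; have {}cr := cr isT.
rewrite !FE ?normrN ?oppr_eq0 ?gt_eqF// -EFinD -mulrDr gtr0_norm//.
congr (_ * _)%:E.
pose phi t := G (r%:C%C * expi t).
have -> : ri (- (pi / 2)) (pi / 2) (fun t => G ((- r)%:C%C * expi t)) =
    ri (pi / 2) (pi / 2 + pi) phi.
  have -> : ri (pi / 2) (pi / 2 + pi) phi = ri (- (pi / 2) + pi) (pi / 2 + pi) phi.
    by congr (ri _ _ _); lra.
  rewrite ri_shift//; last by have := pi_gt0 R; lra.
  by apply: eq_ri => t _; rewrite /phi expiDpi rmorphN mulrN mulNr.
have pp := pi_gt0 R.
rewrite -ri_split//; [|lra|lra].
have -> : pi / 2 + pi = - (pi / 2) + 2 * pi :> R by lra.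
rewrite -(@ri_period _ 0 (- (pi / 2)) (2 * pi) phi) ?add0r//; [lra|lra|].
by move=> t; rewrite /phi expiD2pi.
Qed.

(** * Parseval's identity *)

Lemma cmodD_sq (R : realType) (x y : R[i]) :
  cmod (x + y) ^+ 2 = cmod x ^+ 2 + cmod y ^+ 2 + 2 * complex.Re (conjc x * y).
Proof. by rewrite !cmod_sq ReD ImD ReM; case: x => a b /=; ring. Qed.

Lemma cont_sq (R : realType) (g : R -> R) (t : R) :
  {for t, continuous g} -> {for t, continuous (fun u => g u ^+ 2)}.
Proof.
move=> cg; apply: (@eq_for_continuous _ (fun u => g u * g u)) => [u|].
  by rewrite expr2.
exact: cvgM.
Qed.

(** Induction on the degree: the cross term of the new monomial with the earlier ones contains only
    the frequencies [n - k > 0], so its mean is 0. *)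
Lemma parseval_finite (R : realType) (b : nat -> R[i]) n :
  ri 0 (2 * pi) (fun t => cmod (\sum_(k < n) b k * expi t ^+ k) ^+ 2) =
  2 * pi * \sum_(k < n) cmod (b k) ^+ 2.
Proof.
have T0 := two_pi_ge0 R.
have cP m t : rcont (fun t => \sum_(k < m) b k * expi t ^+ k) t.
  by apply: rcont_sum => k; apply: rcontM; [exact: rcont_cst|apply: rcontX; exact: rcont_expi].
elim: n => [|n IH].
  transitivity (ri 0 (2 * pi) (fun _ => 0 : R)).
    by apply: eq_ri => t _; rewrite big_ord0 cmod0 expr0n.
  by rewrite ri_cst// mul0r big_ord0 mulr0.
pose P t := \sum_(k < n) b k * expi t ^+ k.
pose Q t := conjc (P t) * (b n * expi t ^+ n).
have cQ t : rcont Q t.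
  apply: rcontM; first by apply: rcont_conj; exact: cP.
  by apply: rcontM; [exact: rcont_cst|apply: rcontX; exact: rcont_expi].
rewrite (@eq_ri _ _ _ _ (fun t => cmod (P t) ^+ 2 + (cmod (b n) ^+ 2 + 2 * complex.Re (Q t)))); last first.
  move=> t _; rewrite big_ord_recr/= cmodD_sq -addrA; congr (_ + (_ + _)).
  by rewrite cmodM cmodX cmod_expi expr1n mulr1.
have cP2 t : {for t, continuous (fun t => cmod (P t) ^+ 2)}.
  by apply: cont_sq; apply: cont_cmod; exact: cP.
have cRQ t : {for t, continuous (fun t => 2 * complex.Re (Q t))}.
  by apply: cont_scale; exact: (rcontRe (cQ t)).
rewrite riD//; last by move=> t _; apply: cvgD; [exact: cvg_cst|exact: cRQ].
rewrite riD//; last by move=> t _; exact: cvg_cst.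
rewrite IH ri_cst// subr0 riZ; last by move=> t _; exact: (rcontRe (cQ t)).
have -> : ri 0 (2 * pi) (fun t => complex.Re (Q t)) = complex.Re (ci 0 (2 * pi) Q) by [].
have -> : ci 0 (2 * pi) Q = 0.
  rewrite (@eq_ci _ _ _ _ (fun t => \sum_(k < n) (conjc (b k) * b n) * expi ((n - k)%:R * t))); last first.
    move=> t _; rewrite /Q /P rmorph_sum/= mulr_suml; apply: eq_bigr => k _.
    rewrite rmorphM rmorphXn/= natrB ?(ltnW (ltn_ord k))// mulrBl expiD expiN -!expiX.
    by rewrite rmorphXn; ring.
  rewrite ci_sum//; last first.
    by move=> k t; apply: rcontM; [exact: rcont_cst|exact: rcont_expik].
  rewrite big1// => k _; rewrite ciZ; last by move=> t _; exact: rcont_expik.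
  by rewrite -[2 * pi]add0r ci_expi_period ?mulr0// subn_gt0.
rewrite [complex.Re 0]/= big_ord_recr/=; ring.
Qed.

Lemma ps_ccont (R : realType) (rho : R) a (f : R[i] -> R[i]) z :
  is_ps rho a f -> cmod z < rho -> ccont f z.
Proof. by move=> hf /(ps_cdiff hf)[d]; exact: cdiff_ccont. Qed.

Lemma rcont_circle (R : realType) (f : R[i] -> R[i]) (r t : R) :
  (forall z, cmod z < 1 -> ccont f z) -> 0 <= r < 1 ->
  rcont (fun t => f (r%:C%C * expi t)) t.
Proof.
move=> cf /andP[r0 r1]; apply: rcont_comp.
  by apply: cf; rewrite cmodM cmod_expi mulr1 cmodr ger0_norm.
by apply: rcontM; [exact: rcont_cst|exact: rcont_expi].
Qed.

(** The finite identity passes to the limit because the partial sums converge to [f] uniformly on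
    the circle, with geometric error. *)
Lemma parseval_circle (R : realType) a (f : R[i] -> R[i]) (r : R) :
  is_ps 1 a f -> 0 <= r < 1 ->
  \sum_(0 <= k < n) 2 * pi * (cmod (a k) ^+ 2 * r ^+ (k.*2)) @[n --> \oo] -->
  ri 0 (2 * pi) (fun t => cmod (f (r%:C%C * expi t)) ^+ 2).
Proof.
move=> hf r01; have [r0 r1] := andP r01; have T0 := two_pi_ge0 R.
pose s := (r + 1) / 2.
have s01 : 0 <= s < 1 by rewrite /s; apply/andP; split; lra.
have [C C0 hC] := is_ps_bound hf s01.
have s0 : 0 < s by rewrite /s; lra.
have q01 : 0 <= r / s < 1.
  apply/andP; split; first by rewrite divr_ge0// ltW.
  by rewrite ltr_pdivrMr// mul1r /s; lra.
have q1 : 0 < 1 - r / s by rewrite subr_gt0; case/andP: q01.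
have tail t n : cmod (f (r%:C%C * expi t) - psum a (r%:C%C * expi t) n) <= C * (r / s) ^+ n / (1 - r / s).
  apply: (is_ps_tail n hf q01 C0 hC).
    by rewrite cmodM cmod_expi mulr1 cmodr ger0_norm// divfK// gt_eqF.
  by rewrite cmodM cmod_expi mulr1 cmodr ger0_norm.
pose F t := f (r%:C%C * expi t).
have cF t : rcont F t by apply: rcont_circle => // z; exact: ps_ccont hf.
have cS n t : rcont (fun t => psum a (r%:C%C * expi t) n) t.
  apply: rcont_sum => k; apply: rcontM; first exact: rcont_cst.
  by apply: rcontX; apply: rcontM; [exact: rcont_cst|exact: rcont_expi].
have [c _ hc] := @EVT_max R (fun t => cmod (F t)) 0 (2 * pi) T0
    (within_cont (fun t _ => cont_cmod (cF t))).
pose M := cmod (F c); have M0 : 0 <= M := cmod_ge0 _.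
pose D := C / (1 - r / s); have D0 : 0 <= D by rewrite divr_ge0// ltW.
have SE n : \sum_(0 <= k < n) 2 * pi * (cmod (a k) ^+ 2 * r ^+ (k.*2)) =
    ri 0 (2 * pi) (fun t => cmod (psum a (r%:C%C * expi t) n) ^+ 2).
  rewrite -mulr_sumr big_mkord.
  transitivity (2 * pi * \sum_(k < n) cmod (a k * (r%:C%C) ^+ k) ^+ 2).
    congr (_ * _); apply: eq_bigr => k _.
    by rewrite cmodM cmodX cmodr ger0_norm// exprMn -exprM muln2.
  rewrite -(parseval_finite (fun k => a k * (r%:C)%C ^+ k)); apply: eq_ri => t _; congr (cmod _ ^+ 2).
  by rewrite /psum; apply: eq_bigr => k _; rewrite exprMn mulrA.
apply/cvgrPdist_lt => e e0.
(* From [|F|^2 - |P|^2 = (|F| - |P|) (|F| + |P|)] for a partial sum [P], with [|F| <= M] and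
   [|F - P| <= D * (r / s) ^+ n <= D]. *)
have [n hn] := @geo_small R (r / s) (D * (2 * M + D) * (2 * pi)) e q01 e0.
exists n => // m /= /hn; apply: le_lt_trans.
rewrite SE.
have cF2 t : {for t, continuous (fun t => cmod (F t) ^+ 2)}.
  by apply: cont_sq; exact: cont_cmod.
have cS2 t : {for t, continuous (fun t => cmod (psum a (r%:C%C * expi t) m) ^+ 2)}.
  by apply: cont_sq; apply: cont_cmod; exact: cS.
have -> : ri 0 (2 * pi) (fun t => cmod (F t) ^+ 2) -
   ri 0 (2 * pi) (fun t => cmod (psum a (r%:C%C * expi t) m) ^+ 2) =
   ri 0 (2 * pi) (fun t => cmod (F t) ^+ 2 + - 1 * cmod (psum a (r%:C%C * expi t) m) ^+ 2).
  rewrite riD//; last by move=> t _; apply: cont_scale.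
  by rewrite riZ// mulN1r.
have qm0 : 0 <= (r / s) ^+ m by rewrite exprn_ge0//; case/andP: q01.
have qm1 : (r / s) ^+ m <= 1 by rewrite exprn_ile1 ?(ltW (andP q01).2)//; case/andP: q01.
apply: le_trans (@ri_bound _ _ _ (D * (2 * M + D) * (r / s) ^+ m) _ T0 _ _) _.
- have ck t : {for t, continuous (fun t => - 1 * cmod (psum a (r%:C%C * expi t) m) ^+ 2)}.
    by apply: cont_scale.
  by move=> t _; apply: cvgD; [exact: cF2|exact: ck].
- move=> t tT; rewrite mulN1r subr_sqr normrM.
  have FM : cmod (F t) <= M by apply: hc; rewrite in_itv.
  have ht := tail t m; rewrite -/(F t) mulrAC -/D in ht.
  have x0 := cmod_ge0 (psum a (r%:C%C * expi t) m).
  have hd1 := cmod_sub_ge (F t) (psum a (r%:C%C * expi t) m).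
  have hd2 := cmod_sub_ge (psum a (r%:C%C * expi t) m) (F t).
  rewrite cmodBC in hd2.
  have Dq : D * (r / s) ^+ m <= D by rewrite ler_piMr.
  rewrite -mulrA [_ * (r / s) ^+ m]mulrC mulrA; apply: ler_pM => //.
    by rewrite ler_norml; apply/andP; split; lra.
  by rewrite ger0_norm ?addr_ge0 ?cmod_ge0//; lra.
by rewrite subr0 le_eqVlt; apply/orP; left; apply/eqP; ring.
Qed.

(** * Measurability of power series on the disk *)

Definition cmeas (R : realType) (D : set (plane R)) (F : plane R -> R[i]) :=
  measurable_fun D (fun p => complex.Re (F p)) /\
  measurable_fun D (fun p => complex.Im (F p)).

Lemma cmeas_cst (R : realType) (D : set (plane R)) (c : R[i]) : cmeas D (fun _ => c).
Proof. by split; exact: measurable_cst. Qed.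

Lemma cmeasD (R : realType) (D : set (plane R)) F G :
  cmeas D F -> cmeas D G -> cmeas D (fun p => F p + G p).
Proof.
move=> [F1 F2] [G1 G2]; split.
  by under eq_fun do rewrite ReD; exact: measurable_funD.
by under eq_fun do rewrite ImD; exact: measurable_funD.
Qed.

Lemma cmeasM (R : realType) (D : set (plane R)) F G :
  cmeas D F -> cmeas D G -> cmeas D (fun p => F p * G p).
Proof.
move=> [F1 F2] [G1 G2]; split.
  by under eq_fun do rewrite ReM; apply: measurable_funB; exact: measurable_funM.
by under eq_fun do rewrite ImM; apply: measurable_funD; exact: measurable_funM.
Qed.

Lemma cmeas_psum (R : realType) (D : set (plane R)) (a : nat -> R[i]) n :
  cmeas D (fun p => psum a (cplx p) n).
Proof.
have cz : cmeas D (fun p => cplx p).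
  by split; apply: measurable_funTS; [exact: measurable_fst|exact: measurable_snd].
have cX k : cmeas D (fun p => cplx p ^+ k).
  elim: k => [|k IH]; first exact: cmeas_cst.
  by under eq_fun do rewrite exprS; exact: cmeasM.
elim: n => [|n IH].
  by under eq_fun do rewrite /psum big_ord0; exact: cmeas_cst.
under eq_fun do rewrite psumS.
by apply: cmeasD => //; apply: cmeasM => //; exact: cmeas_cst.
Qed.

Lemma cmeas_ps (R : realType) a (f : R[i] -> R[i]) : is_ps 1 a f ->
  cmeas (@disk_xy R) (fun p => f (cplx p)).
Proof.
move=> hf; have mD := @measurable_disk R; split.
  apply: (@measurable_fun_cvg _ _ _ _ (fun n p => complex.Re (psum a (cplx p) n))) => //.
    by move=> n; case: (cmeas_psum (@disk_xy R) a n).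
  move=> p /disk_cmod p1; apply/cvgrPdist_lt => e e0; have [n hn] := hf _ p1 e e0.
  by exists n => // m /hn; rewrite -ReB; apply: le_lt_trans; exact: Re_le_cmod.
apply: (@measurable_fun_cvg _ _ _ _ (fun n p => complex.Im (psum a (cplx p) n))) => //.
  by move=> n; case: (cmeas_psum (@disk_xy R) a n).
move=> p /disk_cmod p1; apply/cvgrPdist_lt => e e0; have [n hn] := hf _ p1 e e0.
by exists n => // m /hn; rewrite -ImB; apply: le_lt_trans; exact: Im_le_cmod.
Qed.

Lemma measurable_cmod_sq (R : realType) (D : set (plane R)) F :
  cmeas D F -> measurable_fun D (fun p => cmod (F p) ^+ 2).
Proof.
move=> [F1 F2]; under eq_fun do rewrite cmod_sq.
by apply: measurable_funD; exact: measurable_funX.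
Qed.

Lemma continuous_on_measurable (R : realType) (a b : R) (f : R -> R) :
  (forall r, a < r < b -> {for r, continuous f}) -> measurable_fun `]a, b[ f.
Proof.
move=> cf; apply: open_continuous_measurable_fun => //.
by move=> x; rewrite inE/= in_itv/= => /cf.
Qed.

(** * Moments and the norm *)

(** The squared norm of the monomial of degree [k]: [2 * r dr] is the radial part of the normalized
    area measure, and [r ^+ k.*2] is the squared modulus. *)
Definition moment (R : realType) (psi : R -> R) (k : nat) : \bar R :=
  (\int[@lebesgue_measure R]_(r in `]0%R, 1%R[) (2 * r ^+ k.*2.+1 * psi r)%:E)%E.

Section parseval.
Context (R : realType) (w : R[i] -> R) (psi : R -> R).
Hypotheses (psi0 : forall r, 0 <= r < 1 -> 0 <= psi r)
  (cpsi : forall r, 0 < r < 1 -> {for r, continuous psi})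
  (wpsi : forall z, cmod z < 1 -> w z = psi (cmod z))
  (mw : measurable_fun (@disk_xy R) (fun p : plane R => w (cplx p))).

Lemma w_ge0 z : cmod z < 1 -> 0 <= w z.
Proof. by move=> z1; rewrite wpsi// psi0// cmod_ge0. Qed.

Lemma moment_ge0 k : (0 <= moment psi k)%E.
Proof.
apply: integral_ge0 => r; rewrite /= in_itv/= => /andP[r0 r1].
by rewrite lee_fin !mulr_ge0 ?exprn_ge0 ?(ltW r0)// psi0// ltW.
Qed.

Lemma measurable_pow_psi k :
  measurable_fun `]0, (1 : R)[ (fun r : R => r ^+ k * psi r).
Proof.
apply: continuous_on_measurable => r r01; apply: cvgM; last exact: cpsi.
exact: exprn_continuous.
Qed.

Lemma measurable_norm a (f : R[i] -> R[i]) : is_ps 1 a f ->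
  measurable_fun (@disk_xy R) (fun p : plane R => cmod (f (cplx p)) ^+ 2 * w (cplx p)).
Proof.
by move=> hf; apply: measurable_funM => //; apply: measurable_cmod_sq; exact: cmeas_ps hf.
Qed.

(** The circle identity is integrated over the radius; nonnegativity permits termwise integration,
    including infinite values. *)
Lemma parseval a (f : R[i] -> R[i]) : is_ps 1 a f ->
  bergman_sqnorm w f = (\sum_(k <oo) (cmod (a k) ^+ 2)%:E * moment psi k)%E.
Proof.
move=> hf; rewrite /bergman_sqnorm (@disk_polar R (fun z => cmod (f z) ^+ 2 * w z)); last 3 first.
- exact: measurable_norm hf.
- by move=> z z1; rewrite mulr_ge0 ?exprn_ge0 ?cmod_ge0// w_ge0.
- move=> r r01 t; have [r0 r1] := andP r01.
  have -> : (fun t => cmod (f (r%:C%C * expi t)) ^+ 2 * w (r%:C%C * expi t)) =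
            (fun t => psi r * cmod (f (r%:C%C * expi t)) ^+ 2).
    apply/funext => u; rewrite wpsi cmodM cmod_expi mulr1 cmodr gtr0_norm//.
    by rewrite mulrC.
  apply: cont_scale; apply: cont_sq; apply: cont_cmod; apply: rcont_circle.
    by move=> z; exact: ps_ccont hf.
  by rewrite ltW.
pose g k (r : R) : \bar R := (2 * pi * cmod (a k) ^+ 2 * (r ^+ k.*2.+1 * psi r))%:E.
have g0 k (r : R) : `]0, 1[%classic r -> (0 <= g k r)%E.
  rewrite /= in_itv/= => /andP[r0 r1]; rewrite lee_fin.
  by rewrite !mulr_ge0 ?exprn_ge0 ?cmod_ge0 ?pi_ge0 ?(ltW r0)// psi0// ltW.
have mg k : measurable_fun `]0, (1 : R)[ (g k : measurableTypeR R -> \bar R).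
  by apply/measurable_EFinP; apply: measurable_funM => //; exact: measurable_pow_psi.
transitivity ((pi^-1)%:E * \int[mu]_(r in `]0%R, 1%R[) \sum_(k <oo) g k r)%E.
  congr (_ * _)%E; apply: eq_integral => r; rewrite inE/= in_itv/= => r01.
  have [r0 r1] := andP r01.
  have r01' : 0 <= r < 1 by rewrite ltW.
  rewrite (@eq_ri _ _ _ _ (fun t => psi r * cmod (f (r%:C%C * expi t)) ^+ 2)); last first.
    move=> t _; rewrite mulrC wpsi cmodM cmod_expi mulr1 cmodr gtr0_norm//.
  rewrite riZ; last first.
    move=> t _; apply: cont_sq; apply: cont_cmod; apply: rcont_circle => //.
    by move=> z; exact: ps_ccont hf.
  apply/esym/cvg_lim => //.
  have -> : (fun n => \sum_(0 <= k < n) g k r)%E = EFin \o (fun n => r * psi r *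
      \sum_(0 <= k < n) 2 * pi * (cmod (a k) ^+ 2 * r ^+ (k.*2))).
    apply/funext => n; rewrite sumEFin/= mulr_sumr; congr EFin.
    by apply: eq_bigr => k _; rewrite (exprS r k.*2); ring.
  rewrite mulrA; apply: cvg_EFin; first exact: nearW.
  by apply: cvgMr; exact: parseval_circle.
rewrite integral_nneseries//.
rewrite -nneseriesZl; last first.
  by move=> k _; apply: integral_ge0 => r; exact: g0.
apply: eq_eseriesr => k _.
rewrite /moment (_ : (\int[mu]_(r in `]0%R, 1%R[) g k r = (pi * cmod (a k) ^+ 2)%:E *
   \int[mu]_(r in `]0%R, 1%R[) (2 * r ^+ k.*2.+1 * psi r)%:E)%E); last first.
  rewrite -ge0_integralZl//.
  - by apply: eq_integral => r _; rewrite /g -EFinM; congr EFin; ring.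
  - apply/measurable_EFinP.
    rewrite (_ : (fun _ => _) = (fun r : R => 2 * (r ^+ k.*2.+1 * psi r))); last first.
      by apply/funext => r; rewrite mulrA.
    by apply: measurable_funM => //; exact: measurable_pow_psi.
  - move=> r; rewrite /= in_itv/= => /andP[r0 r1].
    by rewrite lee_fin !mulr_ge0 ?exprn_ge0 ?(ltW r0)// psi0// ltW.
  - by rewrite lee_fin mulr_ge0 ?exprn_ge0 ?cmod_ge0 ?pi_ge0.
by rewrite muleA -EFinM mulrA mulVf ?mul1r// gt_eqF// pi_gt0.
Qed.

End parseval.

(** The substitution [r = e t] is decreasing and is made on compact intervals, which then exhaust
    both domains. *)
Lemma moment_laplace (R : realType) (psi h : R -> R) k :
  (forall r, 0 <= r < 1 -> 0 <= psi r) ->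
  (forall r, 0 < r < 1 -> {for r, continuous psi}) ->
  (forall t, 0 < t -> h t = expR (- t) * psi (expR (- (t / 2)))) ->
  moment psi k = (\int[mu]_(t in `]0%R, +oo[) (expR (- k%:R * t) * h t)%:E)%E.
Proof.
move=> psi0 cpsi hE.
pose e (t : R) := expR (- (t / 2)).
have e0 t : 0 < e t by exact: expR_gt0.
have e1 t : 0 < t -> e t < 1 by move=> t0; rewrite expR_lt1; lra.
have ce t : {for t, continuous e}.
  apply: (@continuous_comp _ _ _ (fun t : R => - (t / 2)) expR); last exact: continuous_expR.
  by apply: cvgN; apply: cvgM; [exact: cvg_id|exact: cvg_cst].
pose G r := 2 * r ^+ k.*2.+1 * psi r.
have cG r : 0 < r < 1 -> {for r, continuous G}.
  move=> r01; apply: cvgM; last exact: cpsi.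
  by apply: cvgM; [exact: cvg_cst|exact: exprn_continuous].
have G0 r : 0 < r < 1 -> 0 <= G r.
  by move=> /andP[r0 r1]; rewrite !mulr_ge0 ?exprn_ge0 ?psi0 ?(ltW r0).
pose g t := G (e t) * (e t / 2).
(* [expR (- t)] is [e t ^+ 2]: one factor raises [r ^+ k.*2] to the odd power in [moment], the
   other, halved, is minus the derivative of [e]. *)
have gE t : 0 < t -> expR (- k%:R * t) * h t = g t.
  move=> t0; rewrite hE// /g /G.
  have -> : expR (- t) = e t * e t by rewrite -expRD; congr expR; field.
  have -> : expR (- k%:R * t) = e t ^+ k.*2.
    by rewrite -expRM_natl; congr expR; rewrite -muln2 natrM; field.
  by rewrite -/(e t) exprS; field.
have cg t : 0 < t -> {for t, continuous g}.
  move=> t0; apply: cvgM; last by apply: cvgM; [exact: ce|exact: cvg_cst].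
  apply: (@continuous_comp _ _ _ e G); first exact: ce.
  by apply: cG; rewrite e0 e1.
have g0 t : 0 < t -> 0 <= g t.
  by move=> t0; rewrite mulr_ge0 ?divr_ge0 ?(ltW (e0 t))// G0// e0 e1.
pose F n : set (measurableTypeR R) := `[n.+1%:R^-1, n.+1%:R]%classic.
pose H n : set (measurableTypeR R) := `[e n.+1%:R, e n.+1%:R^-1]%classic.
have n0 n : (0 : R) < n.+1%:R^-1 by rewrite invr_gt0.
have UF : \bigcup_n F n = `]0, +oo[%classic.
  apply/seteqP; split => x /=.
    by case=> n _; rewrite /F/= !in_itv/= andbT => /andP[h1 _]; exact: lt_le_trans (n0 n) h1.
  rewrite in_itv/= andbT => x0.
  exists (maxn (Num.truncn x) (Num.truncn x^-1)) => //; rewrite /F/= in_itv/=.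
  have m1 : x < (maxn (Num.truncn x) (Num.truncn x^-1)).+1%:R.
    by apply: (lt_le_trans (truncnS_gt x)); rewrite ler_nat ltnS leq_maxl.
  have m2 : x^-1 < (maxn (Num.truncn x) (Num.truncn x^-1)).+1%:R.
    by apply: (lt_le_trans (truncnS_gt x^-1)); rewrite ler_nat ltnS leq_maxr.
  by rewrite (ltW m1) andbT -[leRHS]invrK lef_pV2 ?posrE ?invr_gt0// ltW.
have e_le s t : (e s <= e t) = (t <= s).
  by rewrite ler_expR lerN2 ler_pM2r ?invr_gt0.
have UH : \bigcup_n H n = `]0, 1[%classic.
  apply/seteqP; split => x /=.
    case=> n _; rewrite /H/= !in_itv/= => /andP[h1 h2].
    by rewrite (lt_le_trans (e0 _) h1) (le_lt_trans h2)// e1.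
  rewrite in_itv/= => /andP[x0 x1].
  have xe : x = e (- 2 * ln x).
    by rewrite /e (_ : - (- 2 * ln x / 2) = ln x) ?lnK ?posrE//; field.
  have t0 : 0 < - 2 * ln x by rewrite mulNr oppr_gt0 pmulr_rlt0// ln_lt0// x0.
  have : `]0, +oo[%classic (- 2 * ln x) by rewrite /= in_itv/= andbT.
  rewrite -UF => -[n _]; rewrite /F/= in_itv/= => /andP[h1 h2].
  by exists n => //; rewrite /H/= in_itv/= xe !e_le h1 h2.
have mG : measurable_fun `]0, (1 : R)[ (EFin \o G : measurableTypeR R -> \bar R).
  by apply/measurable_EFinP; exact: continuous_on_measurable.
have mg : measurable_fun `](0 : R), +oo[ (EFin \o g : measurableTypeR R -> \bar R).
  apply/measurable_EFinP; apply: open_continuous_measurable_fun => //.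
  by move=> x; rewrite inE/= in_itv/= andbT => /cg.
have nn n m : (n <= m)%N -> (n.+1%:R : R) <= m.+1%:R by rewrite ler_nat ltnS.
have nnV n m : (n <= m)%N -> (m.+1%:R^-1 : R) <= n.+1%:R^-1.
  by move=> nm; rewrite lef_pV2 ?posrE// nn.
have c1 : (\int[mu]_(x in F n) (g x)%:E)%E @[n --> \oo] --> (\int[mu]_(t in `]0%R, +oo[) (g t)%:E)%E.
  rewrite -UF; apply: ge0_nondecreasing_set_cvg_integral => //.
  - move=> n m nm; apply/subsetPset => x; rewrite /F/= !in_itv/= => /andP[h1 h2].
    by rewrite (le_trans (nnV _ _ nm) h1) (le_trans h2)// nn.
  - by move=> n; exact: measurable_itv.
  - move=> n; apply: (measurable_funS _ _ mg); first exact: measurable_itv.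
    by rewrite -UF; exact: bigcup_sup.
  - move=> n x; rewrite /F/= in_itv/= => /andP[h1 h2].
    by rewrite lee_fin g0// (lt_le_trans (n0 n)).
have c2 : (\int[mu]_(x in H n) (G x)%:E)%E @[n --> \oo] --> moment psi k.
  rewrite /moment -UH; apply: ge0_nondecreasing_set_cvg_integral => //.
  - move=> n m nm; apply/subsetPset => x; rewrite /H/= !in_itv/= => /andP[h1 h2].
    by rewrite (le_trans _ h1) ?e_le ?nn// (le_trans h2)// e_le nnV.
  - by move=> n; exact: measurable_itv.
  - move=> n; apply: (measurable_funS _ _ mG); first exact: measurable_itv.
    by rewrite -UH; exact: bigcup_sup.
  - move=> n x; rewrite /H/= in_itv/= => /andP[h1 h2].
    by rewrite lee_fin G0// (lt_le_trans (e0 _) h1) (le_lt_trans h2)// e1.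
have E12 : (fun n => \int[mu]_(x in H n) (G x)%:E)%E = (fun n => \int[mu]_(x in F n) (g x)%:E)%E.
  apply/funext => n.
  have de (t : R) : is_derive t (1 : R) e (- (e t / 2)).
    rewrite /e; apply: is_derive_eq; rewrite /GRing.scale/=.
    by rewrite !mulr0 add0r mulr1 mulrN.
  have dE : e^`()%classic = (fun t => - (e t / 2)).
    by apply/funext => u; rewrite derive1E; case: (de u).
  have cd t : {for t, continuous (fun t => - (e t / 2))}.
    by apply: cvgN; apply: cvgM; [exact: ce|exact: cvg_cst].
  rewrite /H (@integration_by_substitution_decreasing _ e).
  - by apply: eq_integral => x _; rewrite dE /= opprK.
  - by rewrite (@le_trans _ _ 1) ?invf_le1 ?ler1n.
  - by move=> x y _ _ xy; rewrite /e ltr_expR; lra.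
  - by move=> x _; rewrite dE; exact: cd.
  - by rewrite dE; apply/cvg_ex; eexists; apply: cvg_at_right_filter; exact: cd.
  - by rewrite dE; apply/cvg_ex; eexists; apply: cvg_at_left_filter; exact: cd.
  - split; first by move=> x _; case: (de x).
    + by apply: cvg_at_right_filter; exact: ce.
    + by apply: cvg_at_left_filter; exact: ce.
  - apply: within_cont => t /andP[h1 h2]; apply: cG.
    by rewrite (lt_le_trans (e0 _) h1) (le_lt_trans h2)// e1.
rewrite E12 in c2.
rewrite (cvg_unique _ c2 c1)//; apply: eq_integral => t.
by rewrite inE/= in_itv/= andbT => t0; rewrite gE.
Qed.

(** * Norm and inner product in terms of coefficients *)

Section inner_product.
Context (R : realType) (w : R[i] -> R) (psi : R -> R) (m : nat -> R).
Hypotheses (psi0 : forall r, 0 <= r < 1 -> 0 <= psi r)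
  (cpsi : forall r, 0 < r < 1 -> {for r, continuous psi})
  (wpsi : forall z, cmod z < 1 -> w z = psi (cmod z))
  (mw : measurable_fun (@disk_xy R) (fun p : plane R => w (cplx p)))
  (mE : forall k, moment psi k = (m k)%:E).

Lemma m_ge0 k : 0 <= m k.
Proof. by rewrite -lee_fin -mE; exact: moment_ge0. Qed.

(** Partial sums of the squared norm. Inequalities between norms are proved on these finite sums and
    then passed to the limit. *)
Definition psq (a : nat -> R[i]) n := \sum_(0 <= k < n) cmod (a k) ^+ 2 * m k.

Lemma psq_cvge a f : is_ps 1 a f ->
  (psq a n)%:E @[n --> \oo] --> bergman_sqnorm w f.
Proof.
move=> hf; rewrite (parseval psi0 cpsi wpsi mw hf).
rewrite (_ : (fun n => _) = (fun n => \sum_(0 <= k < n) (cmod (a k) ^+ 2)%:E * moment psi k)%E); last first.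
  apply/funext => n; rewrite /psq -sumEFin; apply: eq_bigr => k _.
  by rewrite mE EFinM.
apply: is_cvg_nneseries => k _ _.
by rewrite mE -EFinM lee_fin mulr_ge0 ?exprn_ge0 ?cmod_ge0// m_ge0.
Qed.

Lemma sqnorm_ge0 a f : is_ps 1 a f -> (0 <= bergman_sqnorm w f)%E.
Proof.
move=> hf; rewrite (parseval psi0 cpsi wpsi mw hf); apply: nneseries_ge0 => k _ _.
by rewrite mE -EFinM lee_fin mulr_ge0 ?exprn_ge0 ?cmod_ge0// m_ge0.
Qed.

Lemma sqnorm_le a f C : is_ps 1 a f -> (forall n, psq a n <= C) ->
  (bergman_sqnorm w f <= C%:E)%E.
Proof.
move=> hf hC; have h := psq_cvge hf.
rewrite -(cvg_lim _ h)//; apply: lime_le; first by apply/cvg_ex; eexists; exact: h.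
by apply: nearW => n; rewrite lee_fin.
Qed.

Lemma psq_nd a : {homo psq a : n p / (n <= p)%N >-> n <= p}.
Proof.
move=> n p np; rewrite /psq (big_cat_nat (leq0n n) np)//= lerDl.
by apply: sumr_ge0 => k _; rewrite mulr_ge0 ?exprn_ge0 ?cmod_ge0// m_ge0.
Qed.

Lemma psq_le a f n : is_ps 1 a f -> (bergman_sqnorm w f < +oo)%E ->
  psq a n <= fine (bergman_sqnorm w f).
Proof.
move=> hf fin.
have h := psq_cvge hf.
rewrite -lee_fin fineK ?ge0_fin_numE//; last exact: sqnorm_ge0 hf.
have nd : {homo (fun n => (psq a n)%:E) : n p / (n <= p)%N >-> (n <= p)%E}.
  by move=> x y xy; rewrite lee_fin psq_nd.
rewrite (cvg_unique _ h (ereal_nondecreasing_cvgn nd))//.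
by apply: ereal_sup_ubound; exists n.
Qed.

Lemma psq_cvg a f : is_ps 1 a f -> (bergman_sqnorm w f < +oo)%E ->
  psq a n @[n --> \oo] --> fine (bergman_sqnorm w f).
Proof.
move=> hf fin; apply: (@fine_cvg _ _ _ _ (fun n => (psq a n)%:E)).
rewrite fineK ?ge0_fin_numE//; last exact: sqnorm_ge0 hf.
exact: psq_cvge.
Qed.

Lemma psqD a b n : psq (fun k => a k + b k) n <= 2 * psq a n + 2 * psq b n.
Proof.
rewrite /psq !mulr_sumr -big_split/=; apply: ler_sum => k _.
rewrite (_ : _ + _ = (2 * cmod (a k) ^+ 2 + 2 * cmod (b k) ^+ 2) * m k); last by ring.
rewrite ler_wpM2r ?m_ge0//.
have h2 : cmod (a k + b k) ^+ 2 <= (cmod (a k) + cmod (b k)) ^+ 2.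
  by rewrite lerXn2r ?nnegrE ?addr_ge0 ?cmod_ge0// cmodD.
apply: le_trans h2 _; rewrite -subr_ge0.
have -> : 2 * cmod (a k) ^+ 2 + 2 * cmod (b k) ^+ 2 - (cmod (a k) + cmod (b k)) ^+ 2 =
  (cmod (a k) - cmod (b k)) ^+ 2 by ring.
exact: sqr_ge0.
Qed.

Lemma psqZ (c : R[i]) a n : psq (fun k => c * a k) n = cmod c ^+ 2 * psq a n.
Proof.
by rewrite /psq mulr_sumr; apply: eq_bigr => k _; rewrite cmodM exprMn mulrA.
Qed.

Lemma sqnormD_fin a b f g : is_ps 1 a f -> is_ps 1 b g ->
  (bergman_sqnorm w f < +oo)%E -> (bergman_sqnorm w g < +oo)%E ->
  (bergman_sqnorm w (fun z => (f z + g z)%R) < +oo)%E.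
Proof.
move=> ha hb fa fb.
apply: (@le_lt_trans _ _ (2 * fine (bergman_sqnorm w f) + 2 * fine (bergman_sqnorm w g))%:E); last exact: ltry.
apply: (sqnorm_le (is_psD ha hb)) => n; apply: le_trans (psqD _ _ _) _.
by rewrite lerD// ler_pM2l// psq_le.
Qed.

Lemma sqnormZ_fin (c : R[i]) a f : is_ps 1 a f -> (bergman_sqnorm w f < +oo)%E ->
  (bergman_sqnorm w (fun z => (c * f z)%R) < +oo)%E.
Proof.
move=> ha fa.
apply: (@le_lt_trans _ _ (cmod c ^+ 2 * fine (bergman_sqnorm w f))%:E); last exact: ltry.
apply: (sqnorm_le (is_psZ c ha)) => n; rewrite psqZ.
by rewrite ler_wpM2l ?exprn_ge0 ?cmod_ge0// psq_le.
Qed.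

Lemma sqnormB_fin a b f g : is_ps 1 a f -> is_ps 1 b g ->
  (bergman_sqnorm w f < +oo)%E -> (bergman_sqnorm w g < +oo)%E ->
  (bergman_sqnorm w (fun z => (f z - g z)%R) < +oo)%E.
Proof.
move=> ha hb fa fb.
have -> : (fun z => f z - g z) = (fun z => f z + (-1) * g z).
  by apply/funext => z; rewrite mulN1r.
by apply: (sqnormD_fin ha (is_psZ (-1) hb)) => //; exact: (sqnormZ_fin (-1) hb fb).
Qed.

Lemma disk_int_quarter (u v : R[i] -> R) :
  measurable_fun (@disk_xy R) (fun p : plane R => u (cplx p)) ->
  measurable_fun (@disk_xy R) (fun p : plane R => v (cplx p)) ->
  (forall z, cmod z < 1 -> 0 <= u z) -> (forall z, cmod z < 1 -> 0 <= v z) ->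
  (disk_int (fun z => (u z)%:E) < +oo)%E -> (disk_int (fun z => (v z)%:E) < +oo)%E ->
  fine (disk_int (fun z => (4^-1 * (u z - v z))%:E)) =
  4^-1 * (fine (disk_int (fun z => (u z)%:E)) - fine (disk_int (fun z => (v z)%:E))).
Proof.
move=> mu_ mv u0 v0 fu fv.
have pi1 : 0 < (pi^-1 : R) by rewrite invr_gt0 pi_gt0.
have mD := @measurable_disk R.
pose M := (@lebesgue_measure R \x @lebesgue_measure R)%E.
have int (x : R[i] -> R) : measurable_fun (@disk_xy R) (fun p : plane R => x (cplx p)) ->
   (forall z, cmod z < 1 -> 0 <= x z) -> (disk_int (fun z => (x z)%:E) < +oo)%E ->
   M.-integrable (@disk_xy R) (fun p => (x (cplx p))%:E).
  move=> mx x0; rewrite /disk_int => fx.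
  apply/integrableP; split; first exact/measurable_EFinP.
  have -> : (\int[M]_(p in @disk_xy R) `|(x (cplx p))%:E| =
             \int[M]_(p in @disk_xy R) (x (cplx p))%:E)%E.
    apply: eq_integral => p; rewrite inE => /disk_cmod p1.
    by rewrite gee0_abs// lee_fin x0.
  rewrite ltey; apply/eqP => h; move: fx; rewrite -/M h.
  by rewrite gt0_muley ?lte_fin// ltxx.
have iu := int u mu_ u0 fu; have iv := int v mv v0 fv.
rewrite /disk_int -/M.
have -> : (\int[M]_(p in @disk_xy R) (4^-1 * (u (cplx p) - v (cplx p)))%:E =
   (4^-1)%:E * (\int[M]_(p in @disk_xy R) (u (cplx p))%:E - \int[M]_(p in @disk_xy R) (v (cplx p))%:E))%E.
  rewrite -integralB// -integralZl//; last exact: integrableB.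
have fu' := integrable_fin_num mD iu; have fv' := integrable_fin_num mD iv.
rewrite -(fineK fu') -(fineK fv') -EFinB -!EFinM/=; ring.
Qed.

(** Polarization: the real part of the product is a quarter of the difference of the squared norms
    of [f + g] and [f - g], both covered by Parseval. *)
Lemma Re_inner_product a b f g : is_ps 1 a f -> is_ps 1 b g ->
  (bergman_sqnorm w f < +oo)%E -> (bergman_sqnorm w g < +oo)%E ->
  \sum_(0 <= k < n) complex.Re (a k * conjc (b k)) * m k @[n --> \oo] -->
  fine (disk_int (fun z => (complex.Re (f z * conjc (g z) * (w z)%:C%C))%:E)).
Proof.
move=> ha hb fa fb.
have polar (x y : R[i]) : complex.Re (x * conjc y) = 4^-1 * (cmod (x + y) ^+ 2 - cmod (x - y) ^+ 2).
  by rewrite !cmod_sq !ReD !ImD !ReN !ImN ReM; case: x => x1 x2; case: y => y1 y2 /=; field.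
rewrite (_ : (fun z => _) = (fun z => (4^-1 * (cmod (f z + g z) ^+ 2 * w z - cmod (f z - g z) ^+ 2 * w z))%:E)); last first.
  apply/funext => z; congr EFin.
  by rewrite [LHS]ReM/= mulr0 subr0 polar -mulrBl mulrA.
rewrite (@disk_int_quarter (fun z => cmod (f z + g z) ^+ 2 * w z) (fun z => cmod (f z - g z) ^+ 2 * w z)).
- rewrite (_ : (fun n => _) = (fun n => 4^-1 * (psq (fun k => a k + b k) n - psq (fun k => a k - b k) n))); last first.
    apply/funext => n; rewrite /psq -sumrB mulr_sumr; apply: eq_bigr => k _.
    by rewrite polar; ring.
  apply: cvgMr; apply: (@cvgB _ R^o).
    exact: (psq_cvg (is_psD ha hb) (sqnormD_fin ha hb fa fb)).
  exact: (psq_cvg (is_psB ha hb) (sqnormB_fin ha hb fa fb)).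
- exact: (measurable_norm mw (is_psD ha hb)).
- exact: (measurable_norm mw (is_psB ha hb)).
- by move=> z z1; rewrite mulr_ge0 ?exprn_ge0 ?cmod_ge0// (w_ge0 psi0 wpsi).
- by move=> z z1; rewrite mulr_ge0 ?exprn_ge0 ?cmod_ge0// (w_ge0 psi0 wpsi).
- exact: (sqnormD_fin ha hb fa fb).
- exact: (sqnormB_fin ha hb fa fb).
Qed.

Lemma inner_product a b f g s : is_ps 1 a f -> is_ps 1 b g ->
  (bergman_sqnorm w f < +oo)%E -> (bergman_sqnorm w g < +oo)%E ->
  (forall e : R, 0 < e -> exists n, forall p, (n <= p)%N ->
     cmod (s - \sum_(k < p) a k * conjc (b k) * (m k)%:C%C) < e) ->
  disk_cint (fun z => f z * conjc (g z) * (w z)%:C%C) = s.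
Proof.
move=> ha hb fa fb hs.
have ReS p : complex.Re (\sum_(k < p) a k * conjc (b k) * (m k)%:C%C) =
    \sum_(0 <= k < p) complex.Re (a k * conjc (b k)) * m k.
  rewrite big_mkord; elim/big_ind2 : _ => // [x1 x2 y1 y2 <- <-|k _]; first by rewrite ReD.
  by rewrite [LHS]ReM/= mulr0 subr0.
have ImS p : complex.Im (\sum_(k < p) a k * conjc (b k) * (m k)%:C%C) =
    \sum_(0 <= k < p) complex.Re (a k * conjc ('i%C * b k)) * m k.
  rewrite big_mkord; elim/big_ind2 : _ => // [x1 x2 y1 y2 <- <-|k _]; first by rewrite ImD.
  by rewrite [LHS]ImM/= mulr0 add0r; congr (_ * _); case: (a k) => ? ?; case: (b k) => ? ? /=; ring.
apply: complexP => /=.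
  apply: (cvg_unique _ (Re_inner_product ha hb fa fb)); first exact: Rhausdorff.
  apply/cvgrPdist_lt => e e0; have [n hn] := hs e e0; exists n => // p /hn.
  by rewrite -ReS -ReB; apply: le_lt_trans; exact: Re_le_cmod.
(* The imaginary part of [x * conjc y] is the real part of [x * conjc ('i * y)], so replacing [g] by
   ['i * g] suffices. *)
have := Re_inner_product ha (is_psZ 'i%C hb) fa (sqnormZ_fin 'i%C hb fb).
rewrite (_ : (fun z => _) = (fun z => (complex.Im (f z * conjc (g z) * (w z)%:C%C))%:E)); last first.
  apply/funext => z; congr EFin; rewrite [LHS]ReM [RHS]ImM /= !mulr0 subr0 add0r.
  by congr (_ * _); case: (f z) => ? ?; case: (g z) => ? ? /=; ring.
move=> h; apply: (cvg_unique _ h); first exact: Rhausdorff.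
apply/cvgrPdist_lt => e e0; have [n hn] := hs e e0; exists n => // p /hn.
by rewrite -ImS -ImB; apply: le_lt_trans; exact: Im_le_cmod.
Qed.

End inner_product.

(** * The kernel as a power series *)

Lemma cont_sum (R : realType) n (F : nat -> R -> R) (t : R) :
  (forall k, {for t, continuous (F k)}) ->
  {for t, continuous (fun r => \sum_(k < n) F k r)}.
Proof.
move=> cF; elim: n => [|n IH].
  by apply: (@eq_for_continuous _ (fun=> 0)) => [r|]; [rewrite big_ord0|exact: cvg_cst].
apply: (@eq_for_continuous _ (fun r => \sum_(k < n) F k r + F n r)) => [r|].
  by rewrite big_ord_recr.
by apply: cvgD; [exact: IH|exact: cF].
Qed.

Section kernel.
Context (R : realType) (nu : {finite_measure set (measurableTypeR R) -> \bar R}).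

Let I01 : set (measurableTypeR R) := `[0, 1]%classic.

Let mI : measurable I01. Proof. exact: measurable_itv. Qed.

Let V : R := fine (nu I01).

Let nuV : nu I01 = V%:E.
Proof. by rewrite /V fineK// fin_num_measure. Qed.

Let V0 : 0 <= V. Proof. by rewrite fine_ge0. Qed.

Lemma nu_integrable (g : R -> R) :
  (forall t, 0 <= t <= 1 -> {for t, continuous g}) ->
  nu.-integrable I01 (EFin \o g).
Proof.
move=> cg; have wc := within_cont cg.
have [c _ hc] := @EVT_max R (fun t => `|g t|) 0 1 ler01
  (within_cont (fun t ht => cvg_norm (cg t ht))).
apply: measurable_bounded_integrable => //.
- by have h : (nu I01 < +oo)%E by rewrite nuV ltry.
- by apply: subspace_continuous_measurable_fun => //.
- exists `|g c|; split; first exact: num_real.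
  move=> x /ltW gx t tI; apply: le_trans gx; exact: hc.
Qed.

Lemma nu_bound (g : R -> R) (M : R) :
  (forall t, 0 <= t <= 1 -> {for t, continuous g}) ->
  (forall t, 0 <= t <= 1 -> `|g t| <= M) ->
  `|\int[nu]_(r in I01) g r| <= M * V.
Proof.
move=> cg gM; apply: le_trans (le_normr_Rintegral mI (nu_integrable cg)) _.
have -> : M * V = \int[nu]_(r in I01) M by rewrite Rintegral_cst// nuV.
apply: le_Rintegral => //.
- by apply: (@nu_integrable (fun t => `|g t|)) => t ht; exact: cvg_norm (cg t ht).
- by apply: (@nu_integrable (fun=> M)) => t ht; exact: cvg_cst.
Qed.

Definition nu_mom (k : nat) : R := \int[nu]_(r in I01) r ^+ k.

(** The integral of [1 + r + ... + r ^+ n], the polynomial form of the quotient in the theorem, with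
    the right value at [r = 1]. *)
Definition kcoef (n : nat) : R := \sum_(k < n.+1) nu_mom k.

Lemma nu_mom_ge0 k : 0 <= nu_mom k.
Proof.
by apply: Rintegral_ge0 => r; rewrite /I01/= in_itv/= => /andP[r0 _]; exact: exprn_ge0.
Qed.

Let cX k (t : R) : {for t, continuous (fun r : R => r ^+ k)}.
Proof. exact: exprn_continuous. Qed.

Lemma nu_mom_le k : nu_mom k <= V.
Proof.
apply: le_trans (ler_norm _) _; rewrite -[leRHS]mul1r.
apply: nu_bound => t /andP[t0 t1]; first exact: cX.
by rewrite ger0_norm ?exprn_ge0// exprn_ile1.
Qed.

Lemma kcoef_ge0 n : 0 <= kcoef n.
Proof. by apply: sumr_ge0 => k _; exact: nu_mom_ge0. Qed.

Lemma kcoef_le n : kcoef n <= n.+1%:R * V.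
Proof.
rewrite mulr_natl -[n.+1 in leRHS]card_ord -sumr_const.
by apply: ler_sum => k _; exact: nu_mom_le.
Qed.

Lemma geom_quotE n (r : R) : geom_quot n r = \sum_(k < n.+1) r ^+ k.
Proof.
rewrite /geom_quot; case: eqP => [->|/eqP r1].
  under eq_bigr do rewrite expr1n.
  by rewrite sumr_const card_ord.
have r1' : 1 - r != 0 by rewrite subr_eq0 eq_sym.
apply: (mulIf r1'); rewrite divfK// mulrC -[1 - r]opprB mulNr -subrX1 opprB.
by [].
Qed.

Lemma int_geom_quot n :
  (\int[nu]_(r in `[0%R, 1%R]) (geom_quot n r)%:E = (kcoef n)%:E)%E.
Proof.
have ik k : nu.-integrable I01 (EFin \o (fun r : R => r ^+ k)).
  by apply: nu_integrable => t _; exact: cX.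
transitivity (\int[nu]_(r in I01) \sum_(k < n.+1) (r ^+ k)%:E)%E.
  by apply: eq_integral => r _; rewrite geom_quotE sumEFin.
rewrite integral_sum//; last by move=> k; exact: ik.
rewrite /kcoef -sumEFin; apply: eq_bigr => k _.
by rewrite /nu_mom /Rintegral fineK//; apply: integrable_fin_num => //; exact: ik.
Qed.

Definition kfun (u : R[i]) : R[i] :=
  (1 - u)^-1 * cint nu `[0, 1] (fun r => (1 - r%:C%C * u)^-1).

Lemma S_nu_kfun z l : S_nu nu z l = kfun (z * conjc l).
Proof.
rewrite /S_nu /kfun; congr (_ * cint _ _ _).
by apply/funext => r; rewrite mulrA.
Qed.

Lemma one_minus_ge (u : R[i]) (r : R) : 0 <= r <= 1 -> 1 - cmod u <= cmod (1 - r%:C%C * u).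
Proof.
move=> /andP[r0 r1]; have := cmod_sub_ge 1 (r%:C%C * u).
rewrite cmod1 cmodM cmodr ger0_norm//; apply: le_trans.
by rewrite lerD2l lerN2 ler_piMl ?cmod_ge0.
Qed.

(** The integral in [kfun] is the power series of the moments of [nu], and multiplying a series by
    [1 / (1 - u)] replaces its coefficients by their partial sums. *)
Lemma kfun_ps : is_ps 1 (fun k => (kcoef k)%:C%C) kfun.
Proof.
move=> u u1.
have nz r : 0 <= r <= 1 -> 1 - r%:C%C * u != 0.
  move=> r01; rewrite -cmod_gt0; apply: lt_le_trans (one_minus_ge u r01).
  by rewrite subr_gt0.
have u10 : 1 - u != 0 by have := nz 1; rewrite mul1r => -> //; rewrite ler01 lexx.
pose P n := \sum_(k < n) (nu_mom k)%:C%C * u ^+ k.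
have geo n r : 0 <= r <= 1 -> (1 - r%:C%C * u)^-1 =
    \sum_(k < n) (r ^+ k)%:C%C * u ^+ k + (r%:C%C * u) ^+ n * (1 - r%:C%C * u)^-1.
  move=> r01; have h := nz r r01; apply: (mulfI h).
  rewrite mulrDr mulrCA !mulfV// mulr1.
  have -> : \sum_(k < n) (r ^+ k)%:C%C * u ^+ k = \sum_(k < n) (r%:C%C * u) ^+ k.
    by apply: eq_bigr => k _; rewrite exprMn rmorphXn.
  by rewrite -[1 - _]opprB mulNr -subrX1 opprB subrK.
pose tl n r := (r%:C%C * u) ^+ n * (1 - r%:C%C * u)^-1.
have ctl n t : 0 <= t <= 1 -> rcont (tl n) t.
  move=> t01.
  have cru : rcont (fun r => r%:C%C * u) t.
    by apply: rcontM; [apply: rcont_real; exact: cvg_id|exact: rcont_cst].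
  apply: rcontM; first exact: rcontX.
  by apply: rcontV; [exact: nz|apply: rcontB => //; exact: rcont_cst].
have tl_le n t : 0 <= t <= 1 -> cmod (tl n t) <= cmod u ^+ n / (1 - cmod u).
  move=> t01; have [t0 t1] := andP t01.
  rewrite cmodM cmodX cmodV cmodM cmodr ger0_norm//; apply: ler_pM.
  - by rewrite exprn_ge0// mulr_ge0 ?cmod_ge0.
  - by rewrite invr_ge0 cmod_ge0.
  - by rewrite lerXn2r ?nnegrE ?mulr_ge0 ?cmod_ge0// ler_piMl ?cmod_ge0.
  - by rewrite lef_pV2 ?posrE ?cmod_gt0 ?nz ?subr_gt0// one_minus_ge.
(* [L] stands for the real and the imaginary part: additive, real-homogeneous and bounded by the
   modulus. *)
have part (L : R[i] -> R) (n : nat) : (forall x y, L (x + y) = L x + L y) ->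
   (forall (x : R) y, L (x%:C%C * y) = x * L y) ->
   (forall x, `|L x| <= cmod x) ->
   `|\int[nu]_(r in I01) L ((1 - r%:C%C * u)^-1) - L (P n)| <= cmod u ^+ n / (1 - cmod u) * V.
  move=> LD LZ Lle.
  have L0 : L 0 = 0 by have := LD 0 0; rewrite addr0 => /eqP; rewrite -subr_eq0 opprD addrA subrr sub0r oppr_eq0 => /eqP.
  have LS (k : nat) (F : 'I_k -> R[i]) : L (\sum_(i < k) F i) = \sum_(i < k) L (F i).
    by elim/big_ind2 : _ => // x1 x2 y1 y2 <- <-.
  have LB x y : L (x - y) = L x - L y.
    by rewrite LD; congr (_ + _); have := LZ (-1) y; rewrite rmorphN rmorph1 !mulN1r.
  have ctlL t : 0 <= t <= 1 -> {for t, continuous (fun r => L (tl n r))}.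
    move=> t01; apply/continuous_epsP => e e0; have [d d0 hd] := ctl n t t01 e e0.
    by exists d => // r /hd; rewrite -LB; apply: le_lt_trans.
  have cpol t : {for t, continuous (fun r : R => \sum_(k < n) r ^+ k * L (u ^+ k))}.
    apply: (@cont_sum _ _ (fun k r => r ^+ k * L (u ^+ k))) => k.
    by apply: cvgM; [exact: cX|exact: cvg_cst].
  have -> : \int[nu]_(r in I01) L ((1 - r%:C%C * u)^-1) =
      \int[nu]_(r in I01) (\sum_(k < n) r ^+ k * L (u ^+ k) + L (tl n r)).
    apply: eq_Rintegral => r; rewrite inE /I01/= in_itv/= => r01.
    rewrite (geo n r r01) LD LS; congr (_ + _).
    by apply: eq_bigr => k _; rewrite LZ.
  rewrite RintegralD//; last 2 first.
  - by apply: nu_integrable => t _; exact: cpol.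
  - exact: nu_integrable.
  have -> : \int[nu]_(r in I01) (\sum_(k < n) r ^+ k * L (u ^+ k)) = L (P n).
    rewrite LS; elim: n {ctlL cpol} => [|n IH].
      rewrite big_ord0; have -> : (fun r : R => \sum_(k < 0) r ^+ k * L (u ^+ k)) = fun=> 0.
        by apply/funext => r; rewrite big_ord0.
      by rewrite Rintegral_cst// mul0r.
    have cp t m : {for t, continuous (fun r : R => \sum_(k < m) r ^+ k * L (u ^+ k))}.
      apply: (@cont_sum _ _ (fun k r => r ^+ k * L (u ^+ k))) => k.
      by apply: cvgM; [exact: cX|exact: cvg_cst].
    under eq_Rintegral do rewrite big_ord_recr/=.
    rewrite RintegralD//; last 2 first.
    - by apply: nu_integrable => t _; exact: cp.
    - by apply: nu_integrable => t _; apply: cvgM; [exact: cX|exact: cvg_cst].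
    rewrite IH [RHS]big_ord_recr/= LZ RintegralZr//.
    by apply: nu_integrable => t _; exact: cX.
  rewrite addrAC subrr add0r; apply: nu_bound => // t t01.
  by apply: le_trans (Lle _) _; exact: tl_le.
have ib n : cmod (cint nu `[0, 1] (fun r => (1 - r%:C%C * u)^-1) - P n) <=
    2 * (cmod u ^+ n / (1 - cmod u) * V).
  apply: le_trans (cmod_le_ReIm _) _; rewrite mulr_natl mulr2n ReB ImB lerD//=.
    by apply: (part (@complex.Re R)) => [x y|x y|x]; rewrite ?ReD ?ReM ?Re_le_cmod//= mul0r subr0.
  by apply: (part (@complex.Im R)) => [x y|x y|x]; rewrite ?ImD ?ImM ?Im_le_cmod//= mul0r addr0.
(* The product with [1 / (1 - u)] at finite order; the truncation leaves one boundary term. *)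
have tele n : (1 - u) * psum (fun k => (kcoef k)%:C%C) u n.+1 = P n.+1 - (kcoef n)%:C%C * u ^+ n.+1.
  elim: n => [|n IH].
    by rewrite /psum /P /kcoef !big_ord1 expr0 expr1; ring.
  rewrite psumS mulrDr IH {2}/P [in RHS]big_ord_recr/= -/(P n.+1).
  have -> : kcoef n.+1 = kcoef n + nu_mom n.+1 by rewrite /kcoef [LHS]big_ord_recr.
  by rewrite rmorphD/= [u ^+ n.+2]exprS; ring.
move=> e e0.
(* A ratio larger than [cmod u] absorbs the linear growth of [kcoef] in that boundary term. *)
pose q := (cmod u + 1) / 2.
have uq : cmod u < q by rewrite /q; lra.
have q01 : 0 <= q < 1 by rewrite /q; have := cmod_ge0 u; move=> ?; apply/andP; split; lra.
have [M M0 hM] := nat_pow_le (cmod_ge0 u) uq.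
have c1 : 0 < 1 - cmod u by rewrite subr_gt0.
pose C := (1 - cmod u)^-1 * (2 * (V / (1 - cmod u)) + M * V).
have [n0 hn] := @geo_small R q C e q01 e0.
exists n0.+1 => -[//|n] n0n; apply: le_lt_trans (hn n.+1 (leqW n0n)).
have -> : kfun u - psum (fun k => (kcoef k)%:C%C) u n.+1 = (1 - u)^-1 *
    ((cint nu `[0, 1] (fun r => (1 - r%:C%C * u)^-1) - P n.+1) + (kcoef n)%:C%C * u ^+ n.+1).
  have -> : psum (fun k => (kcoef k)%:C%C) u n.+1 = (1 - u)^-1 * (P n.+1 - (kcoef n)%:C%C * u ^+ n.+1).
    by rewrite -tele mulrA mulVf// mul1r.
  by rewrite /kfun -mulrBr; congr (_ * _); ring.
rewrite cmodM /C -mulrA; apply: ler_pM; rewrite ?cmod_ge0//.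
  rewrite cmodV lef_pV2 ?posrE ?cmod_gt0//.
  by have := one_minus_ge u (_ : 0 <= 1 <= 1); rewrite mul1r; apply; rewrite ler01 lexx.
apply: le_trans (cmodD _ _) _; rewrite mulrDl; apply: lerD.
  apply: le_trans (ib _) _.
  have : cmod u ^+ n.+1 <= q ^+ n.+1 by rewrite lerXn2r ?nnegrE ?cmod_ge0 ?(andP q01).1// ltW.
  move=> h; rewrite -!mulrA ler_wpM2l//.
  have -> : cmod u ^+ n.+1 * ((1 - cmod u)^-1 * V) = (V * (1 - cmod u)^-1) * cmod u ^+ n.+1 by ring.
  by rewrite mulrA ler_wpM2l// mulr_ge0// invr_ge0 ltW.
rewrite cmodM cmodr ger0_norm ?kcoef_ge0// cmodX.
have h1 : kcoef n * cmod u ^+ n.+1 <= n.+1%:R * V * cmod u ^+ n.+1.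
  by rewrite ler_wpM2r ?exprn_ge0 ?cmod_ge0// kcoef_le.
apply: le_trans h1 _; rewrite mulrAC [X in _ <= X]mulrAC ler_wpM2r//.
Qed.

Lemma kernel_ps l : cmod l < 1 ->
  is_ps 1 (fun k => (kcoef k)%:C%C * conjc l ^+ k) (fun z => S_nu nu z l).
Proof.
move=> l1 z z1 e e0.
have zl : cmod (z * conjc l) < 1.
  by rewrite cmodM cmod_conj mulr_ilt1 ?cmod_ge0.
have [n hn] := kfun_ps zl e0; exists n => m /hn.
rewrite S_nu_kfun; congr (cmod (_ - _) < _).
by apply: eq_bigr => k _; rewrite exprMn mulrA mulrAC.
Qed.

Lemma kernel_coef_bound (r : R) : 0 <= r < 1 ->
  exists2 C : R, 0 <= C & forall k, kcoef k * r ^+ k <= C.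
Proof.
move=> r01; have [C C0 hC] := is_ps_bound kfun_ps r01; exists C => // k.
by have := hC k; rewrite cmodr ger0_norm// kcoef_ge0.
Qed.

End kernel.

(** * Logarithms and convexity *)

(** Proved from the definition of the integral by simple functions, separately for positive and
    negative parts; thus [log w] on a circle can be compared with a continuous function as it
    stands, with values [-oo] allowed. *)
Lemma integral_le (d : measure_display) (T : measurableType d) (R : realType)
    (m : set T -> \bar R) (D : set T) (f g : T -> \bar R) :
  (forall x, D x -> (f x <= g x)%E) ->
  (\int[m]_(x in D) f x <= \int[m]_(x in D) g x)%E.
Proof.
move=> fg; have fgD x : ((f \_ D) x <= (g \_ D) x)%E.
  by rewrite !patchE; case: ifPn => //; rewrite inE => /fg.
rewrite /integral; apply: leeB.
  apply: le_ereal_sup => _ [h hf <-]; exists h => // x; apply: le_trans (hf x) _.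
  by rewrite !funeposE ge_max !le_max fgD/= lexx orbT.
apply: le_ereal_sup => _ [h hf <-]; exists h => // x; apply: le_trans (hf x) _.
by rewrite !funenegE ge_max !le_max leeN2 fgD/= lexx orbT.
Qed.

Section log_mean.
Context (R : realType).

Let phi (a : R[i]) (t : R) := ln (cmod (1 + a * expi t)).

Let pos (a : R[i]) t : cmod a < 1 -> 0 < cmod (1 + a * expi t).
Proof.
move=> a1; have := cmod_sub_ge 1 (- (a * expi t)).
rewrite cmod1 cmodN cmodM cmod_expi mulr1 opprK; apply: lt_le_trans.
by rewrite subr_gt0.
Qed.

Let cphi (a : R[i]) : cmod a < 1 -> forall t, {for t, continuous (phi a)}.
Proof.
move=> a1 t.
apply: (@continuous_comp _ _ _ (fun t => cmod (1 + a * expi t)) (@ln R)).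
  apply: cont_cmod; apply: rcontD; first exact: rcont_cst.
  by apply: rcontM; [exact: rcont_cst|exact: rcont_expi].
by apply: continuous_ln; exact: pos.
Qed.

Let LL a := ri 0 (2 * pi) (phi a).

Let period (a : R[i]) t : phi a (t + 2 * pi) = phi a t.
Proof. by rewrite /phi expiD2pi. Qed.

Let LLN a : cmod a < 1 -> LL (- a) = LL a.
Proof.
move=> a1; have pp := pi_gt0 R.
have h2p : pi <= 0 + 2 * pi :> R by lra.
have := ri_period (ltW pp) h2p (cphi a1) (period a).
rewrite add0r /LL => <-.
have -> : ri pi (pi + 2 * pi) (phi a) = ri (0 + pi) (2 * pi + pi) (phi a).
  by rewrite add0r [2 * pi + pi]addrC.
rewrite ri_shift//; [|lra|exact: cphi].
by apply: eq_ri => t _; rewrite /phi expiDpi mulrN mulNr.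
Qed.

(** [(1 + a e^it) (1 - a e^it) = 1 - a^2 e^(2it)], both factors have the same mean, and doubling the
    angle runs through the circle twice. *)
Let LLdouble a : cmod a < 1 -> LL a + LL a = LL (- a ^+ 2).
Proof.
move=> a1; have pp := pi_gt0 R.
have Na1 : cmod (- a) < 1 by rewrite cmodN.
have a2 : cmod (- a ^+ 2) < 1 by rewrite cmodN cmodX exprn_ilt1 ?cmod_ge0.
rewrite -{2}LLN// /LL -riD//; [|by move=> t _; exact: cphi..].
rewrite (@eq_ri _ _ _ _ (fun t => phi (- a ^+ 2) (2 * t + 0))); last first.
  move=> t _; rewrite /phi -lnM ?posrE ?pos// -cmodM addr0; congr (ln (cmod _)).
  by rewrite -(expiX t 2); ring.
have := @ri_affine _ 0 (2 * pi) 2 0 (phi (- a ^+ 2)) (two_pi_ge0 R) _ (cphi a2).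
rewrite ltr0n mulr0 !addr0 => /(_ isT).
rewrite (@ri_split _ 0 (2 * pi) (2 * (2 * pi)))//; [|lra|lra|by move=> t _; exact: cphi].
have -> : ri (2 * pi) (2 * (2 * pi)) (phi (- a ^+ 2)) = ri 0 (2 * pi) (phi (- a ^+ 2)).
  have -> : 2 * (2 * pi) = 2 * pi + 2 * pi :> R by lra.
  rewrite -[X in ri X _ _]add0r ri_shift//; [|lra|exact: cphi].
  by apply: eq_ri => t _; rewrite period.
lra.
Qed.

(* The circle mean [LL] satisfies [2 LL a = LL (- a ^+ 2)] and is bounded on
   [cmod a <= q < 1], hence vanishes. *)
Lemma log_mean (a : R[i]) : cmod a < 1 -> ri 0 (2 * pi) (fun t => ln (cmod (1 + a * expi t))) = 0.
Proof.
move=> a1; rewrite -/(phi a) -/(LL a).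
pose q := cmod a.
have q0 : 0 <= q by exact: cmod_ge0.
have b_le b : cmod b <= q -> `|LL b| <= - ln (1 - q) * (2 * pi).
  move=> bq; have b1 := le_lt_trans bq a1.
  rewrite -[2 * pi]subr0; apply: ri_bound; first exact: two_pi_ge0.
    by move=> t _; exact: cphi.
  move=> t _; rewrite ler_norml opprK; apply/andP; split.
    rewrite ler_ln ?posrE ?subr_gt0 ?pos//.
    have := cmod_sub_ge 1 (- (b * expi t)).
    rewrite cmod1 cmodN cmodM cmod_expi mulr1 opprK; apply: le_trans.
    by rewrite lerD2l lerN2.
  rewrite -lnV ?posrE ?subr_gt0// ler_ln ?posrE ?invr_gt0 ?subr_gt0 ?pos//.
  apply: le_trans (cmodD _ _) _; rewrite cmod1 cmodM cmod_expi mulr1.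
  apply: (@le_trans _ _ (1 + q)); first by rewrite lerD2l.
  rewrite -[leRHS]mul1r ler_pdivlMr ?subr_gt0//.
  by rewrite mulrC -subr_sqr expr1n gerBl sqr_ge0.
have step n b : cmod b <= q -> `|LL b| <= - ln (1 - q) * (2 * pi) * 2^-1 ^+ n.
  elim: n b => [|n IH] b bq; first by rewrite expr0 mulr1; exact: b_le.
  have b1 := le_lt_trans bq a1.
  have bq2 : cmod (- b ^+ 2) <= q.
    by rewrite cmodN cmodX expr2 (le_trans _ bq)// ler_piMr ?cmod_ge0// ltW.
  have := IH _ bq2; rewrite -LLdouble//.
  have -> : `|LL b + LL b| = 2 * `|LL b|.
    have -> : LL b + LL b = 2 * LL b by rewrite mulr_natl mulr2n.
    by rewrite normrM ger0_norm.
  rewrite [2^-1 ^+ n.+1]exprS; set p := 2^-1 ^+ n => h.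
  have -> : - ln (1 - q) * (2 * pi) * (2^-1 * p) = (- ln (1 - q) * (2 * pi) * p) / 2 by ring.
  by rewrite ler_pdivlMr// mulrC.
apply/eqP; rewrite -normr_eq0 eq_le normr_ge0 andbT.
have h01 : 0 <= (2^-1 : R) < 1 by lra.
exact: (geo_limit_le h01 (fun n => step n a (lexx _))).
Qed.

(** Factoring out [z] reduces this to [log_mean] at [rho / z]. It is the mean value property of
    [log |z|] on disks that avoid 0. *)
Lemma log_circle_mean (z : R[i]) (rho : R) : 0 <= rho -> rho < cmod z ->
  ri 0 (2 * pi) (fun t => ln (cmod (z + rho%:C%C * expi t))) = 2 * pi * ln (cmod z).
Proof.
move=> r0 rz; have z0 : z != 0 by rewrite -cmod_gt0 (le_lt_trans r0).
have a1 : cmod (rho%:C%C / z) < 1.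
  by rewrite cmodM cmodV cmodr ger0_norm// ltr_pdivrMr ?mul1r// cmod_gt0.
rewrite (@eq_ri _ _ _ _ (fun t => ln (cmod z) + phi (rho%:C%C / z) t)); last first.
  move=> t _; rewrite /phi -lnM ?posrE ?cmod_gt0// -?cmod_gt0 ?pos// -cmodM.
  by congr (ln (cmod _)); field.
rewrite riD; [|by move=> t _; exact: cvg_cst|by move=> t _; exact: cphi].
by rewrite log_mean// addr0 ri_cst ?two_pi_ge0// subr0 mulrC.
Qed.

(** Parseval for the polynomial [z + rho * expi t]. The excess [rho ^+ 2] over the value at the
    centre makes the maximum principle strict. *)
Lemma sq_circle_mean (z : R[i]) (rho : R) :
  ri 0 (2 * pi) (fun t => cmod (z + rho%:C%C * expi t) ^+ 2) = 2 * pi * (cmod z ^+ 2 + rho ^+ 2).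
Proof.
pose b k := if k is 0%N then z else (rho%:C)%C.
transitivity (ri 0 (2 * pi) (fun t => cmod (\sum_(k < 2) b k * expi t ^+ k) ^+ 2)).
  by apply: eq_ri => t _; rewrite !big_ord_recr/= big_ord0 add0r expr0 expr1 mulr1.
rewrite (parseval_finite b) !big_ord_recr/= big_ord0 add0r; congr (_ * (_ + _)).
by rewrite cmodr real_normK ?num_real.
Qed.

End log_mean.

(** * Convex functions on the half-line *)

(** The three-point inequality without denominators, linear in the values of [f]. *)
Definition convex3 (R : realType) (f : R -> R) := forall x y z, 0 < x -> x < y -> y < z ->
  (z - x) * f y <= (z - y) * f x + (y - x) * f z.

Lemma convlE (R : realType) (t : {i01 R}) (a b : R) :
  conv t (a : convex_lmodType R^o) (b : convex_lmodType R^o) =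
  t%:num * a + (1 - t%:num) * b.
Proof. by []. Qed.

Lemma convex3_of_convex (R : realType) (f : R -> R) :
  convex_function (E := R^o) `]0, +oo[ f -> convex3 f.
Proof.
move=> cf x y z x0 xy yz.
have zx : 0 < z - x by rewrite subr_gt0 (lt_trans xy).
have t01 : 0 <= (z - y) / (z - x) <= 1.
  apply/andP; split; first by rewrite divr_ge0 ?subr_ge0 ?ltW// (lt_trans xy).
  by rewrite ler_pdivrMr// mul1r; lra.
pose t : {i01 R} := Itv01 (andP t01).1 (andP t01).2.
have := cf t x z; rewrite !inE/= !in_itv/= !andbT x0 (lt_trans x0 (lt_trans xy yz)).
move=> /(_ isT isT); rewrite convlE convRE/= /unstable.onem.
have -> : (z - y) / (z - x) * x + (1 - (z - y) / (z - x)) * z = y.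
  by field; rewrite gt_eqF.
have -> : (z - y) / (z - x) * f x + (1 - (z - y) / (z - x)) * f z =
  ((z - y) * f x + (y - x) * f z) / (z - x) by field; rewrite gt_eqF.
by rewrite ler_pdivlMr// mulrC.
Qed.

Lemma convex_of_convex3 (R : realType) (f : R -> R) :
  convex3 f -> convex_function (E := R^o) `]0, +oo[ f.
Proof.
move=> cf t x y; rewrite !inE/= !in_itv/= !andbT => x0 y0.
rewrite convlE convRE /unstable.onem.
have s0 : 0 <= t%:num by [].
have s1 : t%:num <= 1 by [].
move: s0 s1; set s := t%:num => s0 s1.
have [->|sn0] := eqVneq s 0; first by rewrite !mul0r !add0r !subr0 !mul1r.
have [->|sn1] := eqVneq s 1; first by rewrite !subrr !mul0r !addr0 !mul1r.
have {s0}s0 : 0 < s by rewrite lt_neqAle eq_sym sn0.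
have {s1}s1 : s < 1 by rewrite lt_neqAle sn1.
have [xy|yx|->] := ltgtP x y; last by rewrite -!mulrDl subrKC !mul1r.
- have yx0 : 0 < y - x by rewrite subr_gt0.
  have a1 : x < s * x + (1 - s) * y by rewrite -subr_gt0 (_ : _ - _ = (1 - s) * (y - x)); [rewrite mulr_gt0// subr_gt0|ring].
  have a2 : s * x + (1 - s) * y < y by rewrite -subr_gt0 (_ : _ - _ = s * (y - x)); [rewrite mulr_gt0|ring].
  rewrite -(ler_pM2l yx0); apply: le_trans (cf _ _ _ x0 a1 a2) _.
  by rewrite le_eqVlt; apply/orP; left; apply/eqP; ring.
- have yx0 : 0 < x - y by rewrite subr_gt0.
  have a1 : y < s * x + (1 - s) * y by rewrite -subr_gt0 (_ : _ - _ = s * (x - y)); [rewrite mulr_gt0|ring].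
  have a2 : s * x + (1 - s) * y < x by rewrite -subr_gt0 (_ : _ - _ = (1 - s) * (x - y)); [rewrite mulr_gt0// subr_gt0|ring].
  rewrite -(ler_pM2l yx0); apply: le_trans (cf _ _ _ y0 a1 a2) _.
  by rewrite le_eqVlt; apply/orP; left; apply/eqP; ring.
Qed.

(** Near [x] the slopes from [x] lie between those of the chords from [x / 2] to [x] and from [x] to
    [2 * x], so [f] is Lipschitz at [x]. *)
Lemma convex3_continuous (R : realType) (f : R -> R) : convex3 f ->
  forall x, 0 < x -> {for x, continuous f}.
Proof.
move=> cf x x0; apply/continuous_epsP => e e0.
pose p := x / 2; pose q := 2 * x.
have p0 : 0 < p by rewrite divr_gt0.
have px : 0 < x - p by rewrite /p; lra.
have qx : 0 < q - x by rewrite /q; lra.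
pose A := (f q - f x) / (q - x); pose B := (f x - f p) / (x - p).
pose C := `|A| + `|B| + 1.
have C0 : 0 < C by rewrite ltr_wpDl// addr_ge0.
have [A1 A2] : A <= C /\ - A <= C.
  have := ler_norm A; have := ler_norm (- A); rewrite normrN /C => h1 h2.
  by have := normr_ge0 B; split; lra.
have [B1 B2] : B <= C /\ - B <= C.
  have := ler_norm B; have := ler_norm (- B); rewrite normrN /C => h1 h2.
  by have := normr_ge0 A; split; lra.
have Aq : A * (q - x) = f q - f x by rewrite divfK// gt_eqF.
have Bp : B * (x - p) = f x - f p by rewrite divfK// gt_eqF.
exists (Num.min p (e / C)); first by rewrite lt_min p0 divr_gt0.
move=> y; rewrite lt_min => /andP[y1 y2].
suff : `|f y - f x| <= C * `|y - x|.
  by move/le_lt_trans; apply; rewrite mulrC -ltr_pdivlMr.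
have [yp yq] : p < y /\ y < q.
  by move: y1; rewrite ltr_norml /p /q => /andP[h1 h2]; split; lra.
have [yx|xy|->] := ltgtP y x; last by rewrite !subrr normr0 mulr0.
- have xq : x < q by rewrite -subr_gt0.
  have xy0 : 0 <= x - y by rewrite subr_ge0 ltW.
  have h1 := cf _ _ _ p0 yp yx; have h2 := cf _ _ _ (lt_trans p0 yp) yx xq.
  have k1 : f y - f x <= - B * (x - y).
    rewrite -(ler_pM2l px) (_ : _ * (- B * _) = - (B * (x - p)) * (x - y)); last by ring.
    by rewrite Bp; move: h1; lra.
  have k2 : f x - f y <= A * (x - y).
    rewrite -(ler_pM2l qx) (_ : _ * (A * _) = A * (q - x) * (x - y)); last by ring.
    by rewrite Aq; move: h2; lra.
  rewrite [`|y - x|]distrC (ger0_norm xy0) ler_norml.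
  have := ler_wpM2r xy0 A1; have := ler_wpM2r xy0 B2.
  by move=> *; apply/andP; split; lra.
- have px' : p < x by rewrite -subr_gt0.
  have xy0 : 0 <= y - x by rewrite subr_ge0 ltW.
  have h1 := cf _ _ _ x0 xy yq; have h2 := cf _ _ _ p0 px' xy.
  have k1 : f y - f x <= A * (y - x).
    rewrite -(ler_pM2l qx) (_ : _ * (A * _) = A * (q - x) * (y - x)); last by ring.
    by rewrite Aq; move: h1; lra.
  have k2 : f x - f y <= - B * (y - x).
    rewrite -(ler_pM2l px) (_ : _ * (- B * _) = - (B * (x - p)) * (y - x)); last by ring.
    by rewrite Bp; move: h2; lra.
  rewrite (ger0_norm xy0) ler_norml.
  have := ler_wpM2r xy0 A1; have := ler_wpM2r xy0 B2.
  by move=> *; apply/andP; split; lra.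
Qed.

(** After an increase from [x] to [y], convexity keeps [f] above the line through these points,
    which eventually exceeds [B]. *)
Lemma convex3_nonincreasing (R : realType) (f : R -> R) (T B : R) : convex3 f ->
  (forall t, T <= t -> f t <= B) -> forall x y, 0 < x -> x <= y -> f y <= f x.
Proof.
move=> cf fB x y x0; rewrite le_eqVlt => /predU1P[->//|xy].
rewrite leNgt; apply/negP => fxy.
have d0 : 0 < f y - f x by rewrite subr_gt0.
(* Beyond [T] and [y], and so far out that the chord line through [x] and [y] exceeds [B]. *)
pose z := Num.max (Num.max T (y + 1)) (x + ((y - x) * (B - f x) + 1) / (f y - f x)).
have zT : T <= z by rewrite !le_max lexx.
have yz : y < z by apply: (@lt_le_trans _ _ (y + 1)); rewrite ?ltrDl// !le_max lexx orbT.
have zx : ((y - x) * (B - f x) + 1) / (f y - f x) <= z - x.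
  by rewrite lerBrDl le_max lexx orbT.
move: zx; rewrite ler_pdivrMr// => zx.
have yx0 : 0 <= y - x by rewrite subr_ge0 ltW.
have h1 := cf _ _ _ x0 xy yz; have h2 := ler_wpM2l yx0 (fB z zT).
by move: zx h1 h2; lra.
Qed.

(** The supremum of the chord slopes to the left of [x] is at most every chord slope to the
    right. *)
Lemma convex3_subgradient (R : realType) (f : R -> R) (x : R) : convex3 f -> 0 < x ->
  exists s, forall y, 0 < y -> f x + s * (y - x) <= f y.
Proof.
move=> cf x0.
pose S := [set (f x - f y) / (x - y) | y in [set y | 0 < y < x]].
have ub z : x < z -> ubound S ((f z - f x) / (z - x)).
  move=> xz _ [y /= /andP[y0 yx] <-].
  rewrite ler_pdivrMr ?subr_gt0// mulrAC ler_pdivlMr ?subr_gt0//.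
  by have := cf _ _ _ y0 yx xz; lra.
have S0 : S !=set0.
  by exists ((f x - f (x / 2)) / (x - x / 2)), (x / 2) => //=; apply/andP; split; lra.
have hS : has_sup S.
  by split => //; exists ((f (x + 1) - f x) / (x + 1 - x)); apply: ub; rewrite ltrDl.
exists (sup S) => y y0.
have [yx|xy|->] := ltgtP y x; last by rewrite subrr mulr0 addr0.
- have : (f x - f y) / (x - y) <= sup S.
    by apply: sup_upper_bound => //; exists y => //=; rewrite y0.
  by rewrite ler_pdivrMr ?subr_gt0//; lra.
- have : sup S <= (f y - f x) / (y - x) by apply: ge_sup => //; exact: ub.
  by rewrite ler_pdivlMr ?subr_gt0//; lra.
Qed.

(** If the supremum were not attained, each point would have a neighbourhood where [f] stays a
    definite amount below it; by compactness one amount would serve everywhere. *)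
Lemma usc_max (R : realType) (a b : R) (f : R -> R) : a <= b ->
  (forall x c, a <= x <= b -> f x < c ->
     exists2 d : R, 0 < d & forall y, a <= y <= b -> `|y - x| < d -> f y < c) ->
  exists2 x, a <= x <= b & forall y, a <= y <= b -> f y <= f x.
Proof.
move=> ab usc.
(* Compactness in a form used twice: first for an upper bound of [f], then for a uniform gap below
   the supremum. *)
have cover (P : nat -> R -> Prop) :
    (forall x, a <= x <= b -> exists N c, f x < c /\ forall n y, (N <= n)%N -> f y < c -> P n y) ->
    exists n, forall y, a <= y <= b -> P n y.
  move=> hP.
  have /compact_near_coveringP := @segment_compact R a b.
  move=> /(_ nat \oo (fun n y => a <= y <= b -> P n y) _).
  case.
    move=> x; rewrite /= in_itv/= => xab.
    have [N [c [fc hc]]] := hP x xab; have [d d0 hd] := usc x c xab fc.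
    exists ([set y | `|x - y| < d], [set n | (N <= n)%N]) => /=.
      split; last by exists N.
      by apply/nbhs_ballP; exists d.
    move=> [y n]/= [h1 h2] yab; apply: hc => //; apply: hd => //.
    by rewrite distrC.
  move=> N _ /(_ N (leqnn N)) h; exists N => y yab.
  by apply: h => //=; rewrite in_itv.
have [n0 hn0] : exists n : nat, forall y, a <= y <= b -> f y < n%:R.
  apply: cover => x xab; exists (Num.truncn (f x)).+1, (Num.truncn (f x)).+1%:R.
  split; first exact: truncnS_gt.
  by move=> n y Nn /lt_le_trans; apply; rewrite ler_nat.
pose S := [set f y | y in [set y | a <= y <= b]].
have hS : has_sup S.
  split; first by exists (f a), a => //=; rewrite lexx.
  by exists n0%:R => _ [y /= yab <-]; rewrite ltW// hn0.
apply: contrapT => hno.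
have lt_sup x : a <= x <= b -> f x < sup S.
  move=> xab; rewrite lt_neqAle; apply/andP; split; last first.
    by apply: sup_upper_bound => //; exists x.
  apply/eqP => E; apply: hno; exists x => // y yab; rewrite E.
  by apply: sup_upper_bound => //; exists y.
have [n hn] : exists n : nat, forall y, a <= y <= b -> f y < sup S - n.+1%:R^-1.
  apply: cover => x xab; have d0 : 0 < sup S - f x by rewrite subr_gt0 lt_sup.
  pose N := Num.truncn (2 / (sup S - f x)).
  exists N, ((f x + sup S) / 2); split; first by lra.
  move=> m y Nm /lt_le_trans; apply.
  have h : 2 / (sup S - f x) < m.+1%:R.
    by apply: (lt_le_trans (truncnS_gt _)); rewrite ler_nat ltnS.
  have : m.+1%:R^-1 < (sup S - f x) / 2.
    by rewrite -[ltRHS]invrK ltf_pV2 ?posrE ?invr_gt0 ?divr_gt0// invf_div.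
  by set i := _^-1; move=> hi; lra.
have : sup S <= sup S - n.+1%:R^-1.
  by apply: ge_sup; [case: hS|move=> _ [y /= yab <-]; rewrite ltW// hn].
by rewrite leNgt ltrBlDr ltrDl invr_gt0 ltr0n.
Qed.

(** * Radial logarithmically subharmonic functions *)

(** Holds at [x = 0] too, where [lne] is [-oo]; it transfers semicontinuity between [log w] and [w]
    across zeros. *)
Lemma ltr_expR_ln (R : realType) (x c : R) : 0 <= x -> 0 < c ->
  (lne x%:E < (ln c)%:E)%E = (x < c).
Proof.
move=> x0 c0; rewrite /lne; case: ifPn => [xle|].
  by rewrite ltNyr (le_lt_trans xle).
by rewrite -ltNge => xp; rewrite lte_fin ltr_ln.
Qed.

Section radial_subharmonic.
Context (R : realType) (w : R[i] -> R).
Hypotheses (ww : weight w) (rw : radial w) (sw : log_subharmonic w).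

Definition profile (r : R) : R := w (r%:C)%C.

Lemma profileE z : cmod z < 1 -> w z = profile (cmod z).
Proof. by move=> z1; rewrite rw; [rewrite normc_cmod|apply/disk_cmod]. Qed.

Lemma profile_ge0 r : 0 <= r < 1 -> 0 <= profile r.
Proof.
by move=> /andP[r0 r1]; apply: ww.1; apply/disk_cmod; rewrite cmodr ger0_norm.
Qed.

Lemma profile_usc r c : 0 <= r < 1 -> profile r < c ->
  exists2 d : R, 0 < d & forall s, 0 <= s < 1 -> `|s - r| < d -> profile s < c.
Proof.
move=> r01 rc; have [r0 r1] := andP r01.
have c0 : 0 < c by rewrite (le_lt_trans _ rc)// profile_ge0.
have [_ usc _] := sw.
have rD : disk (r%:C)%C by apply/disk_cmod; rewrite cmodr ger0_norm.
have := usc _ rD (ln c); rewrite ltr_expR_ln ?profile_ge0// => /(_ rc).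
move=> /(nbhsC_ball _ _).1[d d0 hd]; exists d => // s s01 sr.
rewrite -(ltr_expR_ln (profile_ge0 s01) c0); apply: hd.
by rewrite -rmorphB cmodr.
Qed.

(* The term [eps * (r3 ^+ 2 - r ^+ 2)] makes the comparison function strictly
   superharmonic, so that an interior maximum contradicts the submean inequality. *)
Lemma profile_max_principle r1 r2 r3 al be : 0 < r1 -> r1 < r2 -> r2 < r3 -> r3 < 1 ->
  profile r1 <= expR (al + be * ln r1) -> profile r3 <= expR (al + be * ln r3) ->
  profile r2 <= expR (al + be * ln r2).
Proof.
move=> r10 r12 r23 r31 h1 h3.
have r20 := lt_trans r10 r12; have r30 := lt_trans r20 r23.
have sub01 r : r1 <= r <= r3 -> 0 <= r < 1.
  by move=> /andP[a b]; rewrite (le_trans (ltW r10) a) (le_lt_trans b).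
suff H eps : 0 < eps -> profile r2 <= expR (al + be * ln r2 + eps * (r3 ^+ 2 - r2 ^+ 2)).
  have K0 : 0 < r3 ^+ 2 - r2 ^+ 2 by rewrite subr_gt0 ltrXn2r// ?nnegrE ltW.
  rewrite leNgt; apply/negP => hlt.
  have p0 : 0 < profile r2 by rewrite (lt_trans _ hlt)// expR_gt0.
  have d0 : 0 < ln (profile r2) - (al + be * ln r2).
    by rewrite subr_gt0 -ltr_expR lnK.
  (* This [eps] makes the perturbation half of the supposed gap. *)
  have := H ((ln (profile r2) - (al + be * ln r2)) / (2 * (r3 ^+ 2 - r2 ^+ 2))).
  rewrite divr_gt0// ?mulr_gt0// => /(_ isT).
  rewrite -{1}(lnK p0) ler_expR.
  have -> : forall x y : R, 0 < y -> x / (2 * y) * y = x / 2.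
    by move=> x y y0; field; rewrite gt_eqF.
    move: d0; lra.
  exact: K0.
move=> e0.
pose g r := al + be * ln r + eps * (r3 ^+ 2 - r ^+ 2).
have cg r : 0 < r -> {for r, continuous (fun r => expR (g r))}.
  move=> r0; apply: (@continuous_comp _ _ _ g expR); last exact: continuous_expR.
  apply: cvgD.
    apply: cvgD; first exact: cvg_cst.
    by apply: cont_scale; exact: continuous_ln.
  apply: (@cont_scale _ eps (fun r => r3 ^+ 2 - r ^+ 2)).
  by apply: cvgB; [exact: cvg_cst|exact: exprn_continuous].
(* The quotient by the comparison function remains a real number where [profile] vanishes. *)
pose Psi r := profile r * expR (- g r).
have Psi_le r c : (Psi r <= c) = (profile r <= c * expR (g r)).
  by rewrite /Psi expRN ler_pdivrMr ?expR_gt0.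
have Psi_lt r c : (Psi r < c) = (profile r < c * expR (g r)).
  by rewrite /Psi expRN ltr_pdivrMr ?expR_gt0.
suff H : forall r, r1 <= r <= r3 -> Psi r <= 1.
  by have := H r2; rewrite Psi_le mul1r; apply; rewrite !ltW.
have [|r0 r0I hmax] := @usc_max R r1 r3 Psi (ltW (lt_trans r12 r23)).
  move=> x c xI; rewrite Psi_lt => hx.
  have x0 : 0 < x by case/andP: xI => h _; exact: lt_le_trans h.
  pose c' := (profile x + c * expR (g x)) / 2.
  have hx1 : profile x < c' by rewrite /c'; lra.
  have hx2 : 0 < c * expR (g x) - c' by rewrite /c'; lra.
  have [d1 d10 hd1] := profile_usc (sub01 _ xI) hx1.
  have cc : {for x, continuous (fun r => c * expR (g r))} by apply: cont_scale; exact: cg.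
  have [d2 d20 hd2] := (continuous_epsP _ _).1 cc _ hx2.
  exists (Num.min d1 d2); first by rewrite lt_min d10.
  move=> y yI; rewrite lt_min => /andP[y1 y2]; rewrite Psi_lt.
  have := hd1 y (sub01 _ yI) y1; have := hd2 y y2.
  by rewrite ltr_norml => /andP[]; lra.
suff M1 : Psi r0 <= 1 by move=> r rI; exact: le_trans (hmax r rI) M1.
rewrite leNgt; apply/negP => M1.
pose M := Psi r0.
have M0 : 0 < M by exact: lt_trans M1.
have end1 r : al + be * ln r <= g r -> profile r <= expR (al + be * ln r) -> Psi r <= 1.
  by move=> hg hp; rewrite Psi_le mul1r (le_trans hp)// ler_expR.
have rr0 : r1 < r0.
  rewrite lt_neqAle (andP r0I).1 andbT; apply/eqP => E.
  move: M1; rewrite ltNge -E end1// /g lerDl mulr_ge0 ?(ltW e0)// subr_ge0.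
  by rewrite lerXn2r ?nnegrE ?ltW// (lt_trans r12).
have rr3 : r0 < r3.
  rewrite lt_neqAle (andP r0I).2 andbT; apply/eqP => E.
  by move: M1; rewrite ltNge E end1// /g lerDl mulr_ge0 ?(ltW e0)// subrr.
have r00 : 0 < r0 := lt_trans r10 rr0.
have r0D : disk (r0%:C)%C by apply/disk_cmod; rewrite cmodr gtr0_norm// (lt_trans rr3).
have [_ _ /(_ _ r0D)[rho0 rho00 hrho]] := sw.
(* Small enough for the submean inequality, and for the circle around [r0] to stay in the annulus
   where [r0] maximizes [Psi]. *)
pose rho := Num.min rho0 (Num.min (r0 - r1) (r3 - r0)) / 2.
have m0 : 0 < Num.min rho0 (Num.min (r0 - r1) (r3 - r0)) by rewrite !lt_min rho00 !subr_gt0 rr0.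
have rhop : 0 < rho by rewrite divr_gt0.
have mle : Num.min rho0 (Num.min (r0 - r1) (r3 - r0)) <= rho0 /\
   Num.min rho0 (Num.min (r0 - r1) (r3 - r0)) <= r0 - r1 /\
   Num.min rho0 (Num.min (r0 - r1) (r3 - r0)) <= r3 - r0.
  by rewrite !ge_min !lexx !orbT.
have [rl1 [rl2 rl3]] : rho < rho0 /\ rho < r0 - r1 /\ rho < r3 - r0.
  by move: mle m0; rewrite /rho => -[a [b c]] d; split; [|split]; lra.
have := hrho rho; rewrite rhop rl1 => /(_ isT); rewrite leNgt => /negP; apply.
have pr0 : profile r0 = M * expR (g r0) by rewrite /M /Psi expRN divfK// gt_eqF// expR_gt0.
have pr0p : 0 < profile r0 by rewrite pr0 mulr_gt0// expR_gt0.
rewrite -/(profile r0) lne_EFin// pr0 lnM ?posrE ?expR_gt0// expRK.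
pose s t := cmod (r0%:C%C + rho%:C%C * expi t).
have sI t : r1 <= s t <= r3.
  apply/andP; split.
    have := cmod_sub_ge (r0%:C)%C (- (rho%:C%C * expi t)); rewrite opprK cmodN cmodM cmod_expi mulr1 !cmodr !gtr0_norm//.
    by rewrite -/(s t); lra.
  have := cmodD (r0%:C)%C (rho%:C%C * expi t); rewrite cmodM cmod_expi mulr1 !cmodr !gtr0_norm//.
  by rewrite -/(s t); lra.
have s0 t : 0 < s t by have /andP[h _] := sI t; exact: lt_le_trans h.
have cs t : {for t, continuous s}.
  apply: cont_cmod; apply: rcontD; first exact: rcont_cst.
  by apply: rcontM; [exact: rcont_cst|exact: rcont_expi].
have cln t : {for t, continuous (fun t => ln (s t))}.
  by apply: (@continuous_comp _ _ _ s (@ln R)); [exact: cs|exact: continuous_ln].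
(* [G t] is the logarithm of [M * expR (g (s t))], the bound for [w] on the circle given by the
   maximum. *)
pose G t := (ln M + al + eps * r3 ^+ 2) + (be * ln (s t) + (- eps) * s t ^+ 2).
have cG1 t : {for t, continuous (fun t => be * ln (s t))} by apply: cont_scale; exact: cln.
have cG2 t : {for t, continuous (fun t => - eps * s t ^+ 2)}.
  by apply: cont_scale; apply: cont_sq; exact: cs.
have cG12 t : {for t, continuous (fun t => be * ln (s t) + - eps * s t ^+ 2)}.
  by apply: cvgD; [exact: cG1|exact: cG2].
have cG t : {for t, continuous G} by apply: cvgD; [exact: cvg_cst|exact: cG12].
have T0 := two_pi_ge0 R.
have pp := pi_gt0 R.
have Tp : 0 < (2 * pi)^-1 :> R by rewrite invr_gt0 mulr_gt0.
apply: (@le_lt_trans _ _ ((2 * pi)^-1 * ri 0 (2 * pi) G)%:E).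
  rewrite /circle_mean EFinM lee_wpmul2l ?lee_fin ?(ltW Tp)//.
  rewrite -ri_EFin; last by move=> t _; exact: cG.
  apply: integral_le => t _.
  have -> : (cos t +i* sin t)%C = expi t by [].
  have st1 : cmod (r0%:C%C + rho%:C%C * expi t) < 1.
    by have /andP[_ h] := sI t; exact: le_lt_trans h r31.
  rewrite profileE// -/(s t).
  have hM : profile (s t) <= M * expR (g (s t)) by rewrite -Psi_le; exact: hmax.
  have [ps|ps] := leP (profile (s t)) 0.
    by rewrite /lne ps leNye.
  rewrite lne_EFin// lee_fin.
  have -> : G t = ln (M * expR (g (s t))).
    by rewrite lnM ?posrE ?expR_gt0// expRK /G /g; ring.
  by rewrite ler_ln ?posrE ?mulr_gt0 ?expR_gt0.
rewrite lte_fin.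
rewrite /G riD//; last by move=> t _; exact: cvg_cst.
rewrite ri_cst// riD// riZ// riZ; last by move=> t _; apply: cont_sq; exact: cs.
rewrite /s log_circle_mean ?(ltW rhop)//; last by rewrite cmodr gtr0_norm//; lra.
rewrite sq_circle_mean cmodr gtr0_norm// subr0.
have E (P A B C : R) : 0 < P ->
    (2 * P)^-1 * (A * (2 * P) + (be * (2 * P * B) + - eps * (2 * P * C))) = A + be * B - eps * C.
  by move=> P0; field; rewrite gt_eqF.
rewrite {}E//.
(* The mean of [G] falls below the logarithm of [profile r0] by exactly this amount. *)
have : 0 < eps * rho ^+ 2 by rewrite mulr_gt0// exprn_gt0.
rewrite /g; lra.
Qed.

(** At a zero [a] the bound of the maximum principle holds for every slope [be]. Steep lines through
    a second point [b] then push the bound at [r] below any positive value. *)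
Lemma profile_dichotomy :
  (forall r, 0 < r < 1 -> profile r = 0) \/ (forall r, 0 < r < 1 -> 0 < profile r).
Proof.
have [[a [a01 pa]]|hno] := pselect (exists a, 0 < a < 1 /\ profile a = 0); last first.
  right=> r r01; have [r0 r1] := andP r01.
  rewrite lt_neqAle profile_ge0 ?ltW ?r1// andbT; apply/eqP => E.
  by apply: hno; exists r; split.
left=> r r01; have [r0 r1] := andP r01; have [a0 a1] := andP a01.
have rr : 0 <= profile r by apply: profile_ge0; rewrite ltW.
apply/eqP; rewrite eq_le rr andbT leNgt; apply/negP => pr.
have [ra|ar|E] := ltgtP r a; last by move: pr; rewrite E pa ltxx.
- pose b := r / 2; have b0 : 0 < b by rewrite divr_gt0.
  have br : b < r by rewrite /b; lra.
  have lbr : 0 < ln r - ln b by rewrite subr_gt0 ltr_ln.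
  pose L := ln (profile b + 1).
  have pb : 0 <= profile b by apply: profile_ge0; rewrite (ltW b0) (lt_trans br).
  (* The line worth [L] at [b] takes the value [ln (profile r) - 1] at [r]; the 1 inside [L] covers
     a zero of [profile] at [b]. *)
  pose be := (ln (profile r) - L - 1) / (ln r - ln b).
  have := @profile_max_principle b r a (L - be * ln b) be b0 br ra a1.
  rewrite subrK pa expR_ge0 lnK ?posrE ?ltr_wpDl// lerDl ler01 => /(_ isT isT).
  rewrite -{1}(lnK pr) ler_expR.
  have -> : L - be * ln b + be * ln r = L + be * (ln r - ln b) by ring.
  by rewrite divfK ?gt_eqF//; lra.
- pose b := (1 + r) / 2.
  have rb : r < b by rewrite /b; lra.
  have b1 : b < 1 by rewrite /b; lra.
  have b0 : 0 < b by exact: lt_trans rb.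
  have lbr : 0 < ln b - ln r by rewrite subr_gt0 ltr_ln.
  pose L := ln (profile b + 1).
  have pb : 0 <= profile b by apply: profile_ge0; rewrite (ltW b0).
  pose be := (L + 1 - ln (profile r)) / (ln b - ln r).
  have := @profile_max_principle a r b (L - be * ln b) be a0 ar rb b1.
  rewrite subrK pa expR_ge0 lnK ?posrE ?ltr_wpDl// lerDl ler01 => /(_ isT isT).
  rewrite -{1}(lnK pr) ler_expR.
  have -> : L - be * ln b + be * ln r = L - be * (ln b - ln r) by ring.
  by rewrite divfK ?gt_eqF//; lra.
Qed.

Definition hprofile (t : R) : R := expR (- t) * profile (expR (- (t / 2))).

Let e01 (t : R) : 0 < t -> 0 < expR (- (t / 2)) < 1.
Proof. by move=> t0; rewrite expR_gt0 expR_lt1; lra. Qed.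

Section positive.
Hypothesis pos : forall r, 0 < r < 1 -> 0 < profile r.

Lemma hprofile_gt0 t : 0 < t -> 0 < hprofile t.
Proof. by move=> t0; rewrite mulr_gt0 ?expR_gt0// pos// e01. Qed.

Lemma ln_hprofile t : 0 < t -> ln (hprofile t) = - t + ln (profile (expR (- (t / 2)))).
Proof. by move=> t0; rewrite lnM ?posrE ?expR_gt0 ?pos ?e01// expRK. Qed.

(** Affine functions of [ln r] are affine in [t = - 2 * ln r], so the maximum principle with the
    chord as majorant is exactly convexity in [t]; a slope [B] in [t] is the slope [- 2 * B] in
    [ln r]. *)
Lemma hprofile_convex3 : convex3 (fun t => ln (hprofile t)).
Proof.
move=> x y z x0 xy yz.
have y0 := lt_trans x0 xy; have z0 := lt_trans y0 yz.
rewrite !ln_hprofile//.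
pose f t := ln (profile (expR (- (t / 2)))); rewrite -/(f x) -/(f y) -/(f z).
have zx : 0 < z - x by rewrite subr_gt0 (lt_trans xy).
pose B := (f z - f x) / (z - x).
have hB : B * (z - x) = f z - f x by rewrite divfK// gt_eqF.
have pE t : 0 < t -> f t = (f x - B * x) + B * t ->
    profile (expR (- (t / 2))) <= expR ((f x - B * x) + (- 2 * B) * ln (expR (- (t / 2)))).
  move=> t0 E; rewrite expRK.
  rewrite (_ : _ + _ = f t); last by rewrite E; field.
  by rewrite /f lnK ?posrE ?pos ?e01.
have := @profile_max_principle (expR (- (z / 2))) (expR (- (y / 2))) (expR (- (x / 2)))
   (f x - B * x) (- 2 * B) (expR_gt0 _).
rewrite !ltr_expR => H.
have {H} : profile (expR (- (y / 2))) <= expR ((f x - B * x) + (- 2 * B) * ln (expR (- (y / 2)))).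
  apply: H; [lra|lra|by case/andP: (e01 x0)|apply: pE => //|apply: pE => //; ring].
  by move: hB; lra.
rewrite expRK -{1}(lnK (pos (e01 y0))) ler_expR -/(f y) => hy.
have : (z - x) * f y <= (z - x) * (f x - B * x + - 2 * B * - (y / 2)) by rewrite ler_pM2l.
have -> : (z - x) * (f x - B * x + - 2 * B * - (y / 2)) = (z - x) * f x + B * (z - x) * (y - x) by field.
by rewrite hB; lra.
Qed.

End positive.

(** Either [profile] is 0 on []0, 1[], or its logarithm is a convex function of [t] plus [t], and
    convex functions are continuous. *)
Lemma profile_continuous r : 0 < r < 1 -> {for r, continuous profile}.
Proof.
move=> r01; have [r0 r1] := andP r01.
have nearE (f : R -> R) : (forall s, 0 < s < 1 -> f s = profile s) -> {for r, continuous f} ->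
    {for r, continuous profile}.
  move=> fE /continuous_epsP cf; apply/continuous_epsP => e e0; have [d d0 hd] := cf e e0.
  exists (Num.min d (Num.min r (1 - r))); first by rewrite !lt_min d0 r0 subr_gt0.
  move=> s; rewrite !lt_min => /andP[s1 /andP[s2 s3]]; rewrite -!fE//; first exact: hd.
  move: s2 s3; rewrite !ltr_norml => /andP[a b] /andP[c d']; apply/andP; split; lra.
have [z|p] := profile_dichotomy.
  by apply: (nearE (fun=> 0)) => [s s01|]; [rewrite z|exact: cvg_cst].
apply: (nearE (fun s => expR (ln (hprofile (- 2 * ln s)) + - 2 * ln s))).
  move=> s s01; have [s0 s1] := andP s01.
  have t0 : 0 < - 2 * ln s by rewrite mulNr oppr_gt0 pmulr_rlt0// ln_lt0.
  rewrite expRD lnK ?posrE; last exact: hprofile_gt0.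
  rewrite /hprofile mulrAC -expRD addNr expR0 mul1r.
  by rewrite (_ : - (- 2 * ln s / 2) = ln s) ?lnK ?posrE//; field.
have t0 : 0 < - 2 * ln r by rewrite mulNr oppr_gt0 pmulr_rlt0// ln_lt0.
have cl : {for r, continuous (fun s : R => - 2 * ln s)}.
  by apply: cont_scale; exact: continuous_ln.
apply: (@continuous_comp _ _ _ (fun s => ln (hprofile (- 2 * ln s)) + - 2 * ln s) expR); last exact: continuous_expR.
apply: cvgD => //.
apply: (@continuous_comp _ _ _ (fun s : R => - 2 * ln s) (fun t => ln (hprofile t))) => //.
exact: (convex3_continuous (hprofile_convex3 p)).
Qed.

(** [expR t * hprofile t] is [profile] at [expR (- (t / 2))], and upper semicontinuity bounds
    [profile] near 0. *)
Lemma hprofile_bounded : exists2 T : R, 0 < T &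
  (ereal_sup [set (expR t * hprofile t)%:E | t in `[T, +oo[] < +oo)%E.
Proof.
have z01 : (0 : R) <= (0 : R) < 1 by rewrite lexx ltr01.
have h0 : profile 0 < profile 0 + 1 by rewrite ltrDl.
have [d d0 hd] := profile_usc z01 h0.
pose T := Num.max 1 (- 2 * ln d + 1).
exists T; first by rewrite lt_max ltr01.
apply: (@le_lt_trans _ _ (profile 0 + 1)%:E); last exact: ltry.
apply: ge_ereal_sup => _ [t /= + <-]; rewrite in_itv/= andbT ge_max => /andP[t1 t2].
rewrite lee_fin /hprofile mulrA -expRD subrr expR0 mul1r.
have t0 : 0 < t by lra.
have /andP[h1 h2] := e01 t0.
apply: ltW; apply: hd; first by rewrite (ltW h1).
rewrite subr0 gtr0_norm// -[ltRHS](lnK (_ : d \is Num.pos)) ?posrE// ltr_expR.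
lra.
Qed.

End radial_subharmonic.

(** * The two implications *)

Lemma sum_single (R : realType) (V : zmodType) (F : nat -> V) k n : (k < n)%N ->
  (forall j, j != k -> F j = 0) -> \sum_(j < n) F j = F k.
Proof.
move=> kn F0; rewrite (bigD1 (Ordinal kn))//= big1 ?addr0// => j /eqP jk.
by apply: F0; apply/eqP => E; apply: jk; apply: val_inj.
Qed.

Definition monocoef (R : realType) (k j : nat) : R[i] := if j == k then 1 else 0.

Lemma monomial_ps (R : realType) k : is_ps 1 (@monocoef R k) (fun z => z ^+ k).
Proof.
move=> z _ e e0; exists k.+1 => n kn.
rewrite /psum (@sum_single R _ (fun j => monocoef R k j * z ^+ j) k n)//.
  by rewrite /monocoef eqxx mul1r subrr cmod0.
by move=> j /negbTE jk; rewrite /monocoef jk mul0r.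
Qed.

Lemma eq_disk_int (R : realType) (f g : R[i] -> \bar R) :
  (forall z, cmod z < 1 -> f z = g z) -> disk_int f = disk_int g.
Proof.
move=> fg; rewrite /disk_int; congr (_ * _)%E; apply: eq_integral => p.
by rewrite inE => /disk_cmod; exact: fg.
Qed.

Lemma eq_disk_cint (R : realType) (f g : R[i] -> R[i]) :
  (forall z, cmod z < 1 -> f z = g z) -> disk_cint f = disk_cint g.
Proof.
move=> fg; rewrite /disk_cint.
by congr (fine _ +i* fine _)%C; apply: eq_disk_int => z /fg ->.
Qed.

Lemma eq_sqnorm (R : realType) (w : R[i] -> R) (f g : R[i] -> R[i]) :
  (forall z, cmod z < 1 -> f z = g z) -> bergman_sqnorm w f = bergman_sqnorm w g.
Proof. by move=> fg; apply: eq_disk_int => z /fg ->. Qed.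

Lemma psq_single (R : realType) (m : nat -> R) k n : (forall j, 0 <= m j) ->
  psq m (@monocoef R k) n <= m k.
Proof.
move=> m0; have [kn|nk] := ltnP k n.
  rewrite /psq big_mkord (@sum_single R _ (fun j => cmod (monocoef R k j) ^+ 2 * m j) k n)//.
    by rewrite /monocoef eqxx cmod1 expr1n mul1r.
  by move=> j /negbTE jk; rewrite /monocoef jk cmod0 expr0n mul0r.
rewrite /psq big_mkord big1// => j _.
by rewrite /monocoef ltn_eqF ?cmod0 ?expr0n ?mul0r// (leq_trans (ltn_ord j)).
Qed.

Lemma conj_coef (R : realType) (x : R) (z : R[i]) k :
  conjc (x%:C%C * conjc z ^+ k) = x%:C%C * z ^+ k.
Proof.
have X (u : R[i]) : conjc (u ^+ k) = conjc u ^+ k by rewrite rmorphXn.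
have -> : conjc (x%:C%C * conjc z ^+ k) = conjc x%:C%C * conjc (conjc z ^+ k) by rewrite rmorphM.
by rewrite X conjcK conjc_real.
Qed.

(** Reproducing the monomial of degree [k] at one nonzero point isolates the [k]-th coefficient of
    the kernel and gives [c_k m_k = 1]. *)
Lemma kernel_implies_laplace (R : realType)
    (nu : {finite_measure set (measurableTypeR R) -> \bar R}) :
  radial_log_subharmonic_bergman_kernel (S_nu nu) ->
  exists h : R -> R,
    [/\ forall t : R, 0 < t -> 0 < h t,
        log_convex h,
        forall n : nat,
          ((\int[nu]_(r in `[0%R, 1%R]) (geom_quot n r)%:E) *
           (\int[lebesgue_measure]_(t in `]0%R, +oo[)
              (expR (- n%:R * t) * h t)%:E) = 1)%E &
        exists2 T : R, 0 < T &
          (ereal_sup [set (expR t * h t)%:E | t in `[T, +oo[] < +oo)%E].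
Proof.
move=> [w [[ww rw sw wfin] [_ [K [Kb Krep] KS]]]].
pose psi := profile w.
have psi0 r : 0 <= r < 1 -> 0 <= psi r by exact: profile_ge0.
have cpsi r : 0 < r < 1 -> {for r, continuous psi} by exact: profile_continuous.
have wpsi z : cmod z < 1 -> w z = psi (cmod z) by exact: profileE.
have mw := ww.2.
have M0fin : (moment psi 0 < +oo)%E.
  rewrite /moment (_ : (\int[_]_(r in _) _ = 2%:E * \int[lebesgue_measure]_(r in `]0%R, 1%R[) (r * w r%:C%C)%:E)%E).
    by rewrite lte_mul_pinfty.
  rewrite -ge0_integralZl//.
  - by apply: eq_integral => r _; rewrite -EFinM mulrA.
  - apply/measurable_EFinP; exact: (measurable_pow_psi cpsi 1).
  - by move=> r; rewrite /= in_itv/= => /andP[r0 r1]; rewrite lee_fin mulr_ge0 ?(ltW r0)// psi0// (ltW r0).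
have Mfin k : moment psi k \is a fin_num.
  rewrite ge0_fin_numE; last exact: moment_ge0.
  apply: le_lt_trans M0fin; apply: integral_le => r; rewrite /= in_itv/= => /andP[r0 r1].
  rewrite lee_fin ler_wpM2r ?psi0 ?(ltW r0)// ler_wpM2l//.
  by rewrite exprS ler_piMr ?(ltW r0)// exprn_ile1 ?ltW.
pose m k := fine (moment psi k).
have mE k : moment psi k = (m k)%:E by rewrite /m fineK.
have m0 k : 0 <= m k by rewrite fine_ge0// moment_ge0.
(* Any nonzero point of the disk would serve, as [z0 ^+ k] is cancelled below. *)
pose z0 : R[i] := ((2^-1 : R)%:C)%C.
have z0n : cmod z0 = 2^-1 by rewrite cmodr ger0_norm.
have z01 : cmod z0 < 1 by rewrite z0n; lra.
have z0D : disk z0 by apply/disk_cmod.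
have cm k : kcoef nu k * m k = 1.
  have fm : (bergman_sqnorm w (fun z => (z ^+ k)%R) < +oo)%E.
    apply: (@le_lt_trans _ _ (m k)%:E); last exact: ltry.
    by apply: (sqnorm_le psi0 cpsi wpsi mw mE (@monomial_ps R k)) => n; exact: psq_single.
  have KSz l : cmod l < 1 -> K l z0 = S_nu nu l z0.
    by move=> l1; apply: KS => //; apply/disk_cmod.
  have fK : (bergman_sqnorm w (fun l => S_nu nu l z0) < +oo)%E.
    by rewrite -(eq_sqnorm w KSz); case: (Kb _ z0D).
  have fB : bergman w (fun z => z ^+ k).
    by split => //; apply: (ps_holomorphic (@monomial_ps R k)).
  have := Krep _ _ fB z0D.
  rewrite (@eq_disk_cint _ _ (fun l => l ^+ k * conjc (S_nu nu l z0) * (w l)%:C%C)); last first.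
    by move=> l /KSz ->.
  rewrite (inner_product psi0 cpsi wpsi mw mE (s := z0 ^+ k * (kcoef nu k * m k)%:C%C) (@monomial_ps R k) (kernel_ps nu z01))//.
    move=> E; have z0k : z0 ^+ k != 0.
      by rewrite -cmod_gt0 cmodX exprn_gt0// z0n.
    apply: complexI; apply: (mulfI z0k); rewrite -E rmorph1 mulr1//.
  move=> e e0; exists k.+1 => p kp.
  rewrite (@sum_single R _ (fun j => monocoef R k j * conjc ((kcoef nu j)%:C%C * conjc z0 ^+ j) * (m j)%:C%C) k p)//; last first.
    by move=> j /negbTE jk; rewrite /monocoef jk !mul0r.
  rewrite /monocoef eqxx mul1r conj_coef (_ : _ - _ = 0) ?cmod0//.
  rewrite rmorphM/=; ring.
(* A weight vanishing on the punctured disk would have [m 0 = 0], against [c_0 m_0 = 1]. *)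
have pos r : 0 < r < 1 -> 0 < psi r.
  have [z|] := profile_dichotomy ww rw sw; last by move=> p /p.
  exfalso; have := cm 0%N; rewrite (_ : m 0%N = 0) ?mulr0 => [/eqP|].
    by rewrite eq_sym oner_eq0.
  apply: EFin_inj; rewrite -mE /moment; apply: integral0_eq => x.
  by rewrite /= in_itv/= => /z; rewrite -/psi => ->; rewrite mulr0.
exists (hprofile w); split.
- exact: hprofile_gt0.
- exact: convex_of_convex3 (hprofile_convex3 ww rw sw pos).
- move=> n; rewrite int_geom_quot -(@moment_laplace _ psi)// mE -EFinM.
  by rewrite cm.
- exact: hprofile_bounded.
Qed.

(** * Completeness and bounded point evaluation *)

Section hilbert.
Context (R : realType) (w : R[i] -> R) (psi : R -> R) (m c : nat -> R).
Hypotheses (psi0 : forall r, 0 <= r < 1 -> 0 <= psi r)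
  (cpsi : forall r, 0 < r < 1 -> {for r, continuous psi})
  (wpsi : forall z, cmod z < 1 -> w z = psi (cmod z))
  (mw : measurable_fun (@disk_xy R) (fun p : plane R => w (cplx p)))
  (mE : forall k, moment psi k = (m k)%:E)
  (cm : forall k, c k * m k = 1) (c0 : forall k, 0 <= c k)
  (cb : forall r, 0 <= r < 1 -> exists2 C : R, 0 <= C & forall k, c k * r ^+ k <= C).

Let m0 k : 0 <= m k := m_ge0 psi0 mE k.

(** A single term of the norm gives [|a_k|^2 <= C^2 c_k], because [c_k] is the inverse of [m_k];
    [c k + 1] replaces the square root of [c k]. *)
Lemma coef_le_psq a k C : 0 <= C -> psq m a k.+1 <= C ^+ 2 -> cmod (a k) <= C * (c k + 1).
Proof.
move=> C0 h.
have h1 : cmod (a k) ^+ 2 * m k <= C ^+ 2.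
  apply: le_trans h; rewrite /psq big_nat_recr//= lerDr.
  by apply: sumr_ge0 => j _; rewrite mulr_ge0 ?exprn_ge0 ?cmod_ge0.
rewrite -(@ler_pXn2r _ 2) ?nnegrE ?cmod_ge0 ?mulr_ge0 ?addr_ge0//.
have -> : cmod (a k) ^+ 2 = (cmod (a k) ^+ 2 * m k) * c k.
  by rewrite -mulrA [m k * _]mulrC cm mulr1.
apply: le_trans (ler_wpM2r (c0 k) h1) _.
rewrite exprMn ler_wpM2l ?exprn_ge0//.
by have := sqr_ge0 (c k); have := c0 k; rewrite !expr2; lra.
Qed.

Lemma coef_bound a C : 0 <= C -> (forall k, cmod (a k) <= C * (c k + 1)) ->
  forall r, 0 <= r < 1 -> exists2 D : R, 0 <= D & forall k, cmod (a k) * r ^+ k <= D.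
Proof.
move=> C0 ha r r01; have [D D0 hD] := cb r01; have [r0 r1] := andP r01.
exists (C * (D + 1)); first by rewrite mulr_ge0 ?addr_ge0.
move=> k; apply: le_trans (ler_wpM2r (exprn_ge0 k r0) (ha k)) _.
rewrite -mulrA ler_wpM2l// mulrDl mul1r lerD//.
by rewrite exprn_ile1 ?(ltW r1).
Qed.

Let sqfin a f : is_ps 1 a f -> (bergman_sqnorm w f < +oo)%E ->
  fine (bergman_sqnorm w f) = bergman_norm w f ^+ 2.
Proof.
by move=> hf fin; rewrite /bergman_norm sqr_sqrtr// fine_ge0// (sqnorm_ge0 psi0 cpsi wpsi mw mE hf).
Qed.

(** The norm controls every coefficient by [c k + 1], of subexponential growth; the tail estimate
    from index 0 then bounds the value. *)
Lemma bergman_eval z : cmod z < 1 -> exists M : R, forall f, bergman w f ->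
  cmod (f z) <= M * bergman_norm w f.
Proof.
move=> z1; pose r := (1 + cmod z) / 2.
have zn := cmod_ge0 z.
have r01 : 0 <= r < 1 by rewrite /r; apply/andP; split; lra.
have r0 : 0 < r by rewrite /r; lra.
have zr : cmod z < r by rewrite /r; lra.
have [D D0 hD] := cb r01.
have q01 : 0 <= cmod z / r < 1.
  by rewrite divr_ge0 ?(ltW r0)//= ltr_pdivrMr// mul1r.
exists ((D + 1) / (1 - cmod z / r)) => f [/holomorphic_ps[a hf] fin].
pose N := bergman_norm w f.
have N0 : 0 <= N by rewrite sqrtr_ge0.
have ak k : cmod (a k) <= N * (c k + 1).
  by apply: coef_le_psq => //; rewrite -(sqfin hf)//; exact: (psq_le psi0 cpsi wpsi mw mE).
have ar k : cmod (a k) * r ^+ k <= N * (D + 1).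
  apply: le_trans (ler_wpM2r (exprn_ge0 k (ltW r0)) (ak k)) _.
  rewrite -mulrA ler_wpM2l// mulrDl mul1r lerD//.
  by rewrite exprn_ile1 ?ltW//; case/andP: r01.
have := @is_ps_tail _ 1 r (cmod z / r) (N * (D + 1)) a f z 0 hf q01 _ ar _ z1.
rewrite divfK ?gt_eqF// lexx mulr_ge0 ?addr_ge0// => /(_ isT isT).
rewrite /psum big_ord0 subr0 expr0 mulr1 => h; apply: le_trans h _; rewrite -/N.
by rewrite le_eqVlt; apply/orP; left; apply/eqP; ring.
Qed.

(** A Cauchy sequence converges coefficientwise. Bounds on finite partial sums of the norm survive
    this limit, and the limit coefficients define a power series in the space. *)
Lemma bergman_complete : bergman_hilbert w.
Proof.
split.
  move=> f fB N0 z /disk_cmod z1; have [M hM] := bergman_eval z1.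
  have := hM f fB; rewrite N0 mulr0 => h; apply/eqP.
  by rewrite -cmod_eq0 eq_le h cmod_ge0.
move=> u uB uC.
have /choice[A hA] : forall n, exists a, is_ps 1 a (u n).
  by move=> n; apply: holomorphic_ps; case: (uB n).
have ufin n : (bergman_sqnorm w (u n) < +oo)%E by case: (uB n).
have dps n p : is_ps 1 (fun k => A n k - A p k) (fun z => u n z - u p z) by exact: is_psB.
have dfin n p : (bergman_sqnorm w (fun z => u n z - u p z)%R < +oo)%E.
  exact: (sqnormB_fin psi0 cpsi wpsi mw mE (hA n) (hA p)).
have dpsq n p K : psq m (fun k => A n k - A p k) K <= bergman_norm w (fun z => u n z - u p z) ^+ 2.
  by rewrite -(sqfin (dps n p))//; exact: (psq_le psi0 cpsi wpsi mw mE).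
have normlt (x : R) n p : bergman_norm w (fun z => u n z - u p z) < x -> forall K,
    psq m (fun k => A n k - A p k) K <= x ^+ 2.
  move=> hx K; apply: le_trans (dpsq n p K) _.
  by rewrite lerXn2r ?nnegrE ?sqrtr_ge0 ?(le_trans (sqrtr_ge0 _) (ltW hx))// ltW.
have /choice[a ha] : forall k, exists l, forall e : R, 0 < e ->
    exists N, forall n, (N <= n)%N -> cmod (A n k - l) < e.
  move=> k; apply: complex_complete => e e0.
  (* With tolerance [e / (c k + 2)] the factor [c k + 1] of [coef_le_psq] still leaves a strict
     inequality. *)
  have ck : 0 < c k + 2 by rewrite ltr_wpDl.
  have [N hN] := uC (e / (c k + 2)) (divr_gt0 e0 ck).
  exists N => p n Np Nn.
  have h := @coef_le_psq (fun k => A p k - A n k) k (e / (c k + 2)) (ltW (divr_gt0 e0 ck)) (normlt _ _ _ (hN p n Np Nn) _).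
  apply: le_lt_trans h _; rewrite mulrAC ltr_pdivrMr//.
  by rewrite ltr_pM2l// ltrD2l ltr1n.
have limpsq n K : psq m (fun k => A n k - A p k) K @[p --> \oo] --> psq m (fun k => A n k - a k) K.
  elim: K => [|K IH].
    have -> : (fun p => psq m (fun k => A n k - A p k) 0) = fun=> 0.
      by apply/funext => p; rewrite /psq big_geq.
    by rewrite /psq big_geq//; exact: cvg_cst.
  have E (b : nat -> R[i]) : psq m b K.+1 = psq m b K + cmod (b K) ^+ 2 * m K.
    by rewrite /psq big_nat_recr.
  under eq_fun do rewrite E.
  rewrite E; apply: cvgD => //; apply: cvgMl.
  have cc : cmod (A n K - A p K) @[p --> \oo] --> cmod (A n K - a K).
    apply/cvgrPdist_lt => e e0; have [N hN] := ha K e e0; exists N => // p /hN; apply: le_lt_trans.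
    have h1 := cmod_sub_ge (A n K - A p K) (A n K - a K).
    have h2 := cmod_sub_ge (A n K - a K) (A n K - A p K).
    have e1 : cmod (A n K - A p K - (A n K - a K)) = cmod (A p K - a K).
      by rewrite cmodBC; congr cmod; ring.
    have e2 : cmod (A n K - a K - (A n K - A p K)) = cmod (A p K - a K).
      by congr cmod; ring.
    by rewrite e1 in h1; rewrite e2 in h2; rewrite ler_norml; apply/andP; split; lra.
  by under eq_fun do rewrite expr2; rewrite expr2; exact: cvgM.
have small (e : R) : 0 < e -> exists N, forall n, (N <= n)%N -> forall K,
    psq m (fun k => A n k - a k) K <= e ^+ 2.
  move=> e0; have [N hN] := uC e e0; exists N => n Nn K.
  by apply: (cvgr_to_le (limpsq n K)); exists N => // p /= Np; exact: normlt (hN n p Nn Np) K.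
have psqa n K : psq m a K <= 2 * psq m (A n) K + 2 * psq m (fun k => A n k - a k) K.
  have -> : psq m a K = psq m (fun k => A n k + (-1) * (A n k - a k)) K.
    by apply: eq_bigr => k _; congr (cmod _ ^+ 2 * _); ring.
  apply: le_trans (psqD psi0 mE _ _ _) _; rewrite psqZ cmodN cmod1 expr1n mul1r//.
have [n1 hn1] := small 1 ltr01.
(* From [psqD], as the limit coefficients are those of [u n1] minus a difference of squared norm at
   most 1. *)
pose B := 2 * bergman_norm w (u n1) ^+ 2 + 2.
have B0 : 0 <= B by rewrite addr_ge0// mulr_ge0// sqr_ge0.
have aB K : psq m a K <= B.
  apply: le_trans (psqa n1 K) _; apply: lerD.
    by rewrite ler_pM2l// -(sqfin (hA n1))//; exact: (psq_le psi0 cpsi wpsi mw mE).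
  by have := hn1 n1 (leqnn _) K; rewrite expr1n; lra.
have B1 : 0 <= B + 1 by rewrite addr_ge0.
have aB2 k : cmod (a k) <= (B + 1) * (c k + 1).
  apply: coef_le_psq => //; apply: le_trans (aB _) _; rewrite expr2.
  by have := mulr_ge0 B0 B0; lra.
have [f hf] := is_ps_exists ltr01 (coef_bound B1 aB2).
exists f.
  split; first exact: ps_holomorphic hf.
  by apply: (le_lt_trans (sqnorm_le psi0 cpsi wpsi mw mE hf aB)); exact: ltry.
apply/cvgrPdist_lt => e e0; have e2 : 0 < e / 2 by rewrite divr_gt0.
have [N hN] := small _ e2; exists N => // n /= Nn.
rewrite sub0r normrN ger0_norm ?sqrtr_ge0//.
apply: (@le_lt_trans _ _ (e / 2)); last by lra.
have hd := is_psB (hA n) hf.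
have h := sqnorm_le psi0 cpsi wpsi mw mE hd (hN n Nn).
rewrite /bergman_norm -[leRHS]gtr0_norm// -sqrtr_sqr ler_wsqrtr//.
rewrite -lee_fin fineK//; apply/fin_numPlt.
rewrite (lt_le_trans _ (sqnorm_ge0 psi0 cpsi wpsi mw mE hd)) ?ltNyr//.
by rewrite (le_lt_trans h) ?ltry.
Qed.

End hilbert.

(** Undoing the substitution, the logarithm of the weight is [zeta (- 2 * ln r)] with
    [zeta t = t + ln (h t)], convex and nonincreasing. The identity [c_k m_k = 1] then yields the
    Hilbert space and its kernel. *)
Lemma laplace_implies_kernel (R : realType)
    (nu : {finite_measure set (measurableTypeR R) -> \bar R}) (h : R -> R) :
  (forall t : R, 0 < t -> 0 < h t) -> log_convex h ->
  (forall n : nat,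
    ((\int[nu]_(r in `[0%R, 1%R]) (geom_quot n r)%:E) *
     (\int[lebesgue_measure]_(t in `]0%R, +oo[) (expR (- n%:R * t) * h t)%:E) = 1)%E) ->
  (exists2 T : R, 0 < T &
    (ereal_sup [set (expR t * h t)%:E | t in `[T, +oo[] < +oo)%E) ->
  radial_log_subharmonic_bergman_kernel (S_nu nu).
Proof.
move=> h0 hconv hint [T T0 hT].
pose zeta t := t + ln (h t).
have lnh3 := convex3_of_convex hconv.
have zeta3 : convex3 zeta.
  by move=> x y z x0 xy yz; have := lnh3 x y z x0 xy yz; rewrite /zeta; lra.
have [B hB] : exists B, forall t, T <= t -> zeta t <= B.
  have [b [b0 hb]] : exists b : R, 0 < b /\ forall t, T <= t -> expR t * h t <= b.
    set S := ereal_sup _ in hT.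
    have hS t : T <= t -> ((expR t * h t)%:E <= S)%E.
      by move=> Tt; apply: ereal_sup_ubound; exists t => //=; rewrite in_itv/= Tt.
    have hT0 := hS T (lexx T).
    have ST : (0 < S)%E by apply: lt_le_trans hT0; rewrite lte_fin mulr_gt0 ?expR_gt0// h0.
    have Sf : S \is a fin_num by rewrite ge0_fin_numE// ltW.
    exists (fine S); split; first by rewrite -lte_fin fineK.
    by move=> t Tt; rewrite -lee_fin fineK// hS.
  exists (ln b) => t Tt; have t0 := lt_le_trans T0 Tt.
  rewrite /zeta -{1}(expRK t) -lnM ?posrE ?expR_gt0 ?h0//.
  by rewrite ler_ln ?posrE ?mulr_gt0 ?expR_gt0 ?h0// hb.
have zeta_ni := convex3_nonincreasing zeta3 hB.
have zeta_c := convex3_continuous zeta3.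
pose phi r := expR (zeta (- 2 * ln r)).
have lnr (r : R) : 0 < r < 1 -> 0 < - 2 * ln r.
  by move=> r01; rewrite mulNr oppr_gt0 pmulr_rlt0// ln_lt0.
have phi_nd r s : 0 < r -> r <= s -> s < 1 -> phi r <= phi s.
  move=> r0 rs s1; rewrite ler_expR; apply: zeta_ni.
    by apply: lnr; rewrite (lt_le_trans r0 rs).
  by rewrite !mulNr lerN2 ler_pM2l// ler_ln ?posrE// (lt_le_trans r0).
have cphi r : 0 < r < 1 -> {for r, continuous phi}.
  move=> r01; have [r0 r1] := andP r01.
  apply: (@continuous_comp _ _ _ (fun s => zeta (- 2 * ln s)) expR); last exact: continuous_expR.
  apply: (@continuous_comp _ _ _ (fun s : R => - 2 * ln s) zeta); last by apply: zeta_c; exact: lnr.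
  by apply: cont_scale; exact: continuous_ln.
pose S0 := [set phi r | r in [set r | 0 < r < 1]].
have half01 : 0 < (2^-1 : R) < 1 by apply/andP; split; lra.
have S0n : has_inf S0.
  split; first by exists (phi 2^-1), 2^-1.
  by exists 0 => _ [r _ <-]; exact: expR_ge0.
(* Since [phi] is nondecreasing, its infimum is its limit at 0, the value that gives both upper
   semicontinuity and the submean inequality there. *)
pose psi r := if r == 0 then inf S0 else phi r.
have psiE r : 0 < r -> psi r = phi r by move=> r0; rewrite /psi gt_eqF.
have psi00 : 0 <= psi 0.
  by rewrite /psi eqxx; apply: lb_le_inf; [case: S0n|move=> _ [r _ <-]; exact: expR_ge0].
have psi0 r : 0 <= r < 1 -> 0 <= psi r.
  move=> /andP[]; rewrite le_eqVlt => /predU1P[<- _//|r0 r1].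
  by rewrite psiE// expR_ge0.
have psi_nd r s : 0 <= r -> r <= s -> s < 1 -> psi r <= psi s.
  rewrite le_eqVlt => /predU1P[<-|r0 rs s1]; last by rewrite !psiE// ?phi_nd// (lt_le_trans r0).
  rewrite le_eqVlt => /predU1P[<-//|s0 s1].
  rewrite [leRHS]psiE// /psi eqxx; apply: inf_lbound => //; first by case: S0n.
  by exists s => //=; rewrite s0.
have cpsi r : 0 < r < 1 -> {for r, continuous psi}.
  move=> r01; have [r0 r1] := andP r01; apply/continuous_epsP => e e0.
  have [d d0 hd] := (continuous_epsP _ _).1 (cphi r r01) e e0.
  exists (Num.min d r); first by rewrite lt_min d0.
  move=> s; rewrite lt_min => /andP[s1 s2]; rewrite !psiE//; first exact: hd.
  by move: s2; rewrite ltr_norml => /andP[]; lra.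
pose w (z : R[i]) := psi (cmod z).
have wpsi z : cmod z < 1 -> w z = psi (cmod z) by [].
have mw : measurable_fun (@disk_xy R) (fun p : plane R => w (cplx p)).
  pose D : set (measurableTypeR R) := `[0, (1 : R)[%classic.
  have mpsi : measurable_fun D (psi : measurableTypeR R -> measurableTypeR R).
    apply/measurable_fun_itv_obnd_cbndP.
    exact: continuous_on_measurable.
  apply: (measurable_comp _ _ mpsi); first exact: measurable_itv.
    by move=> _ [p /disk_cmod p1 <-]; rewrite /D/= in_itv/= cmod_ge0.
  have cz : cmeas (@disk_xy R) (fun p => cplx p).
    by split; apply: measurable_funTS; [exact: measurable_fst|exact: measurable_snd].
  have := measurable_cmod_sq cz => msq.
  rewrite (_ : (fun _ => _) = (fun p : plane R => Num.sqrt (cmod (cplx p) ^+ 2))); last first.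
    by apply/funext => p; rewrite sqrtr_sqr ger0_norm ?cmod_ge0.
  apply: (measurableT_comp _ msq); apply: continuous_measurable_fun; exact: sqrt_continuous.
have hE t : 0 < t -> h t = expR (- t) * psi (expR (- (t / 2))).
  move=> t0; rewrite psiE ?expR_gt0// /phi expRK.
  rewrite (_ : - 2 * - (t / 2) = t); last by field.
  by rewrite /zeta expRD mulrA -expRD addNr expR0 mul1r lnK ?posrE ?h0.
have Mk k : ((kcoef nu k)%:E * moment psi k = 1)%E.
  by rewrite (moment_laplace k psi0 cpsi hE) -int_geom_quot hint.
have c0 := kcoef_ge0 nu.
have Mfin k : moment psi k \is a fin_num.
  rewrite ge0_fin_numE ?moment_ge0// ltey; apply/eqP => E; have := Mk k; rewrite E.
  have := c0 k; rewrite le_eqVlt => /predU1P[<-|cp].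
    by rewrite mul0e => /eqP; rewrite eqe eq_sym oner_eq0.
  by rewrite gt0_muley ?lte_fin.
pose m k := fine (moment psi k).
have mE k : moment psi k = (m k)%:E by rewrite /m fineK.
have cm k : kcoef nu k * m k = 1 by apply: EFin_inj; rewrite EFinM -mE Mk.
have cb := kernel_coef_bound nu.
have wrad : radial w.
  by move=> z _; rewrite /w normc_cmod cmodr ger0_norm ?cmod_ge0.
exists w; split; first split => //.
- by split => // z /disk_cmod z1; apply: psi0; rewrite cmod_ge0.
- split.
  + by move=> z _; rewrite /lne; case: ifP; rewrite ?ltNyy ?ltry// ltNyr.
  + move=> z /disk_cmod z1 a; rewrite -{1}(expRK a) ltr_expR_ln ?expR_gt0 ?psi0 ?cmod_ge0// => hz.
    (* As [psi] is nondecreasing, a bound at one radius beyond [cmod z] holds on the whole disk of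
       that radius. *)
    suff [s s1 hs] : exists2 s, cmod z < s < 1 & psi s < expR a.
      have [zs s1'] := andP s1.
      apply/nbhsC_ball; exists (s - cmod z); first by rewrite subr_gt0.
      move=> y yz; have ys : cmod y <= s.
        by rewrite -(subrK z y) (le_trans (cmodD _ _))// -lerBrDr ltW.
      have y1 := le_lt_trans ys s1'.
      rewrite -{1}(expRK a) ltr_expR_ln ?expR_gt0 ?psi0 ?cmod_ge0//.
      by apply: le_lt_trans hs; apply: psi_nd; rewrite ?cmod_ge0.
    have [z0|z0] := eqVneq (cmod z) 0.
      move: hz; rewrite /w z0 {1}/psi eqxx => hz.
      have [|_ [r r01 <-] hr] := @inf_adherent _ S0 (expR a - inf S0) _ S0n; first by rewrite subr_gt0.
      by exists r => //; rewrite psiE; [move: hr; rewrite subrKC|case/andP: r01].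
    have zp : 0 < cmod z by rewrite lt_neqAle eq_sym z0 cmod_ge0.
    have z01 : 0 < cmod z < 1 by rewrite zp.
    have e0 : 0 < expR a - psi (cmod z) by rewrite subr_gt0.
    have [d d0 hd] := (continuous_epsP _ _).1 (cpsi _ z01) _ e0.
    pose s := cmod z + Num.min d (1 - cmod z) / 2.
    have mp : 0 < Num.min d (1 - cmod z) by rewrite lt_min d0 subr_gt0.
    have [m1 m2] : Num.min d (1 - cmod z) <= d /\ Num.min d (1 - cmod z) <= 1 - cmod z.
      by rewrite !ge_min !lexx orbT.
    exists s; first by rewrite /s; apply/andP; split; lra.
    have : `|s - cmod z| < d by rewrite /s addrAC subrr add0r ger0_norm; lra.
    by move/hd; rewrite ltr_norml => /andP[_]; lra.
  + move=> z /disk_cmod z1; have pp := pi_gt0 R; have T2 := two_pi_ge0 R.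
    have Tp : 0 < (2 * pi)^-1 :> R by rewrite invr_gt0 mulr_gt0.
    have [z0|z0] := eqVneq (cmod z) 0.
      (* On circles centred at 0 the weight is constant, and monotonicity of [psi] gives the
         inequality. *)
      exists 1 => // rho /andP[r0 r1].
      have -> : z = 0 by apply/eqP; rewrite -cmod_eq0 z0.
      rewrite /circle_mean.
      have -> : (\int[lebesgue_measure]_(t in `[0%R, (2 * pi)%R])
          lne (w (0 + rho%:C * (cos t +i* sin t))%C)%:E = (ri 0 (2 * pi) (fun=> ln (psi rho)))%:E)%E.
        rewrite -ri_EFin; last by move=> t _; exact: cvg_cst.
        apply: eq_integral => t _; rewrite add0r /w.
        rewrite -[(cos t +i* sin t)%C]/(expi t) cmodM cmod_expi mulr1 cmodr gtr0_norm//.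
        by rewrite lne_EFin// psiE// expR_gt0.
      rewrite ri_cst// subr0 -EFinM [_ * (2 * pi)]mulrC mulrA mulVf ?mul1r; last first.
        by rewrite gt_eqF// mulr_gt0.
      have pr : 0 < psi rho by rewrite psiE// expR_gt0.
      rewrite -lne_EFin// /w cmod0; have := psi_nd 0 rho (lexx _) (ltW r0) r1.
      by rewrite -lee_fin => hp; rewrite lee_lne//= ?in_itv/= ?leey ?andbT ?lee_fin ?(ltW pr).
    have zp : 0 < cmod z by rewrite lt_neqAle eq_sym z0 cmod_ge0.
    have z01 : 0 < cmod z < 1 by rewrite zp.
    exists (Num.min (cmod z) (1 - cmod z)); first by rewrite lt_min zp subr_gt0.
    move=> rho /andP[r0]; rewrite lt_min => /andP[rz r1].
    (* The supporting line at [- 2 * ln (cmod z)] is a minorant affine in [ln (cmod _)], whose mean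
       over a circle avoiding 0 is its value at the centre. *)
    have [s hs] := convex3_subgradient zeta3 (lnr _ z01).
    pose v t := cmod (z + rho%:C%C * expi t).
    have v01 t : 0 < v t < 1.
      have h1 := cmodD z (rho%:C%C * expi t).
      have h2 := cmod_sub_ge z (- (rho%:C%C * expi t)).
      move: h1 h2; rewrite opprK cmodN cmodM cmod_expi mulr1 cmodr gtr0_norm// -/(v t).
      by move=> h1 h2; apply/andP; split; lra.
    have cv t : {for t, continuous v}.
      apply: cont_cmod; apply: rcontD; first exact: rcont_cst.
      by apply: rcontM; [exact: rcont_cst|exact: rcont_expi].
    have clnv t : {for t, continuous (fun t => ln (v t))}.
      apply: (@continuous_comp _ _ _ v (@ln R)); first exact: cv.
      by apply: continuous_ln; case/andP: (v01 t).
    pose l := - 2 * ln (cmod z).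
    pose G t := (zeta l - s * l) + (- 2 * s) * ln (v t).
    have cG2 t : {for t, continuous (fun t => (- 2 * s) * ln (v t))} by apply: cont_scale; exact: clnv.
    have cG t : {for t, continuous G} by apply: cvgD; [exact: cvg_cst|exact: cG2].
    have -> : lne (w z)%:E = ((2 * pi)^-1 * ri 0 (2 * pi) G)%:E.
      rewrite /w psiE// lne_EFin ?expR_gt0// expRK -/l.
      rewrite /G riD//; last by move=> t _; exact: cvg_cst.
      rewrite ri_cst// riZ// /v log_circle_mean ?(ltW r0)// subr0.
      have E (P A C D : R) : 0 < P -> (2 * P)^-1 * (A * (2 * P) + C * (2 * P * D)) = A + C * D.
        by move=> P0; field; rewrite gt_eqF.
      by rewrite E//; congr EFin; rewrite /l; ring.
    rewrite /circle_mean EFinM lee_wpmul2l ?lee_fin ?(ltW Tp)//.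
    rewrite -ri_EFin; last by move=> t _; exact: cG.
    apply: integral_le => t _; have /andP[v0 v1] := v01 t.
    rewrite -[(cos t +i* sin t)%C]/(expi t) /w -/(v t) psiE// lne_EFin ?expR_gt0// expRK lee_fin.
    have := hs _ (lnr _ (v01 t)); rewrite -/l /G; lra.
- have : (moment psi 0 < +oo)%E by rewrite mE ltry.
  apply: le_lt_trans; apply: integral_le => r; rewrite /= in_itv/= => /andP[r0 r1].
  rewrite lee_fin /w cmodr gtr0_norm// double0 expr1 ler_wpM2r ?psi0 ?(ltW r0)//; lra.
split.
  split; first exact: (bergman_complete psi0 cpsi wpsi mw mE cm c0 cb).
  by move=> z /disk_cmod; exact: (bergman_eval psi0 cpsi wpsi mw mE cm c0 cb).
exists (S_nu nu) => //.
(* By [c_k m_k = 1] the squared norm of the kernel is the sum of [c_k |z|^(2k)], dominated by a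
   geometric series of ratio [cmod z / r]. *)
have kfin z : cmod z < 1 -> (bergman_sqnorm w (fun l => S_nu nu l z) < +oo)%E.
  move=> z1; have zn := cmod_ge0 z.
  pose r := (1 + cmod z) / 2.
  have r01 : 0 <= r < 1 by rewrite /r; apply/andP; split; lra.
  have r0 : 0 < r by rewrite /r; lra.
  have zr : cmod z < r by rewrite /r; lra.
  have [C C0 hC] := cb r r01.
  have q01 : 0 <= cmod z / r < 1.
    apply/andP; split; first by rewrite divr_ge0 ?(ltW r0).
    by rewrite ltr_pdivrMr// mul1r.
  apply: (@le_lt_trans _ _ (C / (1 - cmod z / r))%:E); last exact: ltry.
  apply: (sqnorm_le psi0 cpsi wpsi mw mE (kernel_ps nu z1)) => n.
  apply: (@le_trans _ _ (\sum_(0 <= k < n) C * (cmod z / r) ^+ k)).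
    apply: ler_sum => k _.
    rewrite cmodM cmodr ger0_norm// cmodX cmod_conj.
    have -> : (kcoef nu k * cmod z ^+ k) ^+ 2 * m k = (kcoef nu k * m k) * (kcoef nu k * cmod z ^+ k) * cmod z ^+ k by ring.
    rewrite cm mul1r expr_div_n mulrA ler_pdivlMr ?exprn_gt0//.
    rewrite mulrAC ler_wpM2r ?exprn_ge0//.
    apply: le_trans (hC k); rewrite mulrAC ler_piMr ?mulr_ge0 ?exprn_ge0 ?(ltW r0)//.
    by rewrite exprn_ile1 ?(ltW r0)//; lra.
  rewrite -mulr_sumr ler_wpM2l//.
  by have := @geo_sum_le R (cmod z / r) 0 n q01 (leq0n n); rewrite expr0 mul1r.
split.
  move=> z /disk_cmod z1; split; last exact: kfin.
  exact: ps_holomorphic (kernel_ps nu z1).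
move=> f z [/holomorphic_ps[a ha] ffin] /disk_cmod z1.
apply/esym; apply: (inner_product psi0 cpsi wpsi mw mE ha (kernel_ps nu z1) ffin (kfin z z1)).
move=> e e0; have [n hn] := ha z z1 e e0; exists n => p /hn.
congr (cmod (_ - _) < _); apply: eq_bigr => k _.
rewrite conj_coef.
have -> : a k * ((kcoef nu k)%:C%C * z ^+ k) * (m k)%:C%C = a k * z ^+ k * ((kcoef nu k)%:C%C * (m k)%:C%C) by ring.
by rewrite -rmorphM/= cm mulr1.
Qed.

Theorem theorem1p2 (R : realType)
    (nu : {finite_measure set (measurableTypeR R) -> \bar R})
    (nu_supp : nu (~` `[0, 1]) = 0%E)
    (nu_inf : (\int[nu]_(r in `[0%R, 1%R]) inv_one_minus r = +oo)%E) :
  radial_log_subharmonic_bergman_kernel (S_nu nu) <->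
  exists h : R -> R,
    [/\ forall t : R, 0 < t -> 0 < h t,
        log_convex h,
        forall n : nat,
          ((\int[nu]_(r in `[0%R, 1%R]) (geom_quot n r)%:E) *
           (\int[lebesgue_measure]_(t in `]0%R, +oo[)
              (expR (- n%:R * t) * h t)%:E) = 1)%E &
        exists2 T : R, 0 < T &
          (ereal_sup [set (expR t * h t)%:E | t in `[T, +oo[] < +oo)%E].
Proof.
split; first exact: kernel_implies_laplace.
by move=> [h [h0 hc hi hT]]; exact: (laplace_implies_kernel h0 hc hi hT).
Qed.
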